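(* Let $(M,F)$ be a Finsler manifold. The group of conformal transformations of $(M,F)$ coincides with the group of Mobius transformations of $(M,F)$ if and only if every conformal transformation of $(M,F)$ maps all geodesic circles of $(M,F)$ to geodesic circles.
   Context: Finsler manifold: $M$ is a connected smooth $n$-dimensional manifold, $TM_0$ the bundle of nonzero tangent vectors, $\pi:TM_0\to M$ the projection, $\pi^*TM$ the pull-back bundle. A Finsler structure is $F:TM\to[0,\infty)$, smooth on $TM_0$, with $F(x,\lambda y)=\lambda F(x,y)$ for all $\lambda>0$, and $g_{ij}(x,y)=\frac12\frac{\partial^2F^2}{\partial y^i\partial y^j}$ positive definite on $TM_0$; $g$ is an inner product on $\pi^*TM$, with inverse $g^{ij}$. Cartan connection: $G^i=\frac14 g^{il}\{[F^2]_{x^ky^l}y^k-[F^2]_{x^l}\}$, $G^j_i=\partial G^j/\partial y^i$, $\delta_i=\frac{\delta}{\delta x^i}=\frac{\partial}{\partial x^i}-G^j_i\frac{\partial}{\partial y^j}$, $\Gamma^i_{jk}=\frac12g^{il}(\delta_jg_{lk}+\delta_kg_{jl}-\delta_lg_{jk})$, $C^i_{jk}=\frac12g^{il}\frac{\partial g_{jk}}{\partial y^l}$. The Cartan connection ${}^c\nabla$ is the linear connection on $\pi^*TM$ with ${}^c\nabla_{\delta_k}\frac{\partial}{\partial x^j}=\Gamma^i_{jk}\frac{\partial}{\partial x^i}$ and ${}^c\nabla_{\partial/\partial y^k}\frac{\partial}{\partial x^j}=C^i_{jk}\frac{\partial}{\partial x^i}$. The map $\varrho=\pi_*:TTM_0\to\pi^*TM$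 sends $\delta_i\mapsto\frac{\partial}{\partial x^i}$, $\frac{\partial}{\partial y^i}\mapsto0$. For $\varphi\in C^\infty(M)$ with $\varphi_i=\partial\varphi/\partial x^i$: $\nabla\varphi=g^{ij}(x,y)\varphi_j\frac{\partial}{\partial x^i}\in\Gamma(\pi^*TM)$, $\|\mathrm{grad}\,\varphi\|^2=g^{ij}\varphi_i\varphi_j$, and $\Delta\varphi=g^{ij}\big(\frac{\partial^2\varphi}{\partial x^i\partial x^j}-(\Gamma^k_{ij}+C^k_{ij})\varphi_k\big)$ (the sum of the horizontal and vertical Laplacians). Conformal maps: a diffeomorphism $f:(M,F)\to(M,\bar F)$ between Finsler structures on $M$ is conformal if $f^*\bar F=e^{\varphi}F$ for some smooth $\varphi:M\to\mathbb R$, where $(f^*\bar F)(x,y)=\bar F(f(x),df_x(y))$. Its Schwarzian derivative is the linear map $S_F(f):\Gamma(TTM_0)\to\Gamma(\pi^*TM)$ on vector fields $\hat X$ on $TM_0$, $$S_F(f)\hat X={}^c\nabla_{\hat X}(\nabla\varphi)-g(\nabla\varphi,\varrho\hat X)\nabla\varphi-\tfrac1n\big(\Delta\varphi-\|\mathrm{grad}\,\varphi\|^2\big)\varrho\hat X .$$ The conformal map $f$ is a Mobius mapping if $S_F(f)=0$, i.e. $S_F(f)\hat X=0$ for all $\hat X$. A conformal (resp. Mobius) transformation of $(M,F)$ is a diffeomorphism $f:M\to M$ which is a conformal (resp. Mobius) map $(M,F)\to(M,F)$. Geodesic circles: let $c:I\subset\mathbb R\to M$ be a smooth curve parameterized by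 $F$-arc length $s$, $X=\dot c$, and let $\nabla_{\dot c}$ be the Cartan covariant derivative along $c$ (taken along the lift $(c,\dot c)$ in $TM_0$). The Frenet curvatures $\kappa_1,\kappa_2$ are defined by $\nabla_{\dot c}X=\kappa_1Y$, $\nabla_{\dot c}Y=-\kappa_1X+\kappa_2Z$, with $X,Y,Z$ orthonormal with respect to $g_{\dot c}$. The curve $c$ is a geodesic circle if $\kappa_1$ is constant and $\kappa_2$ vanishes identically, i.e. either $c$ is a geodesic ($\kappa_1=0$), or there are a unit normal field $Y$ along $c$ and a constant $\kappa>0$ with $\nabla_{\dot c}X=\kappa Y$ and $\nabla_{\dot c}Y=-\kappa X$. A map sends geodesic circles to geodesic circles if the image of each geodesic circle, reparameterized by arc length, is a geodesic circle. *)

(* Defs.v *)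
From HB Require Import structures.
From mathcomp Require Import all_boot all_order all_algebra.
From mathcomp Require Import all_classical all_reals all_analysis.

Set Implicit Arguments.
Unset Strict Implicit.
Unset Printing Implicit Defensive.

Import Order.TTheory GRing.Theory Num.Theory.
Import numFieldNormedType.Exports.

Local Open Scope classical_set_scope.
Local Open Scope ring_scope.

Section Smoothness.
Context {R : realType} {V W : normedModType R}.

(* Meaningful for U open.  All V used below are finite-dimensional, so that
   directional derivatives amount to partial derivatives. *)
Fixpoint Ck (k : nat) (U : set V) (f : V -> W) : Prop :=
  {in U, continuous f} /\
  if k is k'.+1 then
    forall v, (forall x, U x -> derivable f x v) /\
              Ck k' U (fun x => 'D_v f x)
  else True.

Definition smooth_on (U : set V) (f : V -> W) : Prop := forall k, Ck k U f.

End Smoothness.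

Record smooth_manifold (R : realType) (n : nat) := SmoothManifold {
  points :> topologicalType;
  chart : Type;
  chart_dom : chart -> set points;
  chart_map : chart -> points -> 'rV[R]_n;
  chart_inv : chart -> 'rV[R]_n -> points;
  manifold_hausdorff : hausdorff_space points;
  manifold_second_countable : @second_countable points;
  manifold_connected : connected [set: points];
  chart_dom_open : forall a, open (chart_dom a);
  chart_cover : forall p, exists a, chart_dom a p;
  chart_cod_open : forall a, open (chart_map a @` chart_dom a);
  chart_mapK : forall a, {in chart_dom a, cancel (chart_map a) (chart_inv a)};
  chart_map_continuous : forall a, {in chart_dom a, continuous (chart_map a)};
  chart_inv_continuous : forall a, {in chart_map a @` chart_dom a,
    continuous (chart_inv a)};
  transition_smooth : forall a b,
    smooth_on (chart_map a @` (chart_dom a `&` chart_dom b))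
              (chart_map b \o chart_inv a) }.

Arguments chart {R n} M : rename.
Arguments chart_dom {R n M} a : rename.
Arguments chart_map {R n M} a p : rename.
Arguments chart_inv {R n M} a x : rename.

Section Manifold.
Context {R : realType} {n : nat} (M : smooth_manifold R n).
Local Notation E := 'rV[R]_n.

Definition chart_cod (a : chart M) : set E := chart_map a @` chart_dom a.

(* The slit tangent bundle TM_0 over the chart a, in coordinates (x, y). *)
Definition slit (a : chart M) : set (E * E) :=
  [set z | chart_cod a z.1 /\ z.2 != 0].

Definition tangent_map (h : E -> E) (z : E * E) : E * E :=
  (h z.1, 'D_(z.2) h z.1).

Definition transition (a b : chart M) : E -> E := chart_map b \o chart_inv a.

Definition smooth_function (phi : M -> R) : Prop :=
  forall a, smooth_on (chart_cod a) (phi \o chart_inv a).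

Definition local_rep (f : M -> M) (a b : chart M) : E -> E :=
  chart_map b \o f \o chart_inv a.

Definition smooth_map (f : M -> M) : Prop :=
  continuous f /\
  forall a b, smooth_on
    [set x | chart_cod a x /\ chart_dom b (f (chart_inv a x))] (local_rep f a b).

Definition diffeomorphism (f : M -> M) : Prop :=
  smooth_map f /\
  exists f' : M -> M, [/\ cancel f f', cancel f' f & smooth_map f'].

(* A vector field on TM_0, given by its components (u, v) standing for
   u^k d/dx^k + v^k d/dy^k in the coordinates (x, y) of each chart; the
   components in two charts are related by the differential of the induced
   change of coordinates of TM. *)
Record slit_vector_field := SlitVectorField {
  field_comp :> chart M -> E * E -> E * E;
  field_smooth : forall a, smooth_on (slit a) (field_comp a);
  field_transition : forall a b z, slit a z -> chart_dom b (chart_inv a z.1) ->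
    field_comp b (tangent_map (transition a b) z) =
    'D_(field_comp a z) (tangent_map (transition a b)) z }.

End Manifold.

Section LocalGeometry.
Context {R : realType} {n : nat}.
Local Notation E := 'rV[R]_n.

Definition basis_vec (i : 'I_n) : E := delta_mx 0 i.
Definition dx (i : 'I_n) (h : E * E -> R) (z : E * E) : R :=
  'D_(basis_vec i, 0) h z.
Definition dy (i : 'I_n) (h : E * E -> R) (z : E * E) : R :=
  'D_(0, basis_vec i) h z.

(* F is the expression of a Finsler structure in one chart, z = (x, y). *)
Variable F : E * E -> R.

Definition F2 (z : E * E) : R := F z ^+ 2.

Definition metric (z : E * E) : 'M[R]_n :=
  \matrix_(i, j) (2^-1 * dy j (dy i F2) z).

Definition finsler_inner (z : E * E) (u v : E) : R :=
  (u *m metric z *m v^T) 0 0.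

Definition metric_inv (z : E * E) : 'M[R]_n := invmx (metric z).

Definition spray (i : 'I_n) (z : E * E) : R :=
  4^-1 * \sum_l metric_inv z i l *
    (\sum_k dy l (dx k F2) z * z.2 0 k - dx l F2 z).

(* nonlinear j i is G^j_i *)
Definition nonlinear (j i : 'I_n) : E * E -> R := dy i (spray j).

Definition hderiv (i : 'I_n) (h : E * E -> R) (z : E * E) : R :=
  dx i h z - \sum_j nonlinear j i z * dy j h z.

Definition Gamma (i j k : 'I_n) (z : E * E) : R :=
  2^-1 * \sum_l metric_inv z i l *
    (hderiv j (fun w => metric w l k) z + hderiv k (fun w => metric w j l) z
     - hderiv l (fun w => metric w j k) z).

Definition Cartan (i j k : 'I_n) (z : E * E) : R :=
  2^-1 * \sum_l metric_inv z i l * dy l (fun w => metric w j k) z.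

(* Zeroth-order part of the Cartan connection in the direction X = (u, v) at
   z: since d/dx^k = delta_k + G^l_k d/dy^l, the vector
   u^k d/dx^k + v^k d/dy^k has delta-components u^k and vertical components
   v^k + G^k_l u^l. *)
Definition connection_form (z X : E * E) (V : E) : E :=
  \row_i \sum_j \sum_k
    (Gamma i j k z * V 0 j * X.1 0 k +
     Cartan i j k z * V 0 j *
       (X.2 0 k + \sum_l nonlinear k l z * X.1 0 l)).

Definition cartan_nabla (X : E * E -> E * E) (V : E * E -> E) (z : E * E) : E :=
  'D_(X z) V z + connection_form z (X z) (V z).

(* phi is the expression of a function on M in the chart. *)
Variable phi : E -> R.

Definition partial (i : 'I_n) (h : E -> R) (x : E) : R := 'D_(basis_vec i) h x.

Definition gradient (z : E * E) : E :=
  \row_i \sum_j metric_inv z i j * partial j phi z.1.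

Definition gradient_norm2 (z : E * E) : R :=
  \sum_i \sum_j metric_inv z i j * partial i phi z.1 * partial j phi z.1.

Definition laplacian (z : E * E) : R :=
  \sum_i \sum_j metric_inv z i j *
    (partial i (partial j phi) z.1 -
     \sum_k (Gamma k i j z + Cartan k i j z) * partial k phi z.1).

Definition schwarzian (X : E * E -> E * E) (z : E * E) : E :=
  cartan_nabla X gradient z
  - finsler_inner z (gradient z) (X z).1 *: gradient z
  - (n%:R^-1 * (laplacian z - gradient_norm2 z)) *: (X z).1.

End LocalGeometry.

(* TM is the union of the chart_cod a * 'rV_n glued along the maps
   tangent_map (transition a b); a function on TM is thus a family of functions
   of (x, y), one for each chart, compatible with these maps. *)
Record finsler (R : realType) (n : nat) (M : smooth_manifold R n) := Finsler {
  finsler_fun :> chart M -> 'rV[R]_n * 'rV[R]_n -> R;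
  finsler_transition : forall a b z,
    chart_cod a z.1 -> chart_dom b (chart_inv a z.1) ->
    finsler_fun b (tangent_map (transition a b) z) = finsler_fun a z;
  finsler_ge0 : forall a z, chart_cod a z.1 -> 0 <= finsler_fun a z;
  finsler_smooth : forall a, smooth_on (slit a) (finsler_fun a);
  finsler_homogeneous : forall a x y (l : R), chart_cod a x -> 0 < l ->
    finsler_fun a (x, l *: y) = l * finsler_fun a (x, y);
  finsler_posdef : forall a z, slit a z ->
    forall v, v != 0 -> 0 < finsler_inner (finsler_fun a) z v v }.

Section Transformations.
Context {R : realType} {n : nat} {M : smooth_manifold R n}.
Implicit Types (F Fbar : finsler M) (f : M -> M).
Local Notation E := 'rV[R]_n.

Definition conformal_factor F Fbar f (phi : M -> R) : Prop :=
  smooth_function phi /\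
  forall a b z, chart_cod a z.1 -> chart_dom b (f (chart_inv a z.1)) ->
    Fbar b (tangent_map (local_rep f a b) z) =
    expR (phi (chart_inv a z.1)) * F a z.

Definition conformal_map F Fbar f : Prop :=
  diffeomorphism f /\ exists phi, conformal_factor F Fbar f phi.

Definition mobius_map F Fbar f : Prop :=
  diffeomorphism f /\
  exists2 phi, conformal_factor F Fbar f phi &
    forall (X : slit_vector_field M) a z, slit a z ->
      schwarzian (F a) (phi \o chart_inv a) (X a) z = 0.

Definition conformal_transformations F : set (M -> M) :=
  [set f | conformal_map F F f].

Definition mobius_transformations F : set (M -> M) :=
  [set f | mobius_map F F f].

Definition open_interval (I : set R) : Prop :=
  [/\ I !=set0, open I & is_interval I].

Definition smooth_curve (I : set R) (c : R -> M) : Prop :=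
  {in I, continuous c} /\
  forall a, smooth_on (I `&` c @^-1` chart_dom a) (chart_map a \o c).

Definition velocity (c : R -> M) (a : chart M) (t : R) : E :=
  derive1 (chart_map a \o c) t.

Definition velocity_lift (c : R -> M) (a : chart M) (t : R) : E * E :=
  (chart_map a (c t), velocity c a t).

Definition field_along (I : set R) (c : R -> M) (Y : chart M -> R -> E)
    : Prop :=
  (forall a, smooth_on (I `&` c @^-1` chart_dom a) (Y a)) /\
  forall a b t, I t -> chart_dom a (c t) -> chart_dom b (c t) ->
    Y b t = 'D_(Y a t) (transition a b) (chart_map a (c t)).

Definition nabla_along F (c : R -> M) (Y : chart M -> R -> E)
    (a : chart M) (t : R) : E :=
  derive1 (Y a) t +
  connection_form (F a) (velocity_lift c a t)
    (derive1 (velocity_lift c a) t) (Y a t).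

Definition geodesic_circle F (I : set R) (c : R -> M) : Prop :=
  [/\ open_interval I, smooth_curve I c,
      forall a t, I t -> chart_dom a (c t) -> F a (velocity_lift c a t) = 1 &
      (forall a t, I t -> chart_dom a (c t) ->
         nabla_along F c (velocity c) a t = 0) \/
      (exists Y (kappa : R), [/\ field_along I c Y, 0 < kappa &
         forall a t, I t -> chart_dom a (c t) ->
           [/\ finsler_inner (F a) (velocity_lift c a t) (Y a t) (Y a t) = 1,
               finsler_inner (F a) (velocity_lift c a t)
                 (velocity c a t) (Y a t) = 0,
               nabla_along F c (velocity c) a t = kappa *: Y a t &
               nabla_along F c Y a t = - kappa *: velocity c a t]])].

Definition maps_geodesic_circles F f : Prop :=
  forall (I : set R) (c : R -> M), geodesic_circle F I c ->
    exists (J : set R) (s : R -> R),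
      [/\ open_interval J, smooth_on J s, forall t, J t -> 0 < derive1 s t,
          s @` J = I & geodesic_circle F J (f \o c \o s)].

End Transformations.

(* Main.v *)
(* Write W for the gradient of phi, B for the metric at the point (x, y) of the
   slit bundle, N for the covariant derivative of W along the lift of a curve and
   C = T (0, _) for the vertical derivative of B, a symmetric tensor with
   C(y, _, _) = 0.

   A unit speed curve is a geodesic circle iff the covariant derivative of its
   acceleration is parallel to its velocity.  If c is a circle and f is conformal
   with factor phi, computing this derivative for f o c (reparametrized) leaves
   N - phi_y W modulo y, so f o c is a circle iff N - phi_y W is parallel to y
   along c.  This is the Schwarzian of f in a direction (y, v).

   If the Schwarzian vanishes on all fields, the vertical field (0, W) gives
   C(W, W, _) = 0, that is D_(0, W) W = 0.  Then W is constant along the ray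
   y + t W, and letting t tend to infinity W(x, w) = w for w = W(x, y); so
   B_(x, W)(W, _) = d phi, and differentiating in y gives D_(0, u) W = 0, that is
   C(W, _, _) = 0.  Hence N does not depend on v, and the geodesic spray, as a
   second test field, gives the condition on N for every curve.

   Conversely a circle exists through every unit y with every acceleration
   A orthogonal to y.  The dependence of N on A gives C(W, _, _) = 0, and then
   the condition on N is the Schwarzian equation for horizontal arguments (y, w).
   Its derivative in the direction (0, u) polarizes y to u, up to a term in
   D_(y, 0) W that the nonlinear connection absorbs. *)

Require Import Defs.
From HB Require Import structures.
From mathcomp Require Import all_boot all_order all_algebra.
From mathcomp Require Import all_classical all_reals all_analysis.
From mathcomp Require Import ring lra.

Set Implicit Arguments.
Unset Strict Implicit.
Unset Printing Implicit Defensive.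

Import Order.TTheory GRing.Theory Num.Theory.
Import numFieldNormedType.Exports.

Local Open Scope classical_set_scope.
Local Open Scope ring_scope.

(** * Maps of class C^k *)

(** Covariant derivatives are never compared through Christoffel symbols. Pairing with a test vector
    turns the connection into a Koszul formula ([connection_inner]) that contains only derivatives
    of the metric, and along the lift of a curve the nonlinear connection drops out of it. The
    conformal change of the covariant derivative is then found by differentiating the identity [hF],
    that is F' o dh = e^phi F, and it reads as in Riemannian geometry. Changes of charts are the
    case of trivial factor, applied to the identity map.

    The Schwarzian equation is given only on vector fields that are smooth on the whole slit bundle,
    so the two test fields must be built from F and phi alone and shown to be compatible with all
    charts. The ray argument needs a ray that avoids the zero vector, which is ensured where D_y phi
    > 0; the other signs follow by replacing phi with - phi and by continuity. In the converse
    direction the computation stays in one chart and ends with a tensor identity with some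
    multiplier; its trace shows that the multiplier is the coefficient in the definition of the
    Schwarzian. *)

Section DirectionalDerivatives.
Context {R : realType}.
Implicit Types U V W Z : normedModType R.

Section affine_substitution.
Context {U V W : normedModType R} (f : V -> W) (L : U -> V) (x v : U) (w : V).
Hypothesis Lw : forall s : R, L (s *: v + x) = s *: w + L x.

Let quotE : (fun h : R => h^-1 *: (((f \o L) \o shift x) (h *: v) - (f \o L) x))
  = (fun h : R => h^-1 *: ((f \o shift (L x)) (h *: w) - f (L x))).
Proof. by apply/funext => h /=; rewrite Lw. Qed.

(** By [Lw] both difference quotients are the same function of [h], so this substitution rule
    precedes any chain rule. It restricts functions to lines and, later, rescales the fibre
    variable. *)
Lemma derivable_affine : derivable f (L x) w -> derivable (f \o L) x v.
Proof. by rewrite /derivable quotE. Qed.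

Lemma derive_affine : 'D_v (f \o L) x = 'D_w f (L x).
Proof. by rewrite /derive quotE. Qed.

End affine_substitution.

Lemma is_derive_cvg V W (f : V -> W) x v l :
  (fun h : R => h^-1 *: ((f \o shift x) (h *: v) - f x)) @ 0^' --> l ->
  is_derive x v f l.
Proof.
move=> fl; apply: DeriveDef; first by apply/cvg_ex; exists l.
exact: cvg_lim fl.
Qed.

Lemma mvt_line V (f : V -> R) x h :
  (forall t : R, 0 <= t <= 1 -> derivable f (x + t *: h) h) ->
  exists2 t : R, 0 <= t <= 1 & f (x + h) - f x = 'D_h f (x + t *: h).
Proof.
move=> df; pose L (t : R) := x + t *: h.
have LE t s : L (s *: 1 + t) = s *: h + L t.
  by rewrite /L [s%:A]mulr1 scalerDl addrCA.
have dL (t : R) : 0 <= t <= 1 -> is_derive t 1 (f \o L) ('D_h f (L t)).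
  move=> t01; apply: DeriveDef; first exact/(derivable_affine (LE t))/df.
  exact: derive_affine.
have cL : {within `[0 : R, 1], continuous (f \o L)}.
  by apply: derivable_within_continuous => t; rewrite in_itv/= => /dL[].
have [|t t01] := @MVT R (f \o L) (fun t => 'D_h f (L t)) 0 1 ltr01 _ cL.
  by move=> t; rewrite in_itv/= => /andP[t0 t1]; apply: dL; rewrite !ltW.
rewrite /L /= scale1r scale0r addr0 subr0 mulr1 => ->; exists t => //.
by move: t01; rewrite in_itv/= => /andP[t0 t1]; rewrite !ltW.
Qed.

Lemma deriveZv V W (f : V -> W) x v (k : R) :
  derivable f x v -> derivable f x (k *: v) /\ 'D_(k *: v) f x = k *: 'D_v f x.
Proof.
move=> df; have [->|k0] := eqVneq k 0.
  by rewrite !scale0r derive0; split => //; exact: derivable0.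
have kE : (fun h : R => h^-1 *: ((f \o shift x) (h *: (k *: v)) - f x)) =
    (k \*: (fun h : R => h^-1 *: ((f \o shift x) (h *: v) - f x)))
    \o (fun h => h * k).
  apply/funext => h /=; rewrite !scalerA.
  by rewrite invfM [h^-1 * _]mulrC mulrA divff// mul1r.
have cvk : (fun h : R => h^-1 *: ((f \o shift x) (h *: (k *: v)) - f x))
    @ 0^' --> k *: 'D_v f x.
  rewrite kE; apply: (@cvg_comp _ _ _ (fun h : R => h * k) _ 0^' 0^').
    move=> A /=; rewrite /dnbhs !nbhs_simpl /within /= => A0.
    have ck : (fun h : R => h * k) @ (0 : R) --> (0 : R).
      by rewrite -[X in _ --> X](mul0r k); apply: cvgM; [exact: cvg_id|exact: cvg_cst].
    have := ck _ A0; rewrite !nbhs_simpl /=; apply: filterS => h Ah h0.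
    by apply: Ah; rewrite mulf_neq0.
  by apply: cvgZr; move: df; rewrite /derivable.
by split; [apply/cvg_ex; exists (k *: 'D_v f x)|exact: cvg_lim cvk].
Qed.

(** The increment along [u + v] is split into a step along [u] and a step along [v]; the second one,
    whose quotient is [g], is evaluated by the mean value theorem and the continuity of ['D_v f] at
    [x]. *)
Lemma derive_additive V (f : V -> R) x u v (U : set V) : open U -> U x ->
  (forall y, U y -> derivable f y v) -> {for x, continuous ('D_v f)} ->
  derivable f x u ->
  derivable f x (u + v) /\ 'D_(u + v) f x = 'D_u f x + 'D_v f x.
Proof.
move=> oU Ux dfv cfv dfu.
have cv : (fun h : R => h^-1 *: ((f \o shift x) (h *: (u + v)) - f x)) @ 0^' -->
    'D_u f x + 'D_v f x.
  pose g (h : R) := h^-1 *: (f (x + h *: u + h *: v) - f (x + h *: u)).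
  have gv : g @ 0^' --> 'D_v f x.
    apply/cvgrPdist_lt => e e0.
    have := cfv; move/cvgrPdist_lt => /(_ _ e0) /nbhs_normP[d /= d0 dP].
    have /nbhs_normP[d' /= d'0 d'U] : nbhs x U by exact: open_nbhs_nbhs.
    pose m := Num.min d d'; have m0 : 0 < m by rewrite lt_min d0.
    (* The [+ 1] keeps [K] positive when [u = v = 0], so that the smallness of [h] can be imposed by
       dividing by [K]. *)
    pose K := `|u| + `|v| + 1; have K0 : 0 < K by rewrite ltr_wpDl.
    near=> h.
    have h0 : h != 0 by near: h; exact: nbhs_dnbhs_neq.
    have hm : `|h| * K < m.
      rewrite -ltr_pdivlMr//; near: h; apply: dnbhs0_lt; exact: divr_gt0.
    have near_seg (t : R) : 0 <= t <= 1 -> `|x - (x + h *: u + t *: (h *: v))| < m.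
      move=> /andP[t0 t1]; apply: le_lt_trans hm.
      rewrite -addrA opprD addNKr normrN (le_trans (ler_normD _ _))// !normrZ.
      rewrite /K !mulrDr mulr1 (ger0_norm t0).
      apply: ler_wpDr => //; rewrite lerD2l.
      by rewrite -[leRHS]mul1r ler_wpM2r// mulr_ge0.
    have [t t01 tE] : exists2 t : R, 0 <= t <= 1 &
        f (x + h *: u + h *: v) - f (x + h *: u) =
        h * 'D_v f (x + h *: u + t *: (h *: v)).
      have dh (t : R) : 0 <= t <= 1 -> derivable f (x + h *: u + t *: (h *: v)) v.
        move=> t01; apply/dfv/d'U/(lt_le_trans (near_seg t t01)).
        by rewrite ge_min lexx orbT.
      have [|t t01 ->] := @mvt_line V f (x + h *: u) (h *: v).
        by move=> t t01; have [] := deriveZv h (dh t t01).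
      by exists t => //; have [_ ->] := deriveZv h (dh t t01).
    rewrite /g tE [_ *: _]mulKf//; apply: dP.
    by apply/(lt_le_trans (near_seg t t01)); rewrite ge_min lexx.
  have -> : (fun h : R => h^-1 *: ((f \o shift x) (h *: (u + v)) - f x)) =
      (fun h : R => h^-1 *: ((f \o shift x) (h *: u) - f x)) \+ g.
    apply/funext => h /=; rewrite /g -scalerDr; congr (_ *: _).
    by rewrite [x + h *: u]addrC [RHS]addrC subrKA scalerDr [_ + x + _]addrAC.
  by apply: cvgD; [move: dfu; rewrite /derivable|exact: gv].
by split; [apply/cvg_ex; exists ('D_u f x + 'D_v f x)|exact: cvg_lim cv].
Unshelve. all: by end_near. Qed.

Lemma near_eq_continuous_at (T S : topologicalType) (f g : T -> S) x :
  (\near x, f x = g x) -> {for x, continuous f} -> {for x, continuous g}.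
Proof.
move=> fg cf; rewrite /prop_for /continuous_at -(nbhs_singleton fg).
exact: cvg_trans (near_eq_cvg fg) cf.
Qed.

Lemma Ck_continuous V W k (U : set V) (f : V -> W) x :
  Ck k U f -> U x -> {for x, continuous f}.
Proof. by case: k => [|k] [cf _] Ux; apply: cf; rewrite inE. Qed.

Lemma Ck_derivable V W k (U : set V) (f : V -> W) x v :
  Ck k.+1 U f -> U x -> derivable f x v.
Proof. by move=> [_ /(_ v)[df _]]; exact: df. Qed.

Arguments Ck_derivable {V W k U f x} v.

Lemma Ck_derive V W k (U : set V) (f : V -> W) v :
  Ck k.+1 U f -> Ck k U ('D_v f).
Proof. by move=> [_ /(_ v)[]]. Qed.

Arguments Ck_derive {V W k U f} v.

Lemma derive_lin V W Z (l : {linear W -> Z}) (f : V -> W) x v : continuous l ->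
  derivable f x v ->
  derivable (l \o f) x v /\ 'D_v (l \o f) x = l ('D_v f x).
Proof.
move=> cl df.
have cv : (fun h : R => h^-1 *: (((l \o f) \o shift x) (h *: v) - (l \o f) x))
    @ 0^' --> l ('D_v f x).
  have -> : (fun h : R => h^-1 *: (((l \o f) \o shift x) (h *: v) - (l \o f) x)) =
      l \o (fun h : R => h^-1 *: ((f \o shift x) (h *: v) - f x)).
    by apply/funext => h; rewrite [RHS]/= linearZ; congr (_ *: _); rewrite linearB.
  by apply: cvg_comp; [move: df; rewrite /derivable; apply|exact: cl].
by split; [apply/cvg_ex; exists (l ('D_v f x))|exact: cvg_lim cv].
Qed.

Lemma derive_dir_linear V (f : V -> R) (U : set V) x (k : R) u v :
  open U -> Ck 1 U f -> U x ->
  'D_(k *: u + v) f x = k * 'D_u f x + 'D_v f x.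
Proof.
move=> oU cf Ux.
have [dk dkE] := deriveZv k (Ck_derivable u cf Ux).
rewrite -[k * _]dkE.
exact: (@derive_additive V f x (k *: u) v U oU Ux
  (fun y Uy => Ck_derivable v cf Uy) (Ck_continuous (Ck_derive v cf) Ux) dk).2.
Qed.

Lemma derive_dir_sum V (f : V -> R) (U : set V) x m (a : 'I_m -> R)
    (e : 'I_m -> V) : open U -> Ck 1 U f -> U x ->
  'D_(\sum_i a i *: e i) f x = \sum_i a i * 'D_(e i) f x.
Proof.
move=> oU cf Ux; elim/big_rec2: _ => [|i r v _ <-]; first by rewrite derive0.
exact: derive_dir_linear cf Ux.
Qed.

(** A finite spanning family with continuous coordinate functionals. Their continuity is what makes
    the passage to coordinates preserve [Ck]. *)
Definition fin_dim V := exists m (e : 'I_m -> V) (c : 'I_m -> {linear V -> R}),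
  (forall i, continuous (c i)) /\ forall v, v = \sum_i c i v *: e i.

(** Mean value theorem on the segment from x to x + h, then linearity of the derivative in its
    direction at the intermediate point and continuity of the partial derivatives at x. *)
Lemma C1_differentiable_real V (f : V -> R) (U : set V) x :
  fin_dim V -> open U -> Ck 1 U f -> U x -> differentiable f x.
Proof.
move=> [m [e [c [cc cE]]]] oU cf Ux.
pose df (h : V) : R := \sum_i c i h * 'D_(e i) f x.
have dfl : linear df.
  move=> k u v; rewrite /df scaler_sumr -big_split /=; apply: eq_bigr => i _.
  by rewrite linearP mulrDl scalerAl.
pose dfL : {linear V -> R} := HB.pack df (GRing.isLinear.Build _ _ _ _ df dfl).
have dfc : continuous dfL.
  rewrite /dfL /= => y; rewrite (_ : df = \sum_i (c i \* cst ('D_(e i) f x))); last first.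
    by apply/funext => h; rewrite fct_sumE.
  elim/big_ind: _ => [|g g' cg cg'|i _]; first exact: cvg_cst.
    by apply: cvgD.
  by apply: cvgM; [exact: cc|exact: cvg_cst].
suff fE : f \o shift x = cst (f x) + dfL +o_ 0 id.
  apply/diff_locallyP; rewrite (diff_unique dfc fE); split => //.
apply/eqaddoP => eps eps0.
have [M M0 MP] : exists2 M : R, 0 < M & forall i h, `|c i h| <= M * `|h|.
  have /choice[K KP] : forall i, exists k : R, 0 < k /\ forall h, `|c i h| <= k * `|h|.
    by move=> i; have [k k0 kP] := linear_lipschitz (cc i); exists k.
  exists (1 + \sum_i K i); first by rewrite ltr_pwDl// sumr_ge0// => i _; exact/ltW/(KP i).1.
  move=> i h; apply: (le_trans ((KP i).2 h)); rewrite ler_wpM2r//.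
  rewrite (bigD1 i)//= addrCA lerDl addr_ge0// sumr_ge0// => j _.
  exact/ltW/(KP j).1.
(* Each of the m terms of the remainder will be at most M |h| eta; the [+ 1] keeps the denominator
   non-zero for m = 0. *)
pose eta := eps / (M * (m%:R + 1)).
have m1 : (0 : R) < m%:R + 1 by rewrite ltr_wpDl.
have eta0 : 0 < eta by rewrite divr_gt0// mulr_gt0.
have Dnear : \forall y \near x, U y /\ forall i, `|'D_(e i) f x - 'D_(e i) f y| < eta.
  apply: filterI; first exact: open_nbhs_nbhs.
  apply: filter_forall => i.
  by have /cvgrPdist_lt := Ck_continuous (Ck_derive (e i) cf) Ux; apply.
have /nbhs_normP[d /= d0 dP] := Dnear.
near=> h.
have hd : `|h| < d by near: h; exact: nbhs0_lt.
have seg (t : R) : 0 <= t <= 1 -> ball_ Num.norm x d (x + t *: h).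
  move=> /andP[t0 t1]; rewrite /ball_ /= opprD addNKr normrN normrZ.
  by rewrite ger0_norm// (le_lt_trans _ hd)// ler_piMl.
have [t t01 tE] := @mvt_line V f x h (fun t t01 => Ck_derivable h cf (dP _ (seg t t01)).1).
have -> : (f \o shift x - (cst (f x) + dfL)) h = f (x + h) - f x - df h.
  by transitivity (f (h + x) - (f x + df h)); [|rewrite [h + x]addrC; ring].
have := derive_dir_sum (fun i => c i h) e oU cf (dP _ (seg t t01)).1.
rewrite -cE tE => ->; rewrite /df -sumrB.
rewrite (le_trans (ler_norm_sum _ _ _))//.
rewrite (@le_trans _ _ (\sum_(i < m) M * `|h| * eta))//.
  apply: ler_sum => i _; rewrite -mulrBr normrM ler_pM//.
  by rewrite distrC ltW//; exact: (dP _ (seg t t01)).2.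
rewrite sumr_const card_ord /eta.
have -> : M * `|h| * (eps / (M * (m%:R + 1))) *+ m = eps * `|h| * (m%:R / (m%:R + 1)).
  by rewrite -[LHS]mulr_natr; field; rewrite !gt_eqF.
rewrite ler_piMr ?mulr_ge0// ?ltW// ltr_pdivrMr// mul1r ltrDl; exact: ltr01.
Unshelve. all: by end_near. Qed.

Lemma C1_differentiable V W (f : V -> W) (U : set V) x : fin_dim V -> fin_dim W ->
  open U -> Ck 1 U f -> U x -> differentiable f x.
Proof.
move=> fV [m [e [c [cc cE]]]] oU cf Ux.
have cfi i : Ck 1 U (c i \o f).
  have dcf v y : U y -> derivable (c i \o f) y v /\ 'D_v (c i \o f) y = c i ('D_v f y).
    by move=> Uy; apply: derive_lin; [exact: cc|exact: Ck_derivable v cf Uy].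
  split=> [y|v]; first by rewrite inE => Uy; apply: continuous_comp;
    [exact: Ck_continuous cf Uy|exact: cc].
  split=> [y /(dcf v)[]//|]; split=> // y; rewrite inE => Uy.
  apply: (@near_eq_continuous_at _ _ (c i \o 'D_v f)).
    by apply: filterS (open_nbhs_nbhs (conj oU Uy)) => z Uz; rewrite (dcf v z Uz).2.
  by apply: continuous_comp; [exact: Ck_continuous (Ck_derive v cf) Uy|exact: cc].
have -> : f = \sum_i (fun y => c i (f y) *: e i).
  by apply/funext => y; rewrite fct_sumE {1}(cE (f y)).
apply: differentiable_sum => i; apply: differentiableZl.
exact: (C1_differentiable_real fV oU (cfi i) Ux).
Qed.

End DirectionalDerivatives.

Arguments Ck_derivable {R V W k U f x} v.
Arguments Ck_derive {R V W k U f} v.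

Section CkCalculus.
Context {R : realType}.
Implicit Types U V W Z : normedModType R.

Lemma Ck_sub V W k (A B : set V) (f : V -> W) : A `<=` B -> Ck k B f -> Ck k A f.
Proof.
move=> AB; elim: k f => [|k IH] f [cf df].
  by split => // x; rewrite inE => /AB Bx; apply: cf; rewrite inE.
split=> [x|v]; first by rewrite inE => /AB Bx; apply: cf; rewrite inE.
by have [dfv Cdf] := df v; split=> [x /AB/dfv//|]; exact: IH.
Qed.

Lemma Ck_weaken V W k (A : set V) (f : V -> W) : Ck k.+1 A f -> Ck k A f.
Proof.
elim: k f => [|k IH] f [cf df]; split => // v.
by have [dfv Cdf] := df v; split => //; exact: IH.
Qed.

Lemma Ck_local V W k (A : set V) (f : V -> W) :
  (forall x, A x -> exists2 B, B x & Ck k B f) -> Ck k A f.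
Proof.
elim: k f => [|k IH] f Af.
  by split => // x; rewrite inE => /Af[B Bx [cf _]]; apply: cf; rewrite inE.
split=> [x|v].
  by rewrite inE => /Af[B Bx [cf _]]; apply: cf; rewrite inE.
split=> [x /Af[B Bx Cf]|]; first exact: Ck_derivable v Cf Bx.
by apply: IH => x /Af[B Bx Cf]; exists B => //; exact: Ck_derive v Cf.
Qed.

Lemma Ck_eq V W k (A : set V) (f g : V -> W) : open A ->
  (forall x, A x -> f x = g x) -> Ck k A f -> Ck k A g.
Proof.
move=> oA; elim: k f g => [|k IH] f g fg Cf.
  split => // x; rewrite inE => Ax; apply: near_eq_continuous_at (Ck_continuous Cf Ax).
  exact: filterS (open_nbhs_nbhs (conj oA Ax)).
have nfg x : A x -> \near x, f x = g x.
  by move=> Ax; exact: filterS (open_nbhs_nbhs (conj oA Ax)).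
split=> [x|v].
  by rewrite inE => Ax; exact: near_eq_continuous_at (nfg x Ax) (Ck_continuous Cf Ax).
split=> [x Ax|]; first exact: near_eq_derivable (nfg x Ax) (Ck_derivable v Cf Ax).
apply: IH (Ck_derive v Cf) => x Ax.
exact: near_eq_derive (nfg x Ax).
Qed.

Lemma derive_lin' V W Z (l : W -> Z) (f : V -> W) x v : linear l -> continuous l ->
  derivable f x v ->
  derivable (l \o f) x v /\ 'D_v (l \o f) x = l ('D_v f x).
Proof.
move=> ll cl df.
exact: (@derive_lin R V W Z (HB.pack l (GRing.isLinear.Build _ _ _ _ l ll))).
Qed.

Lemma Ck_cst V W k (A : set V) (w : W) : Ck k A (fun=> w).
Proof.
elim: k w => [|k IH] w; first by split => // x _; exact: cvg_cst.
split=> [x _|v]; first exact: cvg_cst.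
split=> [x _|]; first exact: derivable_cst.
by rewrite (_ : 'D_v _ = fun=> 0)//; apply/funext => x; rewrite derive_cst.
Qed.

Lemma Ck_lin_comp V W Z k (A : set V) (l : W -> Z) (f : V -> W) :
  linear l -> continuous l -> open A -> Ck k A f -> Ck k A (l \o f).
Proof.
move=> ll cl oA; elim: k f => [|k IH] f Cf.
  split => // x; rewrite inE => Ax.
  by apply: continuous_comp; [exact: Ck_continuous Cf Ax|exact: cl].
split=> [x|v].
  rewrite inE => Ax.
  by apply: continuous_comp; [exact: Ck_continuous Cf Ax|exact: cl].
have dlf x : A x -> _ := fun Ax => derive_lin' ll cl (Ck_derivable v Cf Ax).
split=> [x /dlf[]//|]; apply: Ck_eq (IH _ (Ck_derive v Cf)) => // x /dlf[_].
exact: esym.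
Qed.

Lemma Ck_id V k (A : set V) : Ck k A id.
Proof.
case: k => [|k]; first by split => // x _; exact: cvg_id.
split=> [x _|v]; first exact: cvg_id.
split=> [x _|]; first exact: derivable_id.
rewrite (_ : 'D_v _ = fun=> v); first exact: Ck_cst.
by apply/funext => x; rewrite derive_id.
Qed.

Lemma Ck_add V W k (A : set V) (f g : V -> W) : open A ->
  Ck k A f -> Ck k A g -> Ck k A (fun x => f x + g x).
Proof.
move=> oA; elim: k f g => [|k IH] f g Cf Cg.
  split => // x; rewrite inE => Ax.
  by apply: cvgD; [exact: Ck_continuous Cf Ax|exact: Ck_continuous Cg Ax].
split=> [x|v].
  rewrite inE => Ax.
  by apply: cvgD; [exact: Ck_continuous Cf Ax|exact: Ck_continuous Cg Ax].
split=> [x Ax|].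
  exact: derivableD (Ck_derivable v Cf Ax) (Ck_derivable v Cg Ax).
apply: Ck_eq (IH _ _ (Ck_derive v Cf) (Ck_derive v Cg)) => // x Ax.
apply/esym; exact: deriveD (Ck_derivable v Cf Ax) (Ck_derivable v Cg Ax).
Qed.

Lemma Ck_sum V W k (A : set V) I (r : seq I) (f : I -> V -> W) : open A ->
  (forall i, Ck k A (f i)) -> Ck k A (fun x => \sum_(i <- r) f i x).
Proof.
move=> oA Cf; elim: r => [|i r IH].
  by rewrite (_ : (fun _ => _) = fun=> 0); [exact: Ck_cst|apply/funext => x; rewrite big_nil].
rewrite (_ : (fun _ => _) = (fun x => f i x + \sum_(i <- r) f i x)); first exact: Ck_add.
by apply/funext => x; rewrite big_cons.
Qed.

Lemma derivable_line_continuous V W (f : V -> W) x v : derivable f x v ->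
  (fun h : R => f (h *: v + x)) @ 0^' --> f x.
Proof.
move=> /derivable1P/derivable1_diffP/differentiable_continuous.
rewrite /prop_for /continuous_at scale0r add0r => cf.
by apply: cvg_trans cf; apply: cvg_app; exact: nbhs_dnbhs.
Qed.

Lemma derive_scale V W (a : V -> R) (f : V -> W) x v :
  derivable a x v -> derivable f x v ->
  derivable (fun y => a y *: f y) x v /\
  'D_v (fun y => a y *: f y) x = 'D_v a x *: f x + a x *: 'D_v f x.
Proof.
move=> da df; set g := fun y => _.
have cv : (fun h : R => h^-1 *: ((g \o shift x) (h *: v) - g x)) @ 0^' -->
    'D_v a x *: f x + a x *: 'D_v f x.
  have -> : (fun h : R => h^-1 *: ((g \o shift x) (h *: v) - g x)) =
      (fun h : R => (h^-1 *: ((a \o shift x) (h *: v) - a x)) *: f (h *: v + x)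
        + a x *: (h^-1 *: ((f \o shift x) (h *: v) - f x))).
    apply/funext => h; rewrite /g /=.
    have E (k p q : R) (b b' : W) :
        k *: (p *: b' - q *: b) = (k *: (p - q)) *: b' + q *: (k *: (b' - b)).
      rewrite -[k *: (p - q)]/(k * (p - q)) -scalerA [q *: (k *: _)]scalerA [q * k]mulrC.
      by rewrite -scalerA -scalerDr; congr (_ *: _); rewrite scalerBl scalerBr addrA subrK.
    exact: E.
  apply: cvgD.
    by apply: cvgZ; [move: da; rewrite /derivable|exact: derivable_line_continuous].
  by apply: cvgZr; move: df; rewrite /derivable.
by split; [apply/cvg_ex; eexists; exact: cv|exact: cvg_lim cv].
Qed.

Lemma Ck_scale V W k (A : set V) (a : V -> R) (f : V -> W) : open A ->
  Ck k A a -> Ck k A f -> Ck k A (fun x => a x *: f x).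
Proof.
move=> oA; elim: k a f => [|k IH] a f Ca Cf.
  split => // x; rewrite inE => Ax.
  by apply: cvgZ; [exact: Ck_continuous Ca Ax|exact: Ck_continuous Cf Ax].
split=> [x|v].
  rewrite inE => Ax.
  by apply: cvgZ; [exact: Ck_continuous Ca Ax|exact: Ck_continuous Cf Ax].
have daf x (Ax : A x) := derive_scale (Ck_derivable v Ca Ax) (Ck_derivable v Cf Ax).
split=> [x /daf[]//|].
apply: Ck_eq; first exact: oA.
- by move=> x /daf[_ ->].
- by apply: Ck_add => //; apply: IH; [exact: Ck_derive|exact: Ck_weaken
    |exact: Ck_weaken|exact: Ck_derive].
Qed.

Lemma Ck_mul V k (A : set V) (f g : V -> R) : open A ->
  Ck k A f -> Ck k A g -> Ck k A (fun x => f x * g x).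
Proof. exact: Ck_scale. Qed.

Lemma derive_comp V W Z (g : W -> Z) (f : V -> W) x v :
  derivable f x v -> differentiable g (f x) ->
  derivable (g \o f) x v /\ 'D_v (g \o f) x = 'D_('D_v f x) g (f x).
Proof.
move=> df dg; pose L (h : R) := h *: v + x.
have LE s : L (s *: 1 + 0) = s *: v + L 0.
  by rewrite /L scale0r add0r addr0 [s%:A]mulr1.
have L0 : L 0 = x by rewrite /L scale0r add0r.
have df' : derivable f (L 0) v by rewrite L0.
have dg' : differentiable g ((f \o L) 0) by rewrite /= L0.
have dfL : differentiable (f \o L) 0.
  exact/derivable1_diffP/(derivable_affine LE df').
have dgfL := differentiable_comp dfL dg'.
have gE := derive_affine (g \o f) LE; have fE := derive_affine f LE.
rewrite L0 in gE fE; split; first exact/derivable1P/derivable1_diffP.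
rewrite -fE -gE (_ : (g \o f) \o L = g \o (f \o L))// deriveE// diff_comp//=.
have -> : f (L 0) = f x by rewrite L0.
by rewrite [RHS]deriveE// [in RHS]deriveE.
Qed.

Lemma derive_dir_sumV V W (f : V -> W) x m (a : 'I_m -> R) (e : 'I_m -> V) :
  differentiable f x ->
  'D_(\sum_i a i *: e i) f x = \sum_i a i *: 'D_(e i) f x.
Proof.
move=> df; rewrite deriveE// linear_sum; apply: eq_bigr => i _.
by rewrite linearZ deriveE.
Qed.

(** Induction on [k]: by the chain rule the derivative is a finite combination of the composites of
    the partial derivatives of [g] with [f], and the coefficients are coordinates of the derivative
    of [f]. *)
Lemma Ck_comp V W Z k (A : set V) (B : set W) (g : W -> Z) (f : V -> W) :
  fin_dim W -> fin_dim Z -> open A -> open B -> (forall x, A x -> B (f x)) ->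
  Ck k A f -> Ck k B g -> Ck k A (g \o f).
Proof.
move=> fW fZ oA oB fAB; have [m [e [c [cc cE]]]] := fW.
elim: k g => [|k IH] g Cf Cg.
  split => // x; rewrite inE => Ax.
  by apply: continuous_comp; [exact: Ck_continuous Cf Ax|exact/(Ck_continuous Cg)/fAB].
split=> [x|v].
  rewrite inE => Ax.
  by apply: continuous_comp; [exact: Ck_continuous Cf Ax|exact/(Ck_continuous Cg)/fAB].
have C1g : Ck 1 B g.
  by elim: (k) Cg => // {IH Cf} {}k IH /Ck_weaken; exact: IH.
have dg y : B y -> differentiable g y by exact: C1_differentiable.
have dgf x (Ax : A x) := derive_comp (Ck_derivable v Cf Ax) (dg _ (fAB _ Ax)).
split=> [x /dgf[]//|].
pose h x := \sum_(i < m) c i ('D_v f x) *: ('D_(e i) g \o f) x.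
apply: (@Ck_eq _ _ _ _ h) => //.
  move=> x Ax; rewrite (dgf x Ax).2 [in RHS](cE ('D_v f x)) derive_dir_sumV//.
  exact/dg/fAB.
apply: Ck_sum => // i; apply: Ck_scale => //; last first.
  by apply: IH; [exact: Ck_weaken|exact: Ck_derive].
exact: (Ck_lin_comp (linearP (c i)) (cc i) oA (Ck_derive v Cf)).
Qed.

Lemma Ck_inv V k (A : set V) (f : V -> R) : open A -> (forall x, A x -> f x != 0) ->
  Ck k A f -> Ck k A (fun x => (f x)^-1).
Proof.
move=> oA f0; elim: k f f0 => [|k IH] f f0 Cf.
  split => // x; rewrite inE => Ax.
  by apply: cvgV; [exact: f0|exact: Ck_continuous Cf Ax].
split=> [x|v].
  rewrite inE => Ax.
  by apply: cvgV; [exact: f0|exact: Ck_continuous Cf Ax].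
split=> [x Ax|]; first exact: derivableV (f0 _ Ax) (Ck_derivable v Cf Ax).
apply: (@Ck_eq _ _ _ _ (fun x => (-1) * ((f x)^-1 * (f x)^-1) * 'D_v f x)) => //.
  move=> x Ax; rewrite (deriveV (f0 _ Ax) (Ck_derivable v Cf Ax)).
  by rewrite -[_ *: _]/(_ * _) expr2 invfM mulN1r.
apply: Ck_mul => //; last exact: Ck_derive.
apply: Ck_mul => //; first exact: Ck_cst.
by apply: Ck_mul => //; apply: IH => //; exact: Ck_weaken.
Qed.

(** On the real line the derivative in a direction [v] is [v] times [derive1], so one derivative
    controls all of them. *)
Lemma Ck_curve W k (A : set R) (c : R -> W) :
  (forall t, A t -> derivable c t 1) -> open A -> Ck k A (derive1 c) -> Ck k.+1 A c.
Proof.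
move=> dc oA Cc; have dcv v t : A t -> derivable c t v /\ 'D_v c t = v *: derive1 c t.
  by move=> At; have := deriveZv v (dc t At); rewrite [v%:A]mulr1 derive1E.
split=> [t|v].
  by rewrite inE => At; apply/differentiable_continuous/derivable1_diffP/dc.
split=> [t /(dcv v)[]//|].
apply: (@Ck_eq _ _ _ _ (fun t => v *: derive1 c t)) => //; first by move=> t /(dcv v)[_ ->].
by apply: Ck_scale => //; exact: Ck_cst.
Qed.

Lemma Ck_expR k (A : set R) : open A -> Ck k A (@expR R).
Proof.
move=> oA; elim: k => [|k IH]; first by split => // x _; exact: continuous_expR.
apply: (@Ck_curve _ k A (@expR R)) => [t _||]; [exact: ex_derive|exact: oA|].
by apply: Ck_eq IH => // x _; rewrite derive1E derive_val.
Qed.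

End CkCalculus.

Section CkCoordinates.
Context {R : realType}.
Implicit Types U V W Z : normedModType R.

Lemma fin_dim_R : fin_dim (R : normedModType R).
Proof.
exists 1%N, (fun=> 1), (fun=> idfun); split=> [i x|v]; first exact: cvg_id.
by rewrite big_ord1 [_ *: _]mulr1.
Qed.

Lemma fin_dim_rV n : fin_dim ('rV[R]_n : normedModType R).
Proof.
pose c (i : 'I_n) (v : 'rV[R]_n) : R := v 0 i.
have cl i : linear (c i) by move=> k u v; rewrite /c !mxE.
pose C i : {linear 'rV[R]_n -> R} :=
  HB.pack (c i) (GRing.isLinear.Build _ _ _ _ (c i) (cl i)).
exists n, (fun i => delta_mx 0 i), C.
split=> [i|v]; first exact: coord_continuous.
by rewrite {1}(row_sum_delta v).
Qed.

Lemma fin_dim_pair V W : fin_dim V -> fin_dim W -> fin_dim (V * W)%type.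
Proof.
move=> [m [e [c [cc cE]]]] [m' [e' [c' [cc' cE']]]].
pose f (i : 'I_(m + m')) : V * W :=
  match fintype.split i with inl j => (e j, 0) | inr j => (0, e' j) end.
pose d (i : 'I_(m + m')) (x : V * W) : R :=
  match fintype.split i with inl j => c j x.1 | inr j => c' j x.2 end.
have dl i : linear (d i).
  by rewrite /d; case: (fintype.split i) => j k x y; rewrite /= linearP.
pose D i : {linear (V * W)%type -> R} :=
  HB.pack (d i) (GRing.isLinear.Build _ _ _ _ (d i) (dl i)).
exists (m + m')%N, f, D; split=> [i x|[v w]].
  rewrite /= /d; case: (fintype.split i) => j.
    by apply: continuous_comp; [exact: cvg_fst|exact: cc].
  by apply: continuous_comp; [exact: cvg_snd|exact: cc'].
have fl i : f (lshift m' i) = (e i, 0) by rewrite /f (unsplitK (inl i)).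
have fr i : f (rshift m i) = (0, e' i) by rewrite /f (unsplitK (inr i)).
have dlE i : D (lshift m' i) (v, w) = c i v by rewrite /= /d (unsplitK (inl i)).
have drE i : D (rshift m i) (v, w) = c' i w by rewrite /= /d (unsplitK (inr i)).
have sum1 k (F : 'I_k -> V * W) : (\sum_i F i).1 = \sum_i (F i).1.
  by elim/big_rec2: _ => // i x y _ <-.
have sum2 k (F : 'I_k -> V * W) : (\sum_i F i).2 = \sum_i (F i).2.
  by elim/big_rec2: _ => // i x y _ <-.
rewrite [RHS]surjective_pairing sum1 sum2 !big_split_ord /=; congr pair.
  rewrite [X in _ = _ + X]big1 ?addr0 => [|i _]; last by rewrite fr scaler0.
  by rewrite {1}(cE v); apply: eq_bigr => i _; rewrite fl -dlE.
rewrite [X in _ = X + _]big1 ?add0r => [|i _]; last by rewrite fl scaler0.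
by rewrite {1}(cE' w); apply: eq_bigr => i _; rewrite fr -drE.
Qed.

Lemma Ck_pair U V W k (A : set U) (f : U -> V) (g : U -> W) : open A ->
  Ck k A f -> Ck k A g -> Ck k A (fun x => (f x, g x)).
Proof.
move=> oA Cf Cg.
have i1 : linear (fun v : V => (v, 0 : W)).
  by move=> a u v; apply/pair_equal_spec; split; rewrite //= scaler0 addr0.
have i2 : linear (fun w : W => (0 : V, w)).
  by move=> a u v; apply/pair_equal_spec; split; rewrite //= scaler0 addr0.
have c1 : continuous (fun v : V => (v, 0 : W)).
  by move=> x; apply: cvg_pair; [exact: cvg_id|exact: cvg_cst].
have c2 : continuous (fun w : W => (0 : V, w)).
  by move=> x; apply: cvg_pair; [exact: cvg_cst|exact: cvg_id].
apply: Ck_eq (Ck_add oA (Ck_lin_comp i1 c1 oA Cf) (Ck_lin_comp i2 c2 oA Cg)) => //.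
by move=> x _; apply/pair_equal_spec; split; rewrite /= ?addr0 ?add0r.
Qed.

Lemma Ck_fst U V W k (A : set U) (f : U -> V * W) : open A -> Ck k A f ->
  Ck k A (fun x => (f x).1).
Proof.
move=> oA; apply: (@Ck_lin_comp _ _ _ _ k A (@fst V W)) => //.
by move=> x; exact: cvg_fst.
Qed.

Lemma Ck_snd U V W k (A : set U) (f : U -> V * W) : open A -> Ck k A f ->
  Ck k A (fun x => (f x).2).
Proof.
move=> oA; apply: (@Ck_lin_comp _ _ _ _ k A (@snd V W)) => //.
by move=> x; exact: cvg_snd.
Qed.

Lemma Ck_coord U m n k (A : set U) (f : U -> 'M[R]_(m, n)) i j : open A -> Ck k A f ->
  Ck k A (fun x => f x i j).
Proof.
move=> oA; apply: (@Ck_lin_comp _ _ _ _ k A (fun M : 'M[R]_(m, n) => M i j)) => //.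
  by move=> a u v; rewrite !mxE.
exact: coord_continuous.
Qed.

Lemma Ck_row U n k (A : set U) (f : 'I_n -> U -> R) : open A ->
  (forall i, Ck k A (f i)) -> Ck k A (fun x => \row_i f i x).
Proof.
move=> oA Cf; apply: (@Ck_eq _ _ _ _ _ (fun x => \sum_i f i x *: delta_mx 0 i)) => //.
  by move=> x _; rewrite [RHS]row_sum_delta; apply: eq_bigr => i _; rewrite mxE.
by apply: Ck_sum => // i; apply: Ck_scale => //; exact: Ck_cst.
Qed.

Lemma Ck_prod U k (A : set U) I (r : seq I) (f : I -> U -> R) : open A ->
  (forall i, Ck k A (f i)) -> Ck k A (fun x => \prod_(i <- r) f i x).
Proof.
move=> oA Cf; elim: r => [|i r IH].
  by rewrite (_ : (fun _ => _) = fun=> 1); [exact: Ck_cst|apply/funext => x; rewrite big_nil].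
rewrite (_ : (fun _ => _) = (fun x => f i x * \prod_(i <- r) f i x)); first exact: Ck_mul.
by apply/funext => x; rewrite big_cons.
Qed.

Lemma Ck_det U m k (A : set U) (M : U -> 'M[R]_m) : open A ->
  (forall i j, Ck k A (fun x => M x i j)) -> Ck k A (fun x => \det (M x)).
Proof.
move=> oA CM; apply: Ck_sum => // s; apply: Ck_mul => //; first exact: Ck_cst.
exact: Ck_prod.
Qed.

Lemma Ck_invmx U m k (A : set U) (M : U -> 'M[R]_m) i j : open A ->
  (forall x, A x -> M x \in unitmx) ->
  (forall i j, Ck k A (fun x => M x i j)) -> Ck k A (fun x => invmx (M x) i j).
Proof.
move=> oA uM CM.
apply: (@Ck_eq _ _ _ _ _ (fun x => (\det (M x))^-1 * cofactor (M x) j i)) => //.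
  by move=> x /uM Mu; rewrite /invmx Mu !mxE.
apply: Ck_mul => //.
  apply: Ck_inv => //; last exact: Ck_det.
  by move=> x /uM; rewrite unitmxE unitfE.
apply: Ck_mul => //; first exact: Ck_cst.
apply: Ck_det => // i' j'; apply: Ck_eq (CM (lift j i') (lift i j')) => // x _.
by rewrite !mxE.
Qed.

(** Expanding the direction in coordinates leaves composites of partial derivatives of [f] with the
    moving point; only [f] loses an order. *)
Lemma Ck_derive_along U V W k (A : set U) (B : set V) (f : V -> W)
    (z X : U -> V) : fin_dim V -> fin_dim W -> open A -> open B ->
  (forall x, A x -> B (z x)) -> Ck k.+1 B f -> Ck k A z -> Ck k A X ->
  Ck k A (fun x => 'D_(X x) f (z x)).
Proof.
move=> fV fW oA oB zAB Cf Cz CX; have [m [e [c [cc cE]]]] := fV.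
have C1f : Ck 1 B f.
  by elim: (k) Cf => // {Cz CX} {}k IH /Ck_weaken; exact: IH.
apply: (@Ck_eq _ _ _ _ _ (fun x => \sum_i c i (X x) *: 'D_(e i) f (z x))) => //.
  move=> x Ax; rewrite [in RHS](cE (X x)) derive_dir_sumV//.
  exact/(C1_differentiable fV fW oB C1f)/zAB.
apply: Ck_sum => // i; apply: Ck_scale => //.
  exact: (Ck_lin_comp (linearP (c i)) (cc i) oA CX).
exact: (Ck_comp fV fW oA oB zAB Cz (Ck_derive (e i) Cf)).
Qed.

End CkCoordinates.

Opaque derive.

(** * Symmetry of mixed second derivatives *)

Section MixedDerivatives.
Context {R : realType}.
Implicit Types V W : normedModType R.

Lemma near_dist_lt V (f : V -> R) x (e : R) : 0 < e -> {for x, continuous f} ->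
  \forall y \near x, `|f x - f y| < e.
Proof. by move=> e0 /cvgrPdist_lt; apply. Qed.

(** The mean value theorem is used twice: along [u] for the difference [g] in direction [v], then
    along [v] for ['D_u f]. *)
Lemma second_difference V (f : V -> R) (U : set V) x u v (h : R) :
  open U -> Ck 2 U f ->
  (forall s t : R, 0 <= s <= 1 -> 0 <= t <= 1 -> U (x + s *: (h *: u) + t *: (h *: v))) ->
  exists s t : R, [/\ 0 <= s <= 1, 0 <= t <= 1 &
    f (x + h *: u + h *: v) - f (x + h *: u) - (f (x + h *: v) - f x) =
    h * (h * 'D_v ('D_u f) (x + s *: (h *: u) + t *: (h *: v)))].
Proof.
move=> oU cf xU; pose g y := f (y + h *: v) - f y.
have U0 (s : R) : 0 <= s <= 1 -> U (x + s *: (h *: u)).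
  by move=> s01; have := xU s 0 s01; rewrite scale0r addr0; apply; rewrite lexx ler01.
have U1 (s : R) : 0 <= s <= 1 -> U (x + s *: (h *: u) + h *: v).
  by move=> s01; have := xU s 1 s01; rewrite scale1r; apply; rewrite lexx ler01.
have shiftE (y : V) (s : R) : s *: u + y + h *: v = s *: u + (y + h *: v).
  by rewrite addrA.
have dg y : U y -> U (y + h *: v) ->
    derivable g y u /\ 'D_u g y = 'D_u f (y + h *: v) - 'D_u f y.
  move=> Uy Uyv; have d1 := Ck_derivable u cf Uy; have d2 := Ck_derivable u cf Uyv.
  have d3 := @derivable_affine R V V R f (fun y => y + h *: v) y u u (shiftE y) d2.
  have e3 := @derive_affine R V V R f (fun y => y + h *: v) y u u (shiftE y).
  split; first exact: derivableB d3 d1.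
  by rewrite (deriveB d3 d1) e3.
have [|s s01] := @mvt_line R V g x (h *: u).
  by move=> t t01; have [] := deriveZv h (dg _ (U0 t t01) (U1 t t01)).1.
have [dgs dgE] := dg _ (U0 s s01) (U1 s s01).
rewrite (deriveZv h dgs).2 dgE.
have [|t t01 ->] := @mvt_line R V ('D_u f) (x + s *: (h *: u)) (h *: v).
  move=> t t01; have := Ck_derivable v (Ck_derive u cf) (xU s t s01 t01).
  by move=> /(deriveZv h)[].
rewrite (deriveZv h (Ck_derivable v (Ck_derive u cf) (xU s t s01 t01))).2 /g => fE.
by exists s, t.
Qed.

(** The second difference is symmetric in the two increments, so the two mixed derivatives take a
    common value at two points close to [x]; continuity brings both back to [x]. *)
Lemma derive_swap_real V (f : V -> R) (U : set V) x u v :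
  open U -> Ck 2 U f -> U x -> 'D_u ('D_v f) x = 'D_v ('D_u f) x.
Proof.
move=> oU cf Ux; apply/eqP; rewrite -subr_eq0 -normr_le0; apply/ler_addgt0Pr => e e0; rewrite add0r.
pose e2 : R := e / 2; have e20 : 0 < e2 by rewrite divr_gt0.
have c1 := near_dist_lt e20 (Ck_continuous (Ck_derive u (Ck_derive v cf)) Ux).
have c2 := near_dist_lt e20 (Ck_continuous (Ck_derive v (Ck_derive u cf)) Ux).
have Dnear : nbhs x (U `&` ((fun y => `|'D_u ('D_v f) x - 'D_u ('D_v f) y| < e2)
    `&` (fun y => `|'D_v ('D_u f) x - 'D_v ('D_u f) y| < e2))).
  by apply: filterI; [exact: open_nbhs_nbhs|apply: filterI; [exact: c1|exact: c2]].
have /nbhs_normP[d /= d0 dP] := Dnear.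
pose h := d / (2 * (`|u| + `|v| + 1)).
have K0 : 0 < `|u| + `|v| + 1 by rewrite ltr_wpDl.
have h0 : 0 < h by rewrite divr_gt0// mulr_gt0.
have hd : h * (`|u| + `|v|) < d.
  rewrite /h mulrAC ltr_pdivrMr ?mulr_gt0//; rewrite ltr_pM2l//.
  have := normr_ge0 u; have := normr_ge0 v; lra.
clearbody h; have seg (a b : V) (s t : R) : `|a| + `|b| <= `|u| + `|v| -> 0 <= s <= 1 -> 0 <= t
  <= 1 ->
    ball_ Num.norm x d (x + s *: (h *: a) + t *: (h *: b)).
  move=> abuv /andP[s0 s1] /andP[t0 t1]; rewrite /ball_ /= -addrA opprD addNKr normrN.
  rewrite (le_lt_trans _ hd)// (le_trans (ler_normD _ _))// !normrZ.
  rewrite (ger0_norm s0) (ger0_norm t0) (gtr0_norm h0).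
  apply: (@le_trans _ _ (h * (`|a| + `|b|))); last by rewrite ler_pM2l.
  by rewrite mulrDr lerD// ler_piMl// mulr_ge0// ltW.
have [s [t [s01 t01 E1]]] := second_difference oU cf
  (fun s t s01 t01 => ((dP _ (seg u v s t (lexx _) s01 t01)).1)).
have vu : `|v| + `|u| <= `|u| + `|v| by rewrite addrC.
have [s' [t' [s01' t01' E2]]] := second_difference oU cf
  (fun s t s01 t01 => ((dP _ (seg v u s t vu s01 t01)).1)).
have [_ [_ e1]] := dP _ (seg u v s t (lexx _) s01 t01).
have [_ [e1' _]] := dP _ (seg v u s' t' vu s01' t01').
move: e1 e1' E1 E2; rewrite [x + h *: v + h *: u]addrAC.
move: ('D_v _ (_ + _)) ('D_u _ (_ + _)) => a b; move: ('D_v _ _) ('D_u _ _) => a' b'.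
move=> e1 e1' E1 E2.
have : h * (h * a) = h * (h * b).
  by rewrite -E1 -E2; move: (f _) (f _) (f _) (f _) => ? ? ? ?; ring.
move=> /(mulfI (lt0r_neq0 h0)) /(mulfI (lt0r_neq0 h0)) E.
move: e1 e1'; rewrite E /e2.
rewrite !ltr_distl => /andP[? ?] /andP[? ?]; rewrite ler_distl; apply/andP; split; lra.
Qed.

Lemma derive_swap V W (f : V -> W) (U : set V) x u v : fin_dim W ->
  open U -> Ck 2 U f -> U x -> 'D_u ('D_v f) x = 'D_v ('D_u f) x.
Proof.
move=> [m [e [c [cc cE]]]] oU cf Ux.
have cD i (a b : V) : c i ('D_a ('D_b f) x) = 'D_a ('D_b (c i \o f)) x.
  have [_ <-] := derive_lin (cc i) (Ck_derivable a (Ck_derive b cf) Ux).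
  apply: near_eq_derive; apply: filterS (open_nbhs_nbhs (conj oU Ux)) => y Uy.
  by have [_ ->] := derive_lin (cc i) (Ck_derivable b cf Uy).
rewrite (cE ('D_u ('D_v f) x)) (cE ('D_v ('D_u f) x)); apply: eq_bigr => i _.
have cfi : Ck 2 U (c i \o f) := Ck_lin_comp (linearP (c i)) (cc i) oU cf.
by rewrite (cD i u v) (cD i v u) (derive_swap_real u v oU cfi Ux).
Qed.

End MixedDerivatives.

(** * Primitives on open intervals *)

Section RealLine.
Context {R : realType}.

Lemma antiderivative_segment (g : R -> R) (a b : R) : a < b ->
  (forall t, a <= t <= b -> {for t, continuous g}) ->
  exists G : R -> R, forall t, a < t < b -> is_derive t 1 G (g t).
Proof.
move=> ab cg; exists (fun x => \int[lebesgue_measure]_(t in `[a, x]) (g t)) => t /andP[at_ tb].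
have cgw : {within `[a, b], continuous g}.
  by apply: continuous_in_subspaceT => x; rewrite inE/= in_itv/=; exact: cg.
have ig := continuous_compact_integrable (@segment_compact _ a b) cgw.
have [] := continuous_FTC1_closed tb ig at_.
  by apply: cg; rewrite !ltW.
by move=> dG GE; apply: DeriveDef; [exact: dG|rewrite -GE derive1E].
Qed.

Lemma derive0_cst_itv (h : R -> R) (I : set R) : is_interval I ->
  (forall t, I t -> is_derive t 1 h 0) -> forall s t, I s -> I t -> h s = h t.
Proof.
move=> iI dh; suff H s t : I s -> I t -> s <= t -> h s = h t.
  move=> s t Is It; have [st|/ltW ts] := leP s t; first exact: H.
  by apply/esym; exact: H.
move=> Is It st; have stI x : x \in `[s, t] -> I x.
  by rewrite in_itv/=; exact: iI.
have [||x /stI Ix E] := @MVT_segment R h (fun=> 0) s t st _ _.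
- move=> x xst; apply/dh/stI; move: xst; rewrite !in_itv/= => /andP[? ?].
  by rewrite !ltW.
- by apply: derivable_within_continuous => y /stI Iy; have [] := dh _ Iy.
- by apply/eqP; rewrite eq_sym -subr_eq0 E mul0r.
Qed.

(** Integration gives primitives inside compact segments only. For each [t] a segment in [I] around
    [t] and [t0] is taken, with the primitive that vanishes at [t0]; two of these agree where both
    are defined, so they glue. *)
Lemma antiderivative (g : R -> R) (I : set R) : open_interval I ->
  (forall t, I t -> {for t, continuous g}) ->
  exists G : R -> R, forall t, I t -> is_derive t 1 G (g t).
Proof.
move=> [[t0 It0] oI iI] cg.
pose good (ab : R * R) (G : R -> R) :=
  [/\ ab.1 < t0 < ab.2, I ab.1, I ab.2, G t0 = 0 &
      forall t, ab.1 < t < ab.2 -> is_derive t 1 G (g t)].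
have ex t : I t -> exists ab G, [/\ good ab G, ab.1 < t < ab.2 & True].
  move=> It; have /nbhs_normP[d /= d0 dI] := open_nbhs_nbhs (conj oI It).
  have /nbhs_normP[d' /= d0' dI'] := open_nbhs_nbhs (conj oI It0).
  pose e := Num.min d d' / 2.
  have m0 : 0 < Num.min d d' by rewrite lt_min d0.
  have e0 : 0 < e by rewrite divr_gt0.
  have ed : e < d by rewrite (@lt_le_trans _ _ (Num.min d d'))// ?ge_min ?lexx// /e; lra.
  have ed' : e < d'.
    by rewrite (@lt_le_trans _ _ (Num.min d d'))// ?ge_min ?lexx ?orbT// /e; lra.
  (* [e] is less than the radii of two balls contained in [I], around [t] and [t0], so both points
     lie strictly between [a] and [b] while [a] and [b] stay in [I]. *)
  pose a := Num.min t t0 - e; pose b := Num.max t t0 + e.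
  have Ia : I a.
    rewrite /a; have [_|_] := leP t t0; [apply: dI|apply: dI'];
      by rewrite /ball_ /= opprB addrC subrK gtr0_norm.
  have Ib : I b.
    rewrite /b; have [_|_] := leP t t0; [apply: dI'|apply: dI];
      by rewrite /ball_ /= opprD addNKr normrN gtr0_norm.
  have at0 : a < t0 < b /\ a < t < b.
    by rewrite /a /b; have [?|?] := leP t t0; split; apply/andP; split; lra.
  have ab : a < b by case: at0 => /andP[/lt_trans h] /h.
  have [|G dG] := @antiderivative_segment g a b ab.
    by move=> x /iI xI; apply/cg/xI.
  exists (a, b), (fun x => G x - G t0); split => //; last by case: at0.
  split=> //=; [by case: at0|by rewrite subrr|].
  move=> x xab; have := dG x xab => dGx.
  rewrite -[g x]subr0; apply: is_deriveB.
have {}ex t : exists p : (R * R) * (R -> R), I t -> good p.1 p.2 /\ p.1.1 < t < p.1.2.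
  have [It|nIt] := pselect (I t); last by exists ((0, 0), fun=> 0).
  by have [ab [G [gG tab _]]] := ex t It; exists (ab, G).
have /choice[p pP] := ex.
have uniq ab G ab' G' x : good ab G -> good ab' G' -> ab.1 < x < ab.2 ->
    ab'.1 < x < ab'.2 -> G x = G' x.
  move=> [/andP[a0 b0] _ _ G0 dG] [/andP[a0' b0'] _ _ G0' dG'] /andP[ax xb] /andP[ax' xb'].
  pose J := [set y | Num.max ab.1 ab'.1 < y < Num.min ab.2 ab'.2].
  have Jx : J x by rewrite /J /= gt_max lt_min ax ax' xb xb'.
  have J0 : J t0 by rewrite /J /= gt_max lt_min a0 a0' b0 b0'.
  have iJ : is_interval J.
    move=> r s /andP[ar _] /andP[_ sb] y /andP[ry ys]; apply/andP; split.
      exact: lt_le_trans ar ry.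
    exact: le_lt_trans ys sb.
  have dJ y : J y -> is_derive y 1 (G - G') 0.
    rewrite /J /= gt_max lt_min => /andP[/andP[? ?] /andP[? ?]].
    have d1 : is_derive y 1 G (g y) by apply: dG; apply/andP.
    have d2 : is_derive y 1 G' (g y) by apply: dG'; apply/andP.
    by rewrite -[0](subrr (g y)); apply: is_deriveB.
  have /eqP := derive0_cst_itv iJ dJ Jx J0.
  by rewrite !fctE G0 G0' subrr subr_eq0 => /eqP.
exists (fun t => (p t).2 t) => t It.
have [gt /andP[t1 t2]] := pP t It; have [_ Ia Ib _ dG] := gt.
apply: (@near_eq_is_derive _ _ _ (p t).2); last by apply: dG; apply/andP.
have oJ : nbhs t [set y | (p t).1.1 < y < (p t).1.2].
  apply: open_nbhs_nbhs; split; last by apply/andP.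
  rewrite (_ : [set y | _] = `](p t).1.1, (p t).1.2[%classic); first exact: interval_open.
  by apply/seteqP; split=> y /=; rewrite in_itv.
apply: filterS oJ => y /= ty.
have Iy : I y by apply: (iI _ _ Ia Ib); case/andP: ty => ? ?; rewrite !ltW.
have [gy yy] := pP y Iy.
exact: uniq gt gy ty yy.
Qed.

End RealLine.

(** * Ordinary differential equations *)

Section RowVectors.
Context {R : realType} {m : nat}.
Implicit Types (x : 'rV[R]_m) (h : R -> 'rV[R]_m).

Lemma rV_norm_le x (e : R) : 0 <= e -> (forall i, `|x 0 i| <= e) -> `|x| <= e.
Proof.
move=> e0 xe; rewrite [`|x|]mx_normrE; apply/bigmax_leP; split=> // ij _.
by rewrite (ord1 ij.1).
Qed.

Lemma rV_coord_le x i : `|x 0 i| <= `|x|.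
Proof.
rewrite [X in _ <= X]mx_normrE.
by apply: (@le_bigmax _ _ _ _ (fun ij : 'I_1 * 'I_m => `|x ij.1 ij.2|) (0, i)).
Qed.

Lemma is_derive_coord (V : normedModType R) (h : V -> 'rV[R]_m) (t v : V) (d : 'rV[R]_m) i :
  is_derive t v h d -> is_derive t v (fun s => h s 0 i) (d 0 i).
Proof.
move=> [dh <-]; have cl : linear (fun x : 'rV[R]_m => x 0 i) by move=> a u w; rewrite !mxE.
have [dc E] := derive_lin' cl (@coord_continuous _ _ _ 0 i) dh.
by apply: DeriveDef; [exact: dc|exact: E].
Qed.

Lemma is_derive_row (V : normedModType R) (h : 'I_m -> V -> R) (t v : V) (d : 'I_m -> R) :
  (forall i, is_derive t v (h i) (d i)) ->
  is_derive t v (fun s => \row_i h i s) (\row_i d i).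
Proof.
move=> dh; have -> : (fun s => \row_i h i s) =
    \sum_i (fun s => h i s *: (delta_mx 0 i : 'rV[R]_m)).
  apply/funext => s; rewrite fct_sumE [LHS]row_sum_delta.
  by apply: eq_bigr => i _; rewrite mxE.
rewrite [X in is_derive _ _ _ X]row_sum_delta; apply: is_derive_sum => i; rewrite mxE.
have [dhi <-] := dh i; have [d1 E] := derive_scale dhi (derivable_cst
  (delta_mx 0 i : 'rV[R]_m) t v).
apply: DeriveDef; first exact: d1.
by rewrite E derive_cst scaler0 addr0.
Qed.

Lemma mvt_bound h (dh : R -> 'rV[R]_m) (s t K : R) : 0 <= K ->
  (forall c, 0 <= c <= 1 -> is_derive (s + c * (t - s)) 1 h (dh (s + c * (t - s))) /\
     `|dh (s + c * (t - s))| <= K) -> `|h t - h s| <= K * `|t - s|.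
Proof.
move=> K0 hd; apply: rV_norm_le => [|i]; first by rewrite mulr_ge0.
have dhi c : 0 <= c <= 1 ->
    is_derive (s + c * (t - s)) 1 (fun s => h s 0 i) (dh (s + c * (t - s)) 0 i).
  by move=> /hd[dhc _]; exact: is_derive_coord.
have dZ c (c01 : 0 <= c <= 1) := deriveZv (t - s) (@ex_derive _ _ _ _ _ _ _ (dhi c c01)).
have [|c c01] := @mvt_line R R (fun s => h s 0 i) s (t - s).
  by move=> c c01; have := (dZ c c01).1; rewrite [(t - s)%:A]mulr1.
have [dc Ec] := dhi c c01; have [_] := dZ c c01; rewrite [(t - s)%:A]mulr1 => ->.
rewrite [s + (t - s)]addrC subrK !mxE => ->.
rewrite Ec normrM mulrC ler_wpM2r//.
by apply: le_trans (hd c c01).2; exact: rV_coord_le.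
Qed.

End RowVectors.

Section Picard.
Context {R : realType} {m : nat}.
Variables (v : 'rV[R]_m -> 'rV[R]_m) (x0 : 'rV[R]_m) (r L M T : R).
Hypotheses (r0 : 0 <= r) (L0 : 0 <= L) (M0 : 0 <= M) (T0 : 0 < T).
Hypothesis MT : M * T <= r.
Hypothesis LT : L * T <= 2^-1.
Hypothesis vM : forall x, `|x - x0| <= r -> `|v x| <= M.
Hypothesis vL : forall x y, `|x - x0| <= r -> `|y - x0| <= r ->
  `|v x - v y| <= L * `|x - y|.

(** [adm] controls a curve only for [|t| <= T]. Composing with this truncation makes the integrand
    continuous on the whole line, so that its primitive is differentiable also at [T] and [- T]. *)
Let clamp (t : R) := Num.max (- T) (Num.min t T).

Let clamp_id t : `|t| <= T -> clamp t = t.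
Proof. by rewrite ler_norml /clamp => /andP[t1 t2]; rewrite min_l// max_r. Qed.

Let clamp_le t : `|clamp t| <= T.
Proof.
rewrite ler_norml /clamp le_max lexx/= ge_max ge_min lexx orbT andbT.
by rewrite (@le_trans _ _ 0)// ?oppr_le0 ltW.
Qed.

Let clamp_continuous : continuous clamp.
Proof.
move=> t; apply: (@continuous_max _ _ (cst (- T)) (fun t => Num.min t T)); first exact: cvg_cst.
by apply: (@continuous_min _ _ id (cst T)); [exact: cvg_id|exact: cvg_cst].
Qed.

Let adm (u : R -> 'rV[R]_m) := forall t, `|t| <= T ->
  {for t, continuous u} /\ `|u t - x0| <= r.

Let solves (u u' : R -> 'rV[R]_m) := u' 0 = x0 /\
  forall t : R, `|t| <= T -> is_derive (t : R) (1 : R) u' (v (u t)).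

Let between (s t c : R) : `|s| <= T -> `|t| <= T -> 0 <= c <= 1 -> `|s + c * (t - s)| <= T.
Proof.
rewrite !ler_norml => /andP[? ?] /andP[? ?] /andP[? ?]; apply/andP; split; nra.
Qed.

Let field_lipschitz u u' s t : adm u -> solves u u' -> `|s| <= T -> `|t| <= T ->
  `|u' t - u' s| <= M * `|t - s|.
Proof.
move=> au [_ du] sT tT; apply: (@mvt_bound _ _ _ (fun t => v (u t))) => // c c01.
split; first exact/du/between.
exact/vM/(au _ _).2/between.
Qed.

Let step_adm u u' : adm u -> solves u u' -> adm u'.
Proof.
move=> au su t tT; split.
  have [d _] := su.2 _ tT; exact/differentiable_continuous/derivable1_diffP.
have T00 : `|0 : R| <= T by rewrite normr0 ltW.
rewrite -su.1 (le_trans (field_lipschitz au su T00 tT))// subr0.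
by rewrite (le_trans _ MT)// ler_wpM2l.
Qed.

(** Admissibility stands inside the existential, so that [choice] gives a total operator [step] that
    can be iterated. *)
Let step_ex u : exists u', adm u -> solves u u'.
Proof.
have [au|nau] := pselect (adm u); last by exists u.
pose g t := v (u (clamp t)).
have cg i t : {for t, continuous (fun s => g s 0 i)}.
  apply/cvgrPdist_lt => e e0.
  have e1 : 0 < e / (L + 1) by rewrite divr_gt0// ltr_wpDl.
  have cu : {for t, continuous (u \o clamp)}.
    by apply: continuous_comp; [exact: clamp_continuous|exact: (au _ (clamp_le t)).1].
  move/cvgrPdist_lt : cu => /(_ _ e1); apply: filterS => s /= us.
  have -> : g t 0 i - g s 0 i = (g t - g s) 0 i by rewrite !mxE.
  apply: le_lt_trans (rV_coord_le _ i) _.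
  apply: le_lt_trans (vL (au _ (clamp_le t)).2 (au _ (clamp_le s)).2) _.
  apply: (@le_lt_trans _ _ ((L + 1) * `|u (clamp t) - u (clamp s)|)).
    by rewrite ler_wpM2r// lerDl.
  by rewrite -ltr_pdivlMl ?ltr_wpDl// mulrC.
have T1 : - (T + 1) < T + 1 by have := T0; lra.
have /choice[G GP] i := antiderivative_segment T1 (fun t _ => cg i t).
exists (fun t => \row_i (G i t - G i 0 + x0 0 i)) => _; split.
  by apply/rowP => i; rewrite mxE subrr add0r.
move=> t tT; have -> : v (u t) = \row_i (g t 0 i + 0).
  by apply/rowP => i; rewrite mxE addr0 /g clamp_id.
apply: is_derive_row => i.
have dG : is_derive t 1 (G i) (g t 0 i).
  by apply: GP; move: tT; rewrite ler_norml => /andP[? ?]; apply/andP; split; lra.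
have -> : (fun s => G i s - G i 0 + x0 0 i) = G i + cst (- G i 0 + x0 0 i).
  by apply/funext => s; rewrite -addrA.
exact: is_deriveD.
Qed.

Let step := projT1 (choice step_ex).
Let stepP u : adm u -> solves u (step u) := projT2 (choice step_ex) u.

Let u_ k := iter k step (cst x0).

Let u_adm k : adm (u_ k).
Proof.
elim: k => [|k IH]; last exact: step_adm IH (stepP IH).
by move=> t _; split; [exact: cvg_cst|rewrite subrr normr0].
Qed.

Let u_solves k : solves (u_ k) (u_ k.+1).
Proof. exact/stepP/u_adm. Qed.

Let u_lip k s t : `|s| <= T -> `|t| <= T -> `|u_ k t - u_ k s| <= M * `|t - s|.
Proof.
case: k => [|k]; first by move=> _ _; rewrite subrr normr0 mulr_ge0.
exact: field_lipschitz (u_adm k) (u_solves k).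
Qed.

Let u_dist k t : `|t| <= T -> `|u_ k.+1 t - u_ k t| <= r * 2^-1 ^+ k.
Proof.
elim: k t => [|k IH] t tT; first by rewrite expr0 mulr1; exact: (u_adm 1 tT).2.
have T00 : `|0 : R| <= T by rewrite normr0 ltW.
pose h s := u_ k.+2 s - u_ k.+1 s.
have h0 : h 0 = 0 by rewrite /h (u_solves k.+1).1 (u_solves k).1 subrr.
have rk : 0 <= r * 2^-1 ^+ k by rewrite mulr_ge0// exprn_ge0.
have := @mvt_bound _ _ h (fun s => v (u_ k.+1 s) - v (u_ k s)) 0 t (L * (r * 2^-1 ^+ k)).
rewrite h0 !subr0 mulr_ge0// => /(_ isT) H.
have {}H : `|h t| <= L * (r * 2^-1 ^+ k) * `|t|.
  apply: H => c c01; have cT := between T00 tT c01; rewrite subr0 in cT.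
  split; first exact: is_deriveB ((u_solves k.+1).2 _ cT) ((u_solves k).2 _ cT).
  apply: le_trans (vL (u_adm _ cT).2 (u_adm _ cT).2) _.
  by rewrite ler_wpM2l// IH.
apply: le_trans H _; apply: (@le_trans _ _ ((r * 2^-1 ^+ k) * (L * T))).
  by rewrite mulrAC mulrC ler_wpM2l// ler_wpM2l.
by rewrite exprSr [leRHS]mulrA; exact: ler_wpM2l.
Qed.

Let u_cauchy k j t : `|t| <= T -> `|u_ (k + j) t - u_ k t| <= 2 * r * 2^-1 ^+ k.
Proof.
(* The factor [1 - 2^-1 ^+ j] is the partial geometric sum and makes the bound inductive in [j]. *)
move=> tT; suff : `|u_ (k + j) t - u_ k t| <= 2 * r * 2^-1 ^+ k * (1 - 2^-1 ^+ j).
  have h1 : 1 - 2^-1 ^+ j <= 1 :> R by rewrite gerBl exprn_ge0.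
  have h2 : 0 <= 2 * r * 2^-1 ^+ k by rewrite mulr_ge0 ?exprn_ge0// mulr_ge0.
  by move=> /le_trans; apply; rewrite ler_piMr.
elim: j => [|j IH]; first by rewrite addn0 subrr normr0 expr0 subrr mulr0.
rewrite addnS -[u_ _ t](subrK (u_ (k + j) t)) -addrA.
apply: le_trans (ler_normD _ _) _; apply: le_trans (lerD (u_dist (k + j) tT) IH) _.
rewrite exprD exprSr; move: (2^-1 ^+ k) (2^-1 ^+ j) => a b.
by rewrite le_eqVlt; apply/orP; left; apply/eqP; field.
Qed.

Let err k : R := 2 * r * 2^-1 ^+ k.

Let err_small (e : R) : 0 < e -> exists k, err k < e.
Proof.
move=> e0; have h1 : `|2^-1 : R| < 1 by rewrite gtr0_norm ?invr_gt0// invf_lt1// ltr1n.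
have := cvg_geometric (2 * r) h1.
move/cvgrPdist_lt => /(_ _ e0) [k _ /(_ k (leqnn k))] /=.
by rewrite sub0r normrN => /(le_lt_trans (ler_norm _)); exists k.
Qed.

Let u_cvg t : `|t| <= T -> cvg (u_ ^~ t @ \oo).
Proof.
move=> tT; apply/cauchy_cvgP/cauchy_exP => e e0.
have [k ke] := err_small e0; exists (u_ k t); exists k => // j /= kj.
rewrite -ball_normE /= distrC -(subnKC kj).
exact: le_lt_trans (u_cauchy k _ tT) ke.
Qed.

Let u t := lim (u_ ^~ t @ \oo).

Let u_err k t : `|t| <= T -> `|u t - u_ k t| <= err k.
Proof.
move=> tT; apply/ler_addgt0Pr => e e0.
have := u_cvg tT; move/cvgrPdist_lt => /(_ _ e0) [j _ /(_ (k + j)%N)] /=.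
rewrite leq_addl => /(_ isT) uj.
rewrite -[u t](subrK (u_ (k + j) t)) -addrA addrC.
apply: le_trans (ler_normD _ _) _; apply: lerD; first exact: u_cauchy.
exact: ltW.
Qed.

Let u_ball t : `|t| <= T -> `|u t - x0| <= r.
Proof.
move=> tT; apply/ler_addgt0Pr => e /err_small[k ke].
rewrite -[u t](subrK (u_ k t)) -addrA addrC.
apply: le_trans (ler_normD _ _) _; apply: lerD; first exact: (u_adm k tT).2.
exact: le_trans (u_err k tT) (ltW ke).
Qed.

(** A first order expansion whose quadratic error has a constant common to all iterates, so it
    passes to the limit. It gives the derivative of [u] directly, without an integral equation for
    the limit. *)
Let u_taylor s t : `|s| <= T -> `|t| <= T ->
  `|u t - u s - (t - s) *: v (u s)| <= L * M * `|t - s| ^+ 2.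
Proof.
move=> sT tT; apply/ler_addgt0Pr => e e0; have e3 : 0 < e / 3 by rewrite divr_gt0.
have [k ke] := err_small e3.
have h1 : `|u t - u_ k.+1 t| <= e / 3.
  apply: le_trans (u_err _ tT) (le_trans _ (ltW ke)).
  by rewrite /err exprS mulrCA ler_piMl ?invf_le1 ?ler1n// mulr_ge0 ?exprn_ge0// mulr_ge0.
have h2 : `|u s - u_ k.+1 s| <= e / 3.
  apply: le_trans (u_err _ sT) (le_trans _ (ltW ke)).
  by rewrite /err exprS mulrCA ler_piMl ?invf_le1 ?ler1n// mulr_ge0 ?exprn_ge0// mulr_ge0.
(* Since |t - s| <= 2 T and L T <= 1/2, the factor 2 T L is at most 1. *)
have h3 : `|(t - s) *: (v (u s) - v (u_ k s))| <= e / 3.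
  rewrite normrZ; apply: (@le_trans _ _ (2 * T * (L * (e / 3)))).
    apply: ler_pM => //.
      by apply: le_trans (ler_normB _ _) _; rewrite mulr_natl mulr2n lerD.
    apply: le_trans (vL (u_ball sT) (u_adm k sT).2) _.
    by rewrite ler_wpM2l// (le_trans (u_err k sT))// ltW.
  move: LT; move: (e / 3) e3 => d d0 ?; nra.
have h4 : `|u_ k.+1 t - u_ k.+1 s - (t - s) *: v (u_ k s)| <= L * M * `|t - s| ^+ 2.
  pose h x := u_ k.+1 x - (x - s) *: v (u_ k s).
  have -> : u_ k.+1 t - u_ k.+1 s - (t - s) *: v (u_ k s) = h t - h s.
    by rewrite /h subrr scale0r subr0 addrAC.
  rewrite expr2 mulrA.
  apply: (@mvt_bound _ _ _ (fun x => v (u_ k x) - v (u_ k s))).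
    by rewrite mulr_ge0// mulr_ge0.
  move=> c c01; have cT := between sT tT c01; split.
    apply: is_deriveB; first exact: (u_solves k).2.
    have dl : is_derive (s + c * (t - s)) (1 : R) (fun x : R => x - s) (1 : R).
      by rewrite -[X in is_derive _ _ _ X](subr0 1); apply: is_deriveB.
    have [d1 E] := derive_scale (@ex_derive _ _ _ _ _ _ _ dl)
      (derivable_cst (v (u_ k s)) (s + c * (t - s)) (1 : R)).
    apply: DeriveDef; first exact: d1.
    by rewrite E derive_val derive_cst scale1r scaler0 addr0.
  apply: le_trans (vL (u_adm k cT).2 (u_adm k sT).2) _.
  rewrite -mulrA ler_wpM2l//; apply: le_trans (u_lip k sT cT) _.
  rewrite ler_wpM2l// [s + _]addrC addrK normrM ler_piMl//.
  by case/andP: c01 => c0 c1; rewrite ger0_norm.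
have -> : u t - u s - (t - s) *: v (u s) =
    (u_ k.+1 t - u_ k.+1 s - (t - s) *: v (u_ k s)) + (u t - u_ k.+1 t)
    - (u s - u_ k.+1 s) - (t - s) *: (v (u s) - v (u_ k s)).
  rewrite scalerBr; apply/rowP => i; rewrite !mxE; ring.
apply: le_trans (ler_normB _ _) _; apply: le_trans (lerD (ler_normB _ _) h3) _.
apply: le_trans (lerD (lerD (ler_normD _ _) h2) (lexx _)) _.
apply: le_trans (lerD (lerD (lerD h4 h1) (lexx _)) (lexx _)) _.
rewrite le_eqVlt; apply/orP; left; by apply/eqP; field.
Qed.

Lemma picard : exists u : R -> 'rV[R]_m, u 0 = x0 /\
  forall t : R, `|t| < T -> `|u t - x0| <= r /\ is_derive t (1 : R) u (v (u t)).
Proof.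
exists u; split.
  have T00 : `|0 : R| <= T by rewrite normr0 ltW.
  apply/eqP; rewrite -subr_eq0 -normr_le0; apply/ler_addgt0Pr => e /err_small[k ke].
  rewrite add0r -(u_solves k).1 (le_trans (u_err k.+1 T00))// (le_trans _ (ltW ke))//.
  by rewrite /err exprS mulrCA ler_piMl ?invf_le1 ?ler1n// mulr_ge0 ?exprn_ge0// mulr_ge0.
move=> t tT; split; first exact/u_ball/ltW.
apply: is_derive_cvg; apply/cvgrPdist_lt => e e0.
have LM0 : 0 < L * M + 1 by rewrite ltr_wpDl// mulr_ge0.
have d0 : 0 < T - `|t| by rewrite subr_gt0.
near=> h.
have h0 : h != 0 by near: h; exact: nbhs_dnbhs_neq.
have he : `|h| * (L * M + 1) < e.
  by rewrite -ltr_pdivlMr//; near: h; apply: dnbhs0_lt; exact: divr_gt0.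
have hT : `|h| < T - `|t| by near: h; exact: dnbhs0_lt.
have thT : `|h + t| <= T.
  by rewrite (le_trans (ler_normD _ _))//; move: hT; move: (`|h|) (`|t|) => ? ?; lra.
have -> : v (u t) - h^-1 *: ((u \o shift t) h%:A - u t) =
    - (h^-1 *: (u (h + t) - u t - (h + t - t) *: v (u t))).
  rewrite addrK [RHS](_ : _ = h^-1 *: (h *: v (u t)) - h^-1 *: (u (h + t) - u t)).
    by rewrite scalerA mulVf// scale1r /= [h%:A]mulr1.
  by rewrite -scalerBr -scalerN opprB.
rewrite normrN normrZ normfV mulrC ltr_pdivrMr ?normr_gt0//.
apply: le_lt_trans (u_taylor (ltW tT) thT) _; rewrite addrK expr2 mulrA.
rewrite ltr_pM2r ?normr_gt0//; apply: le_lt_trans he.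
by rewrite mulrC ler_wpM2l// lerDl.
Unshelve. all: by end_near. Qed.

End Picard.

Section OrdinaryDifferentialEquations.
Context {R : realType}.

(** [M] and [K] bound [v] and its partial derivatives near [x0] by continuity. Along a segment in
    the ball the derivative of [v] combines m partial derivatives, whence the Lipschitz constant m
    K. *)
Lemma ode_exists m (U : set 'rV[R]_m) (v : 'rV[R]_m -> 'rV[R]_m) x0 :
  open U -> Ck 1 U v -> U x0 ->
  exists (T : R) (u : R -> 'rV[R]_m), [/\ 0 < T, u 0 = x0 &
    forall t : R, `|t| < T -> U (u t) /\ is_derive (t : R) (1 : R) u (v (u t))].
Proof.
move=> oU cv Ux.
pose e (i : 'I_m) : 'rV[R]_m := delta_mx 0 i.
pose K : R := 1 + \sum_i `|'D_(e i) v x0|; pose M : R := 1 + `|v x0|.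
have M0 : 0 < M by rewrite ltr_wpDr.
have K0 : 0 < K by rewrite ltr_wpDr// sumr_ge0.
have near_bound (f : 'rV[R]_m -> 'rV[R]_m) (B : R) : `|f x0| < B ->
    {for x0, continuous f} -> \forall x \near x0, `|f x| <= B.
  move=> fB cf; have d0 : 0 < B - `|f x0| by rewrite subr_gt0.
  move/cvgrPdist_lt : cf => /(_ _ d0); apply: filterS => x fx.
  rewrite -[f x](subrK (f x0)) (le_trans (ler_normD _ _))// distrC.
  by rewrite -lerBrDr ltW.
have n1 : \forall x \near x0, `|v x| <= M.
  by apply: near_bound (Ck_continuous cv Ux); rewrite /M ltr_pwDl.
have n2 i : \forall x \near x0, `|'D_(e i) v x| <= K.
  apply: near_bound (Ck_continuous (Ck_derive (e i) cv) Ux).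
  rewrite /K (bigD1 i)//= addrCA -[ltLHS]addr0 ltrD2l.
  by rewrite ltr_wpDr// sumr_ge0.
have n3 : \forall x \near x0, forall i, `|'D_(e i) v x| <= K.
  exact: (@filter_forall _ 'I_m (fun i x => `|'D_(e i) v x| <= K) (nbhs x0) _ n2).
have nx : nbhs x0 (U `&` ((fun x => `|v x| <= M) `&`
    (fun x => forall i, `|'D_(e i) v x| <= K))).
  apply: filterI; first exact: open_nbhs_nbhs.
  by apply: filterI; [exact: n1|exact: n3].
have /nbhs_normP[d /= d0 dP] := nx.
pose r := d / 2; have r0 : 0 < r by rewrite divr_gt0.
have rP x : `|x - x0| <= r -> [/\ U x, `|v x| <= M & forall i, `|'D_(e i) v x| <= K].
  move=> xr; suff /dP[? [? ?]] : ball_ Num.norm x0 d x by split.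
  by rewrite /ball_ /= distrC (le_lt_trans xr)// /r; move: d0; clear; lra.
pose L := m%:R * K; have L0 : 0 <= L by rewrite mulr_ge0// ltW.
have vL x y : `|x - x0| <= r -> `|y - x0| <= r -> `|v x - v y| <= L * `|x - y|.
  move=> xr yr; pose l (c : R) := y + c *: (x - y).
  have lr c : 0 <= c <= 1 -> `|l c - x0| <= r.
    move=> /andP[c0 c1].
    have -> : l c - x0 = (1 - c) *: (y - x0) + c *: (x - x0).
      by rewrite /l; apply/rowP => i; rewrite !mxE; ring.
    rewrite (le_trans (ler_normD _ _))// !normrZ (ger0_norm c0) ger0_norm ?subr_ge0//.
    apply: (@le_trans _ _ ((1 - c) * r + c * r)); last by rewrite -mulrDl subrK mul1r.
    by rewrite lerD// ler_wpM2l// subr_ge0.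
  have lE c s : l (s *: 1 + c) = s *: (x - y) + l c.
    by rewrite /l [s%:A]mulr1 scalerDl addrCA.
  have -> : v x = (v \o l) 1 by rewrite /l /= scale1r addrC subrK.
  have -> : v y = (v \o l) 0 by rewrite /l /= scale0r addr0.
  suff : `|(v \o l) 1 - (v \o l) 0| <= L * `|x - y| * `|1 - 0 : R|.
    by rewrite subr0 normr1 mulr1.
  apply: (@mvt_bound _ _ _ (fun c => 'D_(x - y) v (l c))); first by rewrite mulr_ge0.
  move=> c c01; have cE : 0 + c * (1 - 0) = c :> R by rewrite add0r subr0 mulr1.
  rewrite cE; have [Ul _ Dl] := rP _ (lr c c01).
  have dv := Ck_derivable (x - y) cv Ul.
  split.
    apply: DeriveDef; first exact: (derivable_affine (lE c) dv).
    exact: (derive_affine v (lE c)).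
  rewrite {1}(row_sum_delta (x - y)) derive_dir_sumV; last first.
    exact: (C1_differentiable (fin_dim_rV m) (fin_dim_rV m) oU cv Ul).
  rewrite (le_trans (ler_norm_sum _ _ _))//.
  apply: (@le_trans _ _ (\sum_(i < m) `|x - y| * K)).
    by apply: ler_sum => i _; rewrite normrZ ler_pM ?rV_coord_le ?Dl.
  by rewrite sumr_const card_ord -mulr_natl /L mulrA mulrAC.
pose T := Num.min (r / M) (2^-1 / (L + 1)).
have L1 : 0 < L + 1 by rewrite ltr_wpDl.
have T0 : 0 < T by rewrite lt_min !divr_gt0.
have MT : M * T <= r.
  by rewrite mulrC -ler_pdivlMr// ge_min lexx.
have LT : L * T <= 2^-1.
  apply: (@le_trans _ _ ((L + 1) * T)); first by rewrite ler_wpM2r ?ltW// ltrDl.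
  by rewrite mulrC -ler_pdivlMr// ge_min lexx orbT.
have vM x : `|x - x0| <= r -> `|v x| <= M by move=> /rP[].
have [u [u0 uP]] := picard (ltW r0) L0 (ltW M0) T0 MT LT vM vL.
by exists T, u; split=> // t /uP[/rP[Uu _ _] du].
Qed.

(** Bootstrapping: if [u] is of class C^k then so is its derivative [v \o u], and [Ck_curve] gains
    one order. *)
Lemma ode_smooth (V : normedModType R) (U : set V) (J : set R) (v : V -> V) (u : R -> V) :
  fin_dim V -> open U -> open J -> smooth_on U v ->
  (forall t, J t -> U (u t) /\ is_derive t (1 : R) u (v (u t))) -> smooth_on J u.
Proof.
move=> fV oU oJ sv Ju; elim=> [|k IH].
  split=> // t; rewrite inE => /Ju[_ [du _]].
  exact/differentiable_continuous/derivable1_diffP.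
apply: Ck_curve => //; first by move=> t /Ju[_ []].
apply: (@Ck_eq _ _ _ _ _ (v \o u)) => //.
  by move=> t /Ju[_ [_ dE]]; rewrite derive1E dE.
by apply: (Ck_comp fV fV oJ oU _ IH (sv k)) => t /Ju[].
Qed.

(** Separation of variables: [s] is the inverse of an increasing primitive [sigma] of 1 / psi. This
    solves s' = psi(s) on an interval mapped onto all of [I], which local existence of solutions
    would not give. *)
Lemma reparametrization (I : set R) (psi : R -> R) : open_interval I ->
  smooth_on I psi -> (forall t, I t -> 0 < psi t) ->
  exists (J : set R) (s : R -> R), [/\ open_interval J, smooth_on J s, s @` J = I &
    forall t, J t -> is_derive (t : R) (1 : R) s (psi (s t))].
Proof.
move=> oiI spsi psi0; have [[x0 Ix0] oI iI] := oiI.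
have cg t : I t -> {for t, continuous (fun t => (psi t)^-1)}.
  move=> It; apply: cvgV; first by rewrite gt_eqF// psi0.
  exact: Ck_continuous (spsi 0%N) It.
have [sigma dsigma] := antiderivative oiI cg.
have csigma t : I t -> {for t, continuous sigma}.
  by move=> It; have [d _] := dsigma t It; exact/differentiable_continuous/derivable1_diffP.
have stI a b : I a -> I b -> forall x, x \in `[a, b] -> I x.
  by move=> Ia Ib x; rewrite in_itv/=; exact: iI.
have cw a b : I a -> I b -> {within `[a, b], continuous sigma}.
  move=> Ia Ib; apply: continuous_in_subspaceT => x; rewrite inE => /(stI a b Ia Ib).
  exact: csigma.
have incr a b : I a -> I b -> a < b -> sigma a < sigma b.
  move=> Ia Ib ab.
  have [|c cab E] := @MVT R sigma (fun t => (psi t)^-1) a b ab _ (cw a b Ia Ib).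
    by move=> x xab; apply/dsigma/(stI a b Ia Ib); exact: subset_itv_oo_cc xab.
  rewrite -subr_gt0 E mulr_gt0 ?subr_gt0// invr_gt0 psi0//.
  by apply/(stI a b Ia Ib); exact: subset_itv_oo_cc cab.
have inj a b : I a -> I b -> sigma a = sigma b -> a = b.
  move=> Ia Ib E; have [ab|ba|//] := ltgtP a b.
    by have := incr _ _ Ia Ib ab; rewrite E ltxx.
  by have := incr _ _ Ib Ia ba; rewrite E ltxx.
have onto a b y : I a -> I b -> a <= b -> sigma a <= y <= sigma b ->
    exists2 c, I c & sigma c = y.
  move=> Ia Ib ab yab; have sab : sigma a <= sigma b by case/andP: yab => /le_trans; apply.
  have [|c cab <-] := @IVT R sigma a b y ab (cw a b Ia Ib).
    by rewrite min_l// max_r.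
  by exists c => //; exact: stI cab.
have /choice[s sP] y : exists x, (exists2 c, I c & sigma c = y) -> I x /\ sigma x = y.
  have [[c Ic cy]|h] := pselect (exists2 c, I c & sigma c = y); first by exists c.
  by exists 0.
have sK x : I x -> s (sigma x) = x.
  move=> Ix; have [|Is sE] := sP (sigma x); first by exists x.
  exact: inj.
exists (sigma @` I), s.
have ds t : (sigma @` I) t -> is_derive (t : R) (1 : R) s (psi (s t)).
  move=> [x Ix <-]; rewrite sK//.
  have nI : nbhs x I by exact: open_nbhs_nbhs.
  have := @is_derive_inverse R sigma s (psi x)^-1 x; rewrite invrK; apply.
  - by apply: filterS nI => y Iy; exact: sK.
  - by apply: filterS nI => y Iy; exact: csigma.
  - exact: dsigma.
  - by rewrite invr_eq0 gt_eqF// psi0.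
have oJ : open (sigma @` I).
  rewrite openE => _ [x Ix <-]; rewrite /interior.
  have /nbhs_normP[d /= d0 dI] := open_nbhs_nbhs (conj oI Ix).
  have d2 : 0 < d / 2 by rewrite divr_gt0.
  have Ia : I (x - d / 2).
    by apply: dI; rewrite /ball_ /= opprB addrC subrK gtr0_norm//; move: d0; clear; lra.
  have Ib : I (x + d / 2).
    by apply: dI; rewrite /ball_ /= opprD addNKr normrN gtr0_norm//; move: d0; clear; lra.
  have xab : sigma x \in `]sigma (x - d / 2), sigma (x + d / 2)[%R.
    by rewrite in_itv/= !incr// ?ltrBlDr ?ltrDl.
  apply: filterS (near_in_itvoo xab) => y.
  rewrite in_itv/= => /andP[ya yb].
  have [||c Ic <-] := onto (x - d / 2) (x + d / 2) y Ia Ib; last by exists c.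
    by rewrite lerBlDr -addrA lerDl; move: d2; clear; lra.
  by rewrite !ltW.
split=> //.
- split=> //; first by exists (sigma x0), x0.
  move=> _ _ [a Ia <-] [b Ib <-] y yab.
  have ab : a <= b.
    rewrite leNgt; apply/negP => ba; have := incr _ _ Ib Ia ba.
    by case/andP: yab => h1 h2; rewrite ltNge (le_trans h1 h2).
  by have [c Ic <-] := onto a b y Ia Ib ab yab; exists c.
- apply: (ode_smooth fin_dim_R oI oJ spsi) => t Jt; split; last exact: ds.
  by case: Jt => x Ix <-; rewrite sK.
- apply/seteqP; split=> [_ [_ [x Ix <-] <-]|x Ix]; first by rewrite sK.
  by exists (sigma x); [exists x|rewrite sK].
Qed.

End OrdinaryDifferentialEquations.

Section IsDerive.
Context {R : realType}.
Implicit Types V W Z : normedModType R.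

Lemma is_derive_sumE V W n (h : 'I_n -> V -> W) (x v : V) (dh : 'I_n -> W) :
  (forall i, is_derive x v (h i) (dh i)) ->
  is_derive x v (fun y => \sum_i h i y) (\sum_i dh i).
Proof.
move=> dhi; rewrite (_ : (fun y => _) = \sum_i h i); first exact: is_derive_sum.
by apply/funext => y; rewrite fct_sumE.
Qed.

Lemma is_derive_scale V W (a : V -> R) (f : V -> W) (x v : V) da df :
  is_derive x v a da -> is_derive x v f df ->
  is_derive x v (fun y => a y *: f y) (da *: f x + a x *: df).
Proof.
move=> [Da <-] [Df <-]; have [d E] := derive_scale Da Df.
by apply: DeriveDef; [exact: d|exact: E].
Qed.

Lemma is_derive_mul V (a f : V -> R) (x v : V) da df :
  is_derive x v a da -> is_derive x v f df ->
  is_derive x v (fun y => a y * f y) (da * f x + a x * df).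
Proof. exact: is_derive_scale. Qed.

Lemma is_derive_comp_diff V W Z (g : W -> Z) (f : V -> W) (x v : V) df :
  is_derive x v f df -> differentiable g (f x) ->
  is_derive x v (fun y => g (f y)) ('D_df g (f x)).
Proof.
move=> [Df <-] dg; have [d E] := derive_comp Df dg.
by apply: DeriveDef; [exact: d|exact: E].
Qed.

Lemma is_derive_lin V W Z (l : W -> Z) (f : V -> W) (x v : V) df :
  linear l -> continuous l -> is_derive x v f df ->
  is_derive x v (fun y => l (f y)) (l df).
Proof.
move=> ll cl [Df <-]; have [d E] := derive_lin' ll cl Df.
by apply: DeriveDef; [exact: d|exact: E].
Qed.

Lemma is_derive_fst V W Z (f : V -> W * Z) (x v : V) df :
  is_derive x v f df -> is_derive x v (fun y => (f y).1) df.1.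
Proof. by apply: (@is_derive_lin _ _ _ fst) => // y; exact: cvg_fst. Qed.

Lemma is_derive_snd V W Z (f : V -> W * Z) (x v : V) df :
  is_derive x v f df -> is_derive x v (fun y => (f y).2) df.2.
Proof. by apply: (@is_derive_lin _ _ _ snd) => // y; exact: cvg_snd. Qed.

Lemma is_derive_pair V W Z (f : V -> W) (g : V -> Z) (x v : V) df dg :
  is_derive x v f df -> is_derive x v g dg ->
  is_derive x v (fun y => (f y, g y)) (df, dg).
Proof.
move=> Df Dg.
have i1 : linear (fun v : W => (v, 0 : Z)).
  by move=> a u w; apply/pair_equal_spec; split; rewrite //= scaler0 addr0.
have i2 : linear (fun w : Z => (0 : W, w)).
  by move=> a u w; apply/pair_equal_spec; split; rewrite //= scaler0 addr0.
have c1 : continuous (fun v : W => (v, 0 : Z)).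
  by move=> y; apply: cvg_pair; [exact: cvg_id|exact: cvg_cst].
have c2 : continuous (fun w : Z => (0 : W, w)).
  by move=> y; apply: cvg_pair; [exact: cvg_cst|exact: cvg_id].
have -> : (fun y => (f y, g y)) = (fun y => (f y, 0)) + (fun y => (0, g y)).
  by apply/funext => y; apply/pair_equal_spec; rewrite /= addr0 add0r.
have -> : (df, dg) = (df, 0) + (0, dg).
  by apply/pair_equal_spec; rewrite /= addr0 add0r.
exact: is_deriveD (is_derive_lin i1 c1 Df) (is_derive_lin i2 c2 Dg).
Qed.

Lemma smooth_differentiable V W (A : set V) (f : V -> W) x : fin_dim V -> fin_dim W ->
  open A -> smooth_on A f -> A x -> differentiable f x.
Proof. by move=> fV fW oA sf; exact: (C1_differentiable fV fW oA (sf 1%N)). Qed.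

Lemma diff_is_derive V W (f : V -> W) x v : differentiable f x -> is_derive x v f ('D_v f x).
Proof. by move=> df; apply: DeriveDef; [exact: diff_derivable|]. Qed.

Lemma smooth_derive V W (A : set V) (f : V -> W) v : smooth_on A f -> smooth_on A ('D_v f).
Proof. by move=> sf k; exact: Ck_derive v (sf k.+1). Qed.

Lemma diff_dirD V W (f : V -> W) x u v : differentiable f x ->
  'D_(u + v) f x = 'D_u f x + 'D_v f x.
Proof. by move=> df; rewrite !deriveE// linearD. Qed.

Lemma diff_dirZ V W (f : V -> W) x (k : R) v : differentiable f x ->
  'D_(k *: v) f x = k *: 'D_v f x.
Proof. by move=> df; rewrite !deriveE// linearZ. Qed.

Lemma diff_dirN V W (f : V -> W) x v : differentiable f x ->
  'D_(- v) f x = - 'D_v f x.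
Proof. by move=> df; rewrite !deriveE// linearN. Qed.

End IsDerive.

Arguments smooth_derive {R V W A f} v.

(** * Finsler tensors in a chart *)

(* The derivative of the metric in the direction X: horizontal directions
   (a, 0) give its x-derivatives, vertical ones (0, w) twice the Cartan
   tensor. *)
HB.lock Definition dmetric (R : realType) (n : nat) (F : 'rV[R]_n * 'rV[R]_n -> R)
    (z X : 'rV[R]_n * 'rV[R]_n) (u v : 'rV[R]_n) : R :=
  'D_X (fun z' => finsler_inner F z' u v) z.

Section LocalFinsler.
Context {R : realType} {n : nat}.
Local Notation E := 'rV[R]_n.
Implicit Types (z X : E * E) (u v w : E).

Definition slit_over (U : set E) : set (E * E) := [set z | U z.1 /\ z.2 != 0].

(** Stated over any open coordinate set, because the expression of a map in two charts lives only on
    an overlap. For a whole chart see [local_finsler_chart]. *)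
Record local_finsler (U : set E) (F : E * E -> R) : Prop := LocalFinsler {
  local_open : open U;
  local_smooth : smooth_on (slit_over U) F;
  local_homogeneous : forall x y (l : R), U x -> 0 < l -> F (x, l *: y) = l * F (x, y);
  local_posdef : forall z, slit_over U z ->
    forall v, v != 0 -> 0 < finsler_inner F z v v }.

Lemma fin_dim_E2 : fin_dim ((E * E)%type : normedModType R).
Proof. by apply: fin_dim_pair; exact: fin_dim_rV. Qed.

Lemma open_neq0 : open [set y : E | y != 0].
Proof.
have -> : [set y : E | y != 0] = ~` [set 0].
  by apply/seteqP; split=> y /=; move/eqP.
by apply: closed_openC; apply: accessible_closed_set1; exact: hausdorff_accessible.
Qed.

Lemma open_slit_over (U : set E) : open U -> open (slit_over U).
Proof.
move=> oU; have -> : slit_over U = (fst @^-1` U) `&` (snd @^-1` [set y : E | y != 0]).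
  by [].
apply: openI; apply: open_comp => //.
- by move=> z _; exact: cvg_fst.
- by move=> z _; exact: cvg_snd.
- exact: open_neq0.
Qed.

(** The vector with components G^j_i u^i, so that [(u, - nonlinear_vec F z u)] is the horizontal
    lift u^i delta_i of [u]. *)
Definition nonlinear_vec (F : E * E -> R) z u : E :=
  \row_j \sum_i nonlinear F j i z * u 0 i.

Lemma finsler_innerE F z u v :
  finsler_inner F z u v = \sum_i \sum_j u 0 i * metric F z i j * v 0 j.
Proof.
rewrite /finsler_inner mxE exchange_big /=; apply: eq_bigr => j _.
by rewrite !mxE mulr_suml; apply: eq_bigr => i _.
Qed.

Lemma innerDl F z u v w :
  finsler_inner F z (u + v) w = finsler_inner F z u w + finsler_inner F z v w.
Proof. by rewrite /finsler_inner !mulmxDl mxE. Qed.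

Lemma innerZl F z (k : R) u w : finsler_inner F z (k *: u) w = k * finsler_inner F z u w.
Proof. by rewrite /finsler_inner -!scalemxAl mxE. Qed.

Lemma innerZr F z (k : R) u w : finsler_inner F z w (k *: u) = k * finsler_inner F z w u.
Proof. by rewrite /finsler_inner linearZ -scalemxAr mxE. Qed.

Lemma innerNl F z u w : finsler_inner F z (- u) w = - finsler_inner F z u w.
Proof. by rewrite -scaleN1r innerZl mulN1r. Qed.

Lemma inner0l F z w : finsler_inner F z 0 w = 0.
Proof. by rewrite -(scale0r 0) innerZl mul0r. Qed.

Lemma inner0r F z w : finsler_inner F z w 0 = 0.
Proof. by rewrite -(scale0r 0) innerZr mul0r. Qed.

Lemma inner_basis F z i j :
  finsler_inner F z (basis_vec i) (basis_vec j) = metric F z i j.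
Proof.
rewrite finsler_innerE (bigD1 i)//= (bigD1 j)//= !mxE !eqxx !mul1r mulr1.
rewrite !big1 ?addr0// => [k /negbTE ki|k /negbTE kj].
  by rewrite big1// => l _; rewrite !mxE ki andbF !mul0r.
by rewrite !mxE kj andbF mulr0.
Qed.

Context {U : set E} {F : E * E -> R} (HF : local_finsler U F).
Local Notation S := (slit_over U).
Local Notation B := (finsler_inner F).
Local Notation T := (dmetric F).

Let oU : open U := local_open HF.
Let oS : open S := open_slit_over oU.

Lemma smooth_F2 : smooth_on S (F2 F).
Proof.
move=> k; apply: (@Ck_eq _ _ _ _ _ (fun z => F z * F z)) => //.
by apply: Ck_mul => //; exact: local_smooth HF k.
Qed.

Lemma smooth_metric i j : smooth_on S (fun z => metric F z i j).
Proof.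
move=> k; apply: (@Ck_eq _ _ _ _ _ (fun z => 2^-1 * dy j (dy i (F2 F)) z)) => //.
  by move=> z _; rewrite mxE.
apply: Ck_mul => //; first exact: Ck_cst.
exact: (smooth_derive (0, basis_vec j) (smooth_derive (0, basis_vec i) smooth_F2) k).
Qed.

Lemma diff_metric z i j : S z -> differentiable (fun z => metric F z i j) z.
Proof. by move=> Sz; apply: smooth_differentiable fin_dim_E2 fin_dim_R oS
  (smooth_metric i j) Sz. Qed.

Lemma diff_dF2 z X : S z -> differentiable ('D_X (F2 F)) z.
Proof.
by move=> Sz; apply: smooth_differentiable fin_dim_E2 fin_dim_R oS (smooth_derive X smooth_F2) Sz.
Qed.

Lemma diff_F2 z : S z -> differentiable (F2 F) z.
Proof.
by move=> Sz; apply: smooth_differentiable fin_dim_E2 fin_dim_R oS smooth_F2 Sz.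
Qed.

Lemma d2F2_swap z X Y : S z -> 'D_X ('D_Y (F2 F)) z = 'D_Y ('D_X (F2 F)) z.
Proof. exact: (derive_swap X Y fin_dim_R oS (smooth_F2 2)). Qed.

Lemma vertical_sum v : (0, v) = \sum_i v 0 i *: (0, basis_vec i) :> E * E.
Proof.
rewrite [in LHS](row_sum_delta v); elim/big_rec2: _ => // i a b _ <-.
by apply/pair_equal_spec; split; rewrite /= ?scaler0 ?addr0.
Qed.

Lemma horizontal_sum v : (v, 0) = \sum_i v 0 i *: (basis_vec i, 0) :> E * E.
Proof.
rewrite [in LHS](row_sum_delta v); elim/big_rec2: _ => // i a b _ <-.
by apply/pair_equal_spec; split; rewrite /= ?scaler0 ?addr0.
Qed.

(** Frees the metric from coordinates: its symmetries and those of its derivatives now reduce to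
    exchanging directional derivatives of [F2]. *)
Lemma inner_hess z u v : S z -> B z u v = 2^-1 * 'D_(0, v) ('D_(0, u) (F2 F)) z.
Proof.
move=> Sz.
have -> : 'D_(0, v) ('D_(0, u) (F2 F)) z =
    'D_(0, v) (fun z => \sum_i u 0 i * 'D_(0, basis_vec i) (F2 F) z) z.
  apply: near_eq_derive; apply: filterS (open_nbhs_nbhs (conj oS Sz)) => z' Sz'.
  by rewrite {1}vertical_sum derive_dir_sumV//; exact: diff_F2.
have dE : is_derive z (0, v) (fun z => \sum_i u 0 i * 'D_(0, basis_vec i) (F2 F) z)
    (\sum_i u 0 i * 'D_(0, v) ('D_(0, basis_vec i) (F2 F)) z).
  apply: is_derive_sumE => i; have d := diff_is_derive (0, v) (diff_dF2 (0, basis_vec i) Sz).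
  have := is_derive_mul (is_derive_cst (u 0 i) z (0, v)) d.
  by rewrite mul0r add0r.
rewrite (@derive_val _ _ _ _ _ _ _ dE) mulr_sumr finsler_innerE; apply: eq_bigr => i _.
rewrite [in RHS](vertical_sum v) derive_dir_sumV; last exact: diff_dF2.
rewrite !mulr_sumr; apply: eq_bigr => j _; rewrite mxE -[_ *: _]/(_ * _) /dy.
by move: ('D_ _ _ _) => d; ring.
Qed.

Lemma innerC z u v : S z -> B z u v = B z v u.
Proof.
by move=> Sz; rewrite (inner_hess u v Sz) (inner_hess v u Sz) d2F2_swap.
Qed.

Lemma dmetricE z X u v : S z ->
  T z X u v = \sum_i \sum_j u 0 i * 'D_X (fun z => metric F z i j) z * v 0 j.
Proof.
move=> Sz.
have dE : is_derive z X (fun z' => \sum_i \sum_j u 0 i * metric F z' i j * v 0 j)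
    (\sum_i \sum_j u 0 i * 'D_X (fun z => metric F z i j) z * v 0 j).
  apply: is_derive_sumE => i; apply: is_derive_sumE => j.
  have d := is_derive_mul (is_derive_cst (u 0 i) z X) (diff_is_derive X (diff_metric i j Sz)).
  apply: is_derive_eq (is_derive_mul d (is_derive_cst (v 0 j) z X)) _.
  by rewrite mul0r add0r mulr0 addr0.
rewrite dmetric.unlock -(@derive_val _ _ _ _ _ _ _ dE); congr ('D_X _ z).
by apply/funext => z'; rewrite finsler_innerE.
Qed.

Lemma dmetricDX z X Y u v : S z -> T z (X + Y) u v = T z X u v + T z Y u v.
Proof.
move=> Sz; rewrite !dmetricE// -big_split; apply: eq_bigr => i _ /=.
rewrite -big_split; apply: eq_bigr => j _ /=.
by rewrite diff_dirD ?mulrDr ?mulrDl//; exact: diff_metric.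
Qed.

Lemma dmetricZX z (k : R) X u v : S z -> T z (k *: X) u v = k * T z X u v.
Proof.
move=> Sz; rewrite !dmetricE// mulr_sumr; apply: eq_bigr => i _.
rewrite mulr_sumr; apply: eq_bigr => j _.
by rewrite diff_dirZ -?[_ *: _]/(_ * _); [ring|exact: diff_metric].
Qed.

Lemma dmetricDl z X u u' v : S z -> T z X (u + u') v = T z X u v + T z X u' v.
Proof.
move=> Sz; rewrite !dmetricE// -big_split; apply: eq_bigr => i _ /=.
by rewrite -big_split; apply: eq_bigr => j _ /=; rewrite mxE; ring.
Qed.

Lemma dmetricZl z X (k : R) u v : S z -> T z X (k *: u) v = k * T z X u v.
Proof.
move=> Sz; rewrite !dmetricE// mulr_sumr; apply: eq_bigr => i _.
by rewrite mulr_sumr; apply: eq_bigr => j _; rewrite mxE; ring.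
Qed.

Lemma dmetricC z X u v : S z -> T z X u v = T z X v u.
Proof.
move=> Sz; rewrite dmetric.unlock; apply: near_eq_derive.
by apply: filterS (open_nbhs_nbhs (conj oS Sz)) => z' Sz'; exact: innerC.
Qed.

Lemma dmetricDr z X u v v' : S z -> T z X u (v + v') = T z X u v + T z X u v'.
Proof. by move=> Sz; rewrite !(dmetricC X u) ?dmetricDl. Qed.

Lemma dmetricZr z X (k : R) u v : S z -> T z X u (k *: v) = k * T z X u v.
Proof. by move=> Sz; rewrite !(dmetricC X u) ?dmetricZl. Qed.

Lemma dmetric_hess z X u v : S z ->
  T z X u v = 2^-1 * 'D_X ('D_(0, v) ('D_(0, u) (F2 F))) z.
Proof.
move=> Sz.
have -> : T z X u v = 'D_X (fun z => 2^-1 * 'D_(0, v) ('D_(0, u) (F2 F)) z) z.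
  rewrite dmetric.unlock; apply: near_eq_derive.
  by apply: filterS (open_nbhs_nbhs (conj oS Sz)) => z' Sz'; exact: inner_hess.
have d : differentiable ('D_(0, v) ('D_(0, u) (F2 F))) z.
  exact: (smooth_differentiable fin_dim_E2 fin_dim_R oS (smooth_derive (0, v) (smooth_derive
    (0, u) smooth_F2)) Sz).
have dE := is_derive_mul (is_derive_cst (2^-1 : R) z X) (diff_is_derive X d).
by rewrite (@derive_val _ _ _ _ _ _ _ dE) mul0r add0r.
Qed.

(** Both sides are half a third vertical derivative of [F2]: with [dmetricC], the total symmetry of
    the Cartan tensor. *)
Lemma dmetric_vertC z u v w : S z -> T z (0, w) u v = T z (0, u) w v.
Proof.
move=> Sz; rewrite (dmetricC (0, w) u v Sz) (dmetricC (0, u) w v Sz).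
have sw := derive_swap (0, w) (0, u) fin_dim_R oS (smooth_derive (0, v) smooth_F2 2) Sz.
exact: (etrans (dmetric_hess (0, w) v u Sz)
  (etrans (congr1 (fun d => 2^-1 * d) sw) (esym (dmetric_hess (0, u) v w Sz)))).
Qed.

Lemma is_derive_inner (P : normedModType R) (zeta : P -> E * E) (A C : P -> E)
    (p q : P) dzeta dA dC :
  is_derive p q zeta dzeta -> is_derive p q A dA -> is_derive p q C dC -> S (zeta p) ->
  is_derive p q (fun p => B (zeta p) (A p) (C p))
    (T (zeta p) dzeta (A p) (C p) + B (zeta p) dA (C p) + B (zeta p) (A p) dC).
Proof.
move=> dz dA' dC' Sz.
rewrite (_ : (fun p => _) = fun p => \sum_i \sum_j A p 0 i * metric F (zeta p) i j * C p 0 j).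
  rewrite dmetricE// !finsler_innerE -!big_split /=; apply: is_derive_sumE => i.
  rewrite -!big_split /=; apply: is_derive_sumE => j.
  have d := is_derive_mul (is_derive_mul (is_derive_coord i dA')
    (is_derive_comp_diff dz (diff_metric i j Sz))) (is_derive_coord j dC').
  apply: is_derive_eq d _ => /=; move: ('D_ _ _ _) => d; ring.
by apply/funext => p'; rewrite finsler_innerE.
Qed.

End LocalFinsler.

Section LocalFinslerIdentities.
Context {R : realType} {n : nat}.
Local Notation E := 'rV[R]_n.
Implicit Types (z X : E * E) (u v w V : E).
Context {U : set E} {F : E * E -> R} (HF : local_finsler U F).
Local Notation S := (slit_over U).
Local Notation B := (finsler_inner F).
Local Notation T := (dmetric F).

Let oU : open U := local_open HF.
Let oS : open S := open_slit_over oU.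

Lemma scale_slit (x y : E) (l : R) : S (x, y) -> 0 < l -> S (x, l *: y).
Proof. by move=> [Ux y0] l0; split; rewrite //= scaler_eq0 negb_or gt_eqF. Qed.

(** The homogeneity relation is differentiated through the fibre dilation [L], which carries the
    direction [(a, b)] to [(a, l *: b)]. For [a = 0] this lowers the degree by one. *)
Lemma derive_scaling (h : E * E -> R) (a b x y : E) (l : R) k :
  (forall x y (l : R), S (x, y) -> 0 < l -> h (x, l *: y) = l ^+ k * h (x, y)) ->
  S (x, y) -> 0 < l -> differentiable h (x, y) ->
  'D_(a, l *: b) h (x, l *: y) = l ^+ k * 'D_(a, b) h (x, y).
Proof.
move=> hk Sxy l0 dh; pose L (z : E * E) : E * E := (z.1, l *: z.2).
have LE s : L (s *: (a, b) + (x, y)) = s *: (a, l *: b) + L (x, y).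
  apply/pair_equal_spec; split; rewrite //= scalerDr; congr (_ + _).
  by rewrite !scalerA mulrC.
have /= <- := derive_affine h LE.
have -> : 'D_(a, b) (h \o L) (x, y) = 'D_(a, b) (fun z => l ^+ k * h z) (x, y).
  apply: near_eq_derive; apply: filterS (open_nbhs_nbhs (conj oS Sxy)) => -[x' y'] Sxy'.
  exact: hk.
have dE := is_derive_mul (is_derive_cst (l ^+ k) (x, y) (a, b)) (diff_is_derive (a, b) dh).
by rewrite (@derive_val _ _ _ _ _ _ _ dE) mul0r add0r.
Qed.

(** Derivative at t = 0 of h(x, (1 + t) y) = (1 + t)^k h(x, y), an identity valid for t near 0,
    where 1 + t > 0. *)
Lemma euler (h : E * E -> R) z k :
  (forall x y (l : R), S (x, y) -> 0 < l -> h (x, l *: y) = l ^+ k * h (x, y)) ->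
  S z -> differentiable h z -> 'D_(0, z.2) h z = k%:R * h z.
Proof.
case: z => x y hk Sxy dh; pose L (t : R) : E * E := t *: (0, y) + (x, y).
have L0 : L 0 = (x, y) by rewrite /L scale0r add0r.
have LE (s : R) : L (s *: 1 + 0) = s *: (0, y) + L 0.
  by rewrite L0 /L addr0 [s%:A]mulr1.
have /= := derive_affine h LE; rewrite L0 => <-.
have -> : 'D_1 (h \o L) 0 = 'D_1 (fun t : R => ((id + cst (1 : R)) ^+ k) t * cst (h (x, y)) t) 0.
  apply: near_eq_derive; have n1 : \forall t \near (0 : R), `|t| < 1 by exact: nbhs0_lt.
  apply: filterS n1 => t; rewrite ltr_norml => /andP[tN1 _].
  have t1 : 0 < 1 + t by rewrite -ltrBlDl sub0r.
  have -> : ((id + cst 1) ^+ k) t = (1 + t) ^+ k :> R by rewrite !fctE addrC.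
  rewrite [cst _ _]/= -hk//; have -> : (h \o L) t = h (L t) by [].
  have -> // : L t = (x, (1 + t) *: y).
  by apply/pair_equal_spec; split; rewrite /= ?scaler0 ?add0r// scalerDl scale1r addrC.
have d1 : is_derive (0 : R) (1 : R) (id + cst (1 : R)) (1 + 0 : R) by exact: is_deriveD.
have dE := is_derive_mul (is_deriveX k d1) (is_derive_cst (h (x, y)) (0 : R) (1 : R)).
rewrite (@derive_val _ _ _ _ _ _ _ dE) mulr0 !addr0; congr (_ * _).
by rewrite -[_ *: _]/(_ * _) !fctE /= add0r expr1n !mulr1.
Qed.

Lemma F2_scale x y (l : R) : S (x, y) -> 0 < l -> F2 F (x, l *: y) = l ^+ 2 * F2 F (x, y).
Proof. by move=> [Ux _] l0; rewrite /F2 (local_homogeneous HF)// exprMn. Qed.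

Lemma dF2_scale v x y (l : R) : S (x, y) -> 0 < l ->
  'D_(0, v) (F2 F) (x, l *: y) = l ^+ 1 * 'D_(0, v) (F2 F) (x, y).
Proof.
move=> Sxy l0; have l1 : l != 0 by rewrite gt_eqF.
have := derive_scaling 0 v F2_scale Sxy l0 (diff_F2 HF Sxy).
have -> : (0, l *: v) = l *: (0, v) :> E * E.
  by apply/pair_equal_spec; rewrite /= scaler0.
rewrite diff_dirZ; last exact/(diff_F2 HF)/scale_slit.
by rewrite expr1 expr2 -mulrA -[_ *: _]/(_ * _) => /(mulfI l1).
Qed.

Lemma inner_scale x y (l : R) u v : S (x, y) -> 0 < l ->
  B (x, l *: y) u v = B (x, y) u v.
Proof.
move=> Sxy l0; have l1 : l != 0 by rewrite gt_eqF.
have Sl := scale_slit Sxy l0.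
rewrite (inner_hess HF u v Sl) (inner_hess HF u v Sxy).
have := derive_scaling 0 v (dF2_scale u) Sxy l0 (diff_dF2 HF (0, u) Sxy).
have -> : (0, l *: v) = l *: (0, v) :> E * E.
  by apply/pair_equal_spec; rewrite /= scaler0.
rewrite diff_dirZ; last exact: (diff_dF2 HF).
by rewrite expr1 -[_ *: _]/(_ * _) => /(mulfI l1) ->.
Qed.

Lemma diff_inner z u v : S z -> differentiable (fun z => B z u v) z.
Proof.
move=> Sz; have -> : (fun z => B z u v) =
    \sum_i \sum_j (fun z => (u 0 i * v 0 j) *: metric F z i j).
  apply/funext => z'; rewrite finsler_innerE fct_sumE; apply: eq_bigr => i _.
  by rewrite fct_sumE; apply: eq_bigr => j _; rewrite -[_ *: _]/(_ * _); ring.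
apply: differentiable_sum => i; apply: differentiable_sum => j.
apply: (@differentiableZ _ _ _ (fun z => metric F z i j)).
exact: diff_metric HF _ _ _ Sz.
Qed.

Lemma dmetric_scale x y (l : R) a b u v : S (x, y) -> 0 < l ->
  T (x, l *: y) (a, l *: b) u v = T (x, y) (a, b) u v.
Proof.
move=> Sxy l0; rewrite dmetric.unlock.
have := @derive_scaling (fun z => B z u v) a b x y l 0 _ Sxy l0 (diff_inner u v Sxy).
rewrite expr0 mul1r; apply => x' y' l' S' l0'; rewrite expr0 mul1r.
exact: inner_scale.
Qed.

Lemma inner_y z v : S z -> B z z.2 v = 2^-1 * 'D_(0, v) (F2 F) z.
Proof.
move=> Sz; rewrite (innerC HF _ _ Sz) (inner_hess HF _ _ Sz).
by rewrite (euler (dF2_scale v) Sz (diff_dF2 HF _ Sz)) mul1r.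
Qed.

Lemma inner_yy z : S z -> B z z.2 z.2 = F2 F z.
Proof.
move=> Sz; rewrite (inner_y _ Sz) (euler F2_scale Sz (diff_F2 HF Sz)) mulrA.
by rewrite mulVf ?mul1r// pnatr_eq0.
Qed.

(** Euler's relation in degree 0, as the metric is constant along the rays of a fibre. By total
    symmetry the Cartan tensor vanishes as soon as one argument is y. *)
Lemma dmetric_vy z u v : S z -> T z (0, z.2) u v = 0.
Proof.
move=> Sz; have := @euler (fun z => B z u v) z 0 _ Sz (diff_inner u v Sz).
rewrite mul0r dmetric.unlock; apply => x' y' l' S' l0'; rewrite expr0 mul1r.
exact: inner_scale.
Qed.

Lemma dmetric_yl z u v : S z -> T z (0, v) z.2 u = 0.
Proof. by move=> Sz; rewrite (dmetric_vertC HF _ _ _ Sz) dmetric_vy. Qed.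

Lemma dmetric_yr z u v : S z -> T z (0, v) u z.2 = 0.
Proof. by move=> Sz; rewrite (dmetricC HF _ _ _ Sz) dmetric_yl. Qed.

Lemma metric_unit z : S z -> metric F z \in unitmx.
Proof.
move=> Sz; rewrite unitmxE unitfE; apply/negP => /det0P[v v0 vM].
by have := local_posdef HF Sz v0; rewrite /finsler_inner vM mul0mx mxE ltxx.
Qed.

Lemma finsler_metric_sym z : S z -> (metric F z)^T = metric F z.
Proof.
move=> Sz; apply/matrixP => i j; rewrite mxE -!inner_basis.
by rewrite (innerC HF _ _ Sz).
Qed.

(** [metric_inv] raises the index of the covector [c] and the pairing lowers it again, so inverse
    matrices disappear from paired identities. *)
Lemma inner_sharp z (c : E) w : S z ->
  B z (\row_i \sum_l metric_inv F z i l * c 0 l) w = \sum_l c 0 l * w 0 l.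
Proof.
move=> Sz; have -> : \row_i \sum_l metric_inv F z i l * c 0 l = c *m (metric_inv F z)^T.
  by apply/rowP => i; rewrite !mxE; apply: eq_bigr => l _; rewrite mxE mulrC.
rewrite /finsler_inner /metric_inv trmx_inv (finsler_metric_sym Sz) -!mulmxA mulKmx.
  by rewrite mxE; apply: eq_bigr => l _; rewrite mxE.
exact: metric_unit.
Qed.

Lemma inner_inj z u v : S z -> (forall w, B z u w = B z v w) -> u = v.
Proof.
move=> Sz uv; apply/eqP; rewrite -subr_eq0; apply/negPn/negP => /(local_posdef HF Sz).
by rewrite innerDl innerNl uv subrr ltxx.
Qed.

Lemma pair_dir_sum (f : E * E -> R) z a b : differentiable f z ->
  'D_(a, b) f z = \sum_i a 0 i * dx i f z + \sum_i b 0 i * dy i f z.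
Proof.
move=> df; have -> : (a, b) = (a, 0) + (0, b) :> E * E.
  by apply/pair_equal_spec; rewrite /= addr0 add0r.
rewrite diff_dirD//; congr (_ + _).
  by rewrite horizontal_sum derive_dir_sumV.
by rewrite vertical_sum derive_dir_sumV.
Qed.

Lemma hderiv_sum (f : E * E -> R) z a : differentiable f z ->
  'D_(a, - nonlinear_vec F z a) f z = \sum_i a 0 i * hderiv F i f z.
Proof.
move=> df; rewrite pair_dir_sum//.
under [in RHS]eq_bigr do rewrite /hderiv mulrBr.
rewrite sumrB; congr (_ + _).
under eq_bigr do rewrite !mxE mulNr mulr_suml.
rewrite sumrN; congr (- _); rewrite exchange_big; apply: eq_bigr => i _ /=.
by rewrite mulr_sumr; apply: eq_bigr => j _; ring.
Qed.

(** A Koszul formula: the first three terms come from [Gamma], with metric derivatives along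
    horizontal lifts, and the last is the Cartan tensor on the vertical part of [X]. *)
Lemma connection_inner z X V w : S z ->
  2 * B z (connection_form F z X V) w =
    T z (V, - nonlinear_vec F z V) w X.1 + T z (X.1, - nonlinear_vec F z X.1) V w
    - T z (w, - nonlinear_vec F z w) V X.1
    + T z (0, w) V (X.2 + nonlinear_vec F z X.1).
Proof.
move=> Sz; set u := X.1; set q := X.2 + nonlinear_vec F z u.
pose H i j k := hderiv F i (fun z => metric F z j k) z.
pose K i j k := dy i (fun z => metric F z j k) z.
(* [c] is twice [connection_form F z X V] with its index lowered; [H] and [K] are the horizontal and
   vertical derivatives of the metric entries. *)
pose c : E := \row_l \sum_j \sum_k ((H j l k + H k j l - H l j k) * V 0 j * u 0 k
                                    + K l j k * V 0 j * q 0 k).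
have -> : connection_form F z X V =
    2^-1 *: \row_i \sum_l metric_inv F z i l * c 0 l.
  apply/rowP => i; rewrite !mxE mulr_sumr.
  under [in RHS]eq_bigr => l _.
    rewrite mxE mulr_sumr mulr_sumr; under eq_bigr do rewrite mulr_sumr mulr_sumr; over.
  rewrite [in RHS]exchange_big; apply: eq_bigr => j _ /=.
  rewrite [in RHS]exchange_big; apply: eq_bigr => k _ /=.
  rewrite /Gamma /Cartan -/u.
  have -> : X.2 0 k + \sum_l nonlinear F k l z * u 0 l = q 0 k by rewrite /q !mxE.
  rewrite !(mulr_sumr, mulr_suml) -big_split; apply: eq_bigr => l _ /=.
  by rewrite -/(H j l k) -/(H k j l) -/(H l j k) -/(K l j k); ring.
rewrite innerZl mulrA divff ?pnatr_eq0// mul1r (inner_sharp _ _ Sz).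
have TE a b d : T z (a, - nonlinear_vec F z a) b d =
    \sum_i \sum_j \sum_k b 0 i * (a 0 k * H k i j) * d 0 j.
  rewrite (dmetricE HF _ _ _ Sz); apply: eq_bigr => i _; apply: eq_bigr => j _.
  rewrite hderiv_sum; last exact: diff_metric HF _ _ _ Sz.
  by rewrite mulr_sumr mulr_suml.
have TV a b d : T z (0, a) b d = \sum_i \sum_j \sum_k b 0 i * (a 0 k * K k i j) * d 0 j.
  rewrite (dmetricE HF _ _ _ Sz); apply: eq_bigr => i _; apply: eq_bigr => j _.
  rewrite vertical_sum derive_dir_sumV; last exact: diff_metric HF _ _ _ Sz.
  by rewrite mulr_sumr mulr_suml.
rewrite !TE TV.
have -> : \sum_l c 0 l * w 0 l = \sum_l \sum_j \sum_k
    ((H j l k + H k j l - H l j k) * V 0 j * u 0 k * w 0 l + K l j k * V 0 j * q 0 k * w 0 l).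
  apply: eq_bigr => l _; rewrite mxE mulr_suml; apply: eq_bigr => j _.
  by rewrite mulr_suml; apply: eq_bigr => k _; rewrite mulrDl.
have -> : \sum_i \sum_j \sum_k w 0 i * (V 0 k * H k i j) * u 0 j =
    \sum_i \sum_k \sum_j w 0 i * (V 0 k * H k i j) * u 0 j.
  by apply: eq_bigr => i _; rewrite exchange_big.
have -> : \sum_i \sum_j \sum_k V 0 i * (u 0 k * H k i j) * w 0 j =
    \sum_j \sum_i \sum_k V 0 i * (u 0 k * H k i j) * w 0 j by rewrite exchange_big.
(* The triple sums are reordered until the index contracted with [w] is outermost, so that summands
   can be compared. *)
have rot (f : 'I_n -> 'I_n -> 'I_n -> R) :
    \sum_i \sum_j \sum_k f i j k = \sum_k \sum_i \sum_j f i j k.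
  by rewrite [RHS]exchange_big; apply: eq_bigr => i _; rewrite exchange_big.
rewrite (rot (fun i j k => V 0 i * (w 0 k * H k i j) * u 0 j)).
rewrite (rot (fun i j k => V 0 i * (w 0 k * K k i j) * q 0 j)).
rewrite -sumrN -!big_split; apply: eq_bigr => l _ /=.
rewrite -sumrN -!big_split; apply: eq_bigr => j _ /=.
rewrite -sumrN -!big_split; apply: eq_bigr => k _ /=.
by ring.
Qed.

(** For [X.1 = y] the nonlinear connection drops out: in the directions [V] and [w] it only enters a
    Cartan tensor with an argument y, and the two terms in [nonlinear_vec F z z.2] cancel by
    symmetry. *)
Lemma connection_inner_y z v V w : S z ->
  2 * B z (connection_form F z (z.2, v) V) w =
    T z (V, 0) w z.2 + T z (z.2, 0) V w - T z (w, 0) V z.2 + T z (0, w) V v.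
Proof.
move=> Sz; rewrite (connection_inner _ _ _ Sz) /=.
have TD a b c d : T z (a, b) c d = T z (a, 0) c d + T z (0, b) c d.
  by rewrite -(dmetricDX HF _ _ _ _ Sz); congr (T z _ c d); apply/pair_equal_spec;
    rewrite /= addr0 add0r.
have vN b c d : T z (0, - b) c d = - T z (0, b) c d.
  have -> : (0, - b) = (-1) *: (0, b) :> E * E.
    by apply/pair_equal_spec; rewrite /= scaler0 scaleN1r.
  by rewrite (dmetricZX HF _ _ _ _ Sz) mulN1r.
rewrite (TD V) (TD z.2) (TD w) !vN !(dmetric_yr _ _ Sz) (dmetricDr HF _ _ _ _ Sz).
have -> : T z (0, w) V (nonlinear_vec F z z.2) = T z (0, nonlinear_vec F z z.2) V w.
  by rewrite (dmetricC HF _ _ _ Sz) (dmetric_vertC HF _ _ _ Sz) (dmetricC HF _ _ _ Sz).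
by ring.
Qed.

Lemma smooth_inner k (P : normedModType R) (A : set P) (zeta : P -> E * E) (a b : P -> E) :
  open A -> (forall p, A p -> S (zeta p)) ->
  Ck k A zeta -> Ck k A a -> Ck k A b -> Ck k A (fun p => B (zeta p) (a p) (b p)).
Proof.
move=> oA AS Cz Ca Cb.
rewrite (_ : (fun p => _) =
  fun p => \sum_i \sum_j a p 0 i * metric F (zeta p) i j * b p 0 j); last first.
  by apply/funext => p; rewrite finsler_innerE.
apply: Ck_sum => // i; apply: Ck_sum => // j; apply: Ck_mul => //; last exact: Ck_coord.
apply: Ck_mul => //; first exact: Ck_coord.
exact: (Ck_comp fin_dim_E2 fin_dim_R oA oS AS Cz (smooth_metric HF i j k)).
Qed.

Lemma smooth_dmetric k (P : normedModType R) (A : set P) (zeta X : P -> E * E) (a b : P -> E) :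
  open A -> (forall p, A p -> S (zeta p)) ->
  Ck k A zeta -> Ck k A X -> Ck k A a -> Ck k A b ->
  Ck k A (fun p => T (zeta p) (X p) (a p) (b p)).
Proof.
move=> oA AS Cz CX Ca Cb.
apply: (@Ck_eq _ _ _ _ _ (fun p => \sum_i \sum_j
    a p 0 i * 'D_(X p) (fun z => metric F z i j) (zeta p) * b p 0 j)) => //.
  by move=> p Ap; rewrite (dmetricE HF _ _ _ (AS p Ap)).
apply: Ck_sum => // i; apply: Ck_sum => // j; apply: Ck_mul => //; last exact: Ck_coord.
apply: Ck_mul => //; first exact: Ck_coord.
exact: (Ck_derive_along fin_dim_E2 fin_dim_R oA oS AS (smooth_metric HF i j k.+1)).
Qed.

Lemma smooth_sharp k (P : normedModType R) (A : set P) (zeta : P -> E * E) (c : 'I_n -> P -> R) :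
  open A -> (forall p, A p -> S (zeta p)) ->
  Ck k A zeta -> (forall l, Ck k A (c l)) ->
  Ck k A (fun p => \row_i \sum_l metric_inv F (zeta p) i l * c l p).
Proof.
move=> oA AS Cz Cc; apply: Ck_row => // i; apply: Ck_sum => // l; apply: Ck_mul => //.
apply: Ck_invmx => // [p Ap|i' j']; first exact/metric_unit/AS.
exact: (Ck_comp fin_dim_E2 fin_dim_R oA oS AS Cz (smooth_metric HF i' j' k)).
Qed.

Section Gradient.
Context {phi : E -> R} (sphi : smooth_on U phi).
Local Notation W := (gradient F phi).

Lemma diff_phi x : U x -> differentiable phi x.
Proof. exact: smooth_differentiable (fin_dim_rV n) fin_dim_R oU sphi. Qed.

Lemma partial_sum x v : U x -> 'D_v phi x = \sum_i partial i phi x * v 0 i.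
Proof.
move=> Ux; rewrite [in LHS](row_sum_delta v) derive_dir_sumV; last exact: diff_phi.
by apply: eq_bigr => i _; rewrite mulrC.
Qed.

Lemma inner_gradient z w : S z -> B z (W z) w = 'D_w phi z.1.
Proof.
move=> Sz; have -> : W z = \row_i \sum_l metric_inv F z i l * (\row_l partial l phi z.1) 0 l.
  by apply/rowP => i; rewrite !mxE; apply: eq_bigr => l _; rewrite mxE.
rewrite (inner_sharp _ _ Sz) partial_sum; last by case: Sz.
by apply: eq_bigr => l _; rewrite mxE.
Qed.

Lemma smooth_gradient : smooth_on S W.
Proof.
move=> k; apply: (smooth_sharp oS) => //; first exact: Ck_id.
move=> l; apply: (Ck_comp (fin_dim_rV n) fin_dim_R oS oU).
- by move=> z [].
- by apply: Ck_fst => //; exact: Ck_id.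
- exact: smooth_derive sphi k.
Qed.

Lemma diff_gradient z : S z -> differentiable W z.
Proof. exact: smooth_differentiable fin_dim_E2 (fin_dim_rV n) oS smooth_gradient. Qed.

(** [inner_gradient] is differentiated with [w] fixed; the variation of the metric along [X] moves
    to the right. *)
Lemma inner_dgradient z X w : S z ->
  B z ('D_X W z) w = 'D_(X.1) ('D_w phi) z.1 - T z X (W z) w.
Proof.
move=> Sz.
have d1 := is_derive_inner HF (is_derive_id z X) (diff_is_derive X (diff_gradient Sz))
  (is_derive_cst w z X) Sz.
have dw : differentiable ('D_w phi) z.1.
  apply: smooth_differentiable (fin_dim_rV n) fin_dim_R oU (smooth_derive w sphi) _.
  by case: Sz.
have d2 := is_derive_comp_diff (is_derive_fst (is_derive_id z X)) dw.
have : 'D_X (fun z => B z (W z) w) z = 'D_X (fun z => 'D_w phi z.1) z.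
  apply: near_eq_derive; apply: filterS (open_nbhs_nbhs (conj oS Sz)) => z' Sz'.
  exact: inner_gradient.
rewrite (@derive_val _ _ _ _ _ _ _ d1) (@derive_val _ _ _ _ _ _ _ d2) inner0r addr0.
by move=> <-; rewrite /= addrAC subrr add0r.
Qed.

End Gradient.

Lemma inner_spray z w : S z ->
  4 * B z (\row_i spray F i z) w =
  \sum_k z.2 0 k * 'D_(0, w) (dx k (F2 F)) z - 'D_(w, 0) (F2 F) z.
Proof.
move=> Sz; pose c : E := \row_l (\sum_k dy l (dx k (F2 F)) z * z.2 0 k - dx l (F2 F) z).
have -> : \row_i spray F i z = 4^-1 *: \row_i \sum_l metric_inv F z i l * c 0 l.
  by apply/rowP => i; rewrite !mxE; congr (_ * _); apply: eq_bigr => l _; rewrite mxE.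
rewrite innerZl mulrA divff ?pnatr_eq0// mul1r (inner_sharp _ _ Sz).
under eq_bigr do rewrite mxE mulrBl mulr_suml.
rewrite sumrB exchange_big; congr (_ - _) => /=.
  apply: eq_bigr => k _; rewrite vertical_sum derive_dir_sumV; last first.
    exact: diff_dF2 HF _ _ Sz.
  rewrite mulr_sumr; apply: eq_bigr => l _.
  by rewrite -[_ *: _]/(_ * _) /dy; move: ('D_ _ _ _) => d; ring.
rewrite horizontal_sum derive_dir_sumV; last exact: diff_F2 HF _ Sz.
by apply: eq_bigr => l _; rewrite mulrC.
Qed.

Lemma smooth_spray : smooth_on S (fun z => \row_i spray F i z).
Proof.
move=> k.
pose c l z := \sum_k dy l (dx k (F2 F)) z * z.2 0 k - dx l (F2 F) z.
rewrite (_ : (fun z => _) = fun z => 4^-1 *: \row_i \sum_l metric_inv F z i l * c l z); last first.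
  by apply/funext => z; apply/rowP => i; rewrite !mxE.
apply: Ck_scale => //; first exact: Ck_cst.
apply: (smooth_sharp oS) => //; first exact: Ck_id.
move=> l; apply: (@Ck_eq _ _ _ _ _ (fun z =>
    \sum_k dy l (dx k (F2 F)) z * z.2 0 k + (-1) * dx l (F2 F) z)) => //.
  by move=> z _; rewrite mulN1r.
apply: Ck_add => //; last first.
  apply: Ck_mul => //; first exact: Ck_cst.
  exact: (smooth_derive (basis_vec l, 0) (smooth_F2 HF) k).
apply: Ck_sum => // k'; apply: Ck_mul => //.
  exact: (smooth_derive (0, basis_vec l) (smooth_derive (basis_vec k', 0) (smooth_F2 HF)) k).
by apply: Ck_coord => //; apply: Ck_snd => //; exact: Ck_id.
Qed.

End LocalFinslerIdentities.

(* The Cartan derivative along the lift (c, c') of a curve with c = x, c' = y and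
   c'' = v, where z = (x, y), of a field with value V and derivative dV there. *)
HB.lock Definition nab (R : realType) (n : nat) (F : 'rV[R]_n * 'rV[R]_n -> R)
  (z : 'rV[R]_n * 'rV[R]_n) (v V dV : 'rV[R]_n) : 'rV[R]_n :=
  dV + connection_form F z (z.2, v) V.

(** * The Cartan derivative along lifts of curves *)

Section CovariantDerivative.
Context {R : realType} {n : nat}.
Local Notation E := 'rV[R]_n.
Implicit Types (z X : E * E) (u v w V : E).

Context {U : set E} {F : E * E -> R} (HF : local_finsler U F).
Local Notation S := (slit_over U).
Local Notation B := (finsler_inner F).
Local Notation T := (dmetric F).

Lemma pairD (a b : E) : (a, b) = (a, 0) + (0, b) :> E * E.
Proof. by apply/pair_equal_spec; rewrite /= addr0 add0r. Qed.

Lemma dmetric_pair z a b u v : S z -> T z (a, b) u v = T z (a, 0) u v + T z (0, b) u v.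
Proof. by move=> Sz; rewrite {1}pairD (dmetricDX HF _ _ _ _ Sz). Qed.

Lemma dmetric_vertD z a b u v : S z -> T z (0, a + b) u v = T z (0, a) u v + T z (0, b) u v.
Proof.
move=> Sz; rewrite -(dmetricDX HF _ _ _ _ Sz); congr (T z _ u v).
by apply/pair_equal_spec; rewrite /= addr0.
Qed.

Lemma dmetric_vertZ z (k : R) a u v : S z -> T z (0, k *: a) u v = k * T z (0, a) u v.
Proof.
move=> Sz; rewrite -(dmetricZX HF _ _ _ _ Sz); congr (T z _ u v).
by apply/pair_equal_spec; rewrite /= scaler0.
Qed.

Lemma dmetric_horZ z (k : R) a u v : S z -> T z (k *: a, 0) u v = k * T z (a, 0) u v.
Proof.
move=> Sz; rewrite -(dmetricZX HF _ _ _ _ Sz); congr (T z _ u v).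
by apply/pair_equal_spec; rewrite /= scaler0.
Qed.

Lemma dmetric_horD z a b u v : S z -> T z (a + b, 0) u v = T z (a, 0) u v + T z (b, 0) u v.
Proof.
move=> Sz; rewrite -(dmetricDX HF _ _ _ _ Sz); congr (T z _ u v).
by apply/pair_equal_spec; rewrite /= addr0.
Qed.

Lemma nab_inner z v V dV w : S z ->
  2 * B z (nab F z v V dV) w = 2 * B z dV w + T z (V, 0) w z.2 + T z (z.2, 0) V w
    - T z (w, 0) V z.2 + T z (0, w) V v.
Proof.
by move=> Sz; rewrite nab.unlock innerDl mulrDr (connection_inner_y HF _ _ _ Sz) !addrA.
Qed.

Lemma nab_innerE z v V dV w : S z ->
  B z (nab F z v V dV) w = 2^-1 * (2 * B z dV w + T z (V, 0) w z.2 + T z (z.2, 0) V w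
    - T z (w, 0) V z.2 + T z (0, w) V v).
Proof. by move=> Sz; have <- := nab_inner v V dV w Sz; rewrite mulKf// pnatr_eq0. Qed.

Lemma inner_inj2 z u v : S z -> (forall w, 2 * B z u w = 2 * B z v w) -> u = v.
Proof.
move=> Sz uv; apply: (inner_inj HF Sz) => w; apply: (@mulfI _ (2 : R)); last exact: uv.
by rewrite pnatr_eq0.
Qed.

Lemma nab_add z v V dV V' dV' : S z ->
  nab F z v (V + V') (dV + dV') = nab F z v V dV + nab F z v V' dV'.
Proof.
move=> Sz; apply: (inner_inj2 Sz) => w.
rewrite innerDl mulrDr !(nab_inner _ _ _ _ Sz) innerDl (dmetric_horD _ _ _ _ Sz).
by rewrite !(dmetricDl HF _ _ _ _ Sz); ring.
Qed.

Lemma nab_scale z v V dV (k dk : R) : S z ->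
  nab F z v (k *: V) (dk *: V + k *: dV) = dk *: V + k *: nab F z v V dV.
Proof.
move=> Sz; apply: (inner_inj HF Sz) => w; rewrite (innerDl F z (dk *: V)) !innerZl.
rewrite (nab_innerE v V dV w Sz) (nab_innerE v (k *: V) _ w Sz) innerDl !innerZl.
rewrite (dmetric_horZ k V _ _ Sz) (dmetricZl HF (z.2, 0) k V w Sz).
by rewrite (dmetricZl HF (w, 0) k V z.2 Sz) (dmetricZl HF (0, w) k V v Sz); field.
Qed.

Lemma nab_opp z v V dV : S z -> nab F z v (- V) (- dV) = - nab F z v V dV.
Proof.
move=> Sz; have := @nab_scale z v V dV (-1) 0 Sz.
by rewrite !scale0r !add0r !scaleN1r.
Qed.

(** In the two Koszul formulas the terms antisymmetric in [V] and [V'] cancel and the others add up: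
    the connection is metric along lifts. *)
Lemma nab_metric z v V dV V' dV' : S z ->
  B z (nab F z v V dV) V' + B z V (nab F z v V' dV') =
  T z (z.2, v) V V' + B z dV V' + B z V dV'.
Proof.
move=> Sz; apply: (@mulfI _ (2 : R)); first by rewrite pnatr_eq0.
rewrite mulrDr (innerC HF V (nab F z v V' dV') Sz) !(nab_inner _ _ _ _ Sz).
rewrite (dmetric_pair _ _ _ _ Sz) (innerC HF V dV' Sz) (dmetricC HF (z.2, 0) V' V Sz).
rewrite (dmetricC HF (0, V') V v Sz) (dmetric_vertC HF v V V' Sz).
rewrite (dmetricC HF (0, V) V' v Sz) (dmetric_vertC HF v V' V Sz).
by rewrite (dmetricC HF (0, v) V' V Sz); ring.
Qed.

(** A curve run at speed factor [l] has second derivative m y + l^2 v. The part along y is lost,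
    since the Cartan tensor vanishes there, and the Cartan tensor has degree -1 in y, which turns
    l^2 into l. *)
Lemma nab_reparam x y (l m : R) v V dV : S (x, y) -> 0 < l ->
  nab F (x, l *: y) (m *: y + l ^+ 2 *: v) V (l *: dV) = l *: nab F (x, y) v V dV.
Proof.
move=> Sz l0; have Sl := scale_slit Sz l0; have l1 : l != 0 by rewrite gt_eqF.
have hor a b c : T (x, l *: y) (a, 0) b c = T (x, y) (a, 0) b c.
  by rewrite -(dmetric_scale HF a 0 b c Sz l0) scaler0.
have ver a b c : T (x, l *: y) (0, a) b c = l^-1 * T (x, y) (0, a) b c.
  by rewrite -(dmetric_scale HF 0 a b c Sz l0) (dmetric_vertZ _ _ _ _ Sl) mulKf.
apply: (inner_inj2 Sl) => w; rewrite (nab_inner _ _ _ _ Sl) /= [in RHS]innerZl.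
rewrite !(inner_scale HF _ _ Sz l0) (mulrCA _ l) (nab_inner _ _ _ _ Sz) /=.
rewrite !hor ver (dmetric_horZ _ _ _ _ Sz) !innerZl !(dmetricZr HF _ _ _ _ Sz).
rewrite (dmetricDr HF _ _ _ _ Sz) !(dmetricZr HF _ _ _ _ Sz).
rewrite (dmetric_yr HF (z := (x, y)) V w Sz).
by field.
Qed.

End CovariantDerivative.

(** * Behaviour of the metric and of the connection under conformal maps *)

Section Naturality.
Context {R : realType} {n : nat}.
Local Notation E := 'rV[R]_n.
Implicit Types (z X : E * E) (u v w V : E).

Lemma is_derive_dir (P : normedModType R) (A : set E) (h : E -> E) (xi V : P -> E)
    (p q : P) (a dV : E) : open A -> smooth_on A h -> A (xi p) ->
  {for p, continuous xi} -> is_derive p q xi a -> is_derive p q V dV ->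
  is_derive p q (fun p => 'D_(V p) h (xi p)) ('D_a ('D_(V p) h) (xi p) + 'D_dV h (xi p)).
Proof.
move=> oA sh Ap cxi dxi dV'; have fE := fin_dim_rV (R := R) n.
have dh x : A x -> differentiable h x by exact: smooth_differentiable.
have ddh i x : A x -> differentiable ('D_(delta_mx 0 i : E) h) x.
  exact: (smooth_differentiable fE fE oA (smooth_derive (delta_mx 0 i) sh)).
have expand v x : A x -> 'D_v h x = \sum_i v 0 i *: 'D_(delta_mx 0 i) h x.
  by move=> Ax; rewrite [in LHS](row_sum_delta v) derive_dir_sumV//; exact: dh.
have nA : \forall p' \near p, A (xi p').
  by apply: cxi; exact: open_nbhs_nbhs.
have dE : is_derive p q (fun p => \sum_i V p 0 i *: 'D_(delta_mx 0 i) h (xi p))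
    (\sum_i (dV 0 i *: 'D_(delta_mx 0 i) h (xi p)
              + V p 0 i *: 'D_a ('D_(delta_mx 0 i) h) (xi p))).
  apply: is_derive_sumE => i.
  exact: is_derive_scale (is_derive_coord i dV') (is_derive_comp_diff dxi (ddh i _ Ap)).
have dF : is_derive (xi p) a (fun x => \sum_i V p 0 i *: 'D_(delta_mx 0 i) h x)
    (\sum_i V p 0 i *: 'D_a ('D_(delta_mx 0 i) h) (xi p)).
  apply: is_derive_sumE => i.
  have := is_derive_scale (is_derive_cst (V p 0 i) (xi p) a) (diff_is_derive a (ddh i _ Ap)).
  by rewrite scale0r add0r.
have E1 : 'D_a ('D_(V p) h) (xi p) = \sum_i V p 0 i *: 'D_a ('D_(delta_mx 0 i) h) (xi p).
  rewrite -(@derive_val _ _ _ _ _ _ _ dF); apply: near_eq_derive.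
  by apply: filterS (open_nbhs_nbhs (conj oA Ap)) => x Ax; exact: expand.
apply: (@near_eq_is_derive _ _ _ (fun p => \sum_i V p 0 i *: 'D_(delta_mx 0 i) h (xi p))).
  by apply: filterS nA => p' Ap'; rewrite expand.
apply: is_derive_eq dE _; rewrite E1 (expand dV _ Ap) addrC -big_split.
by apply: eq_bigr => i _.
Qed.

Lemma is_derive_line (P Q : normedModType R) (f : P -> Q) (p q : P) (d : Q) :
  is_derive p q f d <-> is_derive (0 : R) (1 : R) (fun t => f (t *: q + p)) d.
Proof.
pose L (t : R) := t *: q + p; have L0 : L 0 = p by rewrite /L scale0r add0r.
have LE (s : R) : L (s *: 1 + 0) = s *: q + L 0 by rewrite L0 /L addr0 [s%:A]mulr1.
have e := derive_affine f LE; split=> -[df <-].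
  apply: DeriveDef; last by rewrite e L0.
  by apply: (derivable_affine LE); rewrite L0.
by apply: DeriveDef; [exact/derivable1P|rewrite -{1}L0 -e].
Qed.

Context {U U' : set E} {F F' : E * E -> R}.
Hypotheses (HF : local_finsler U F) (HF' : local_finsler U' F').
Context {h : E -> E} {phi : E -> R}.
Hypotheses (sh : smooth_on U h) (sphi : smooth_on U phi).
Hypothesis hU : forall x, U x -> U' (h x).
Hypothesis hF : forall z, U z.1 -> F' (tangent_map h z) = expR (phi z.1) * F z.

Local Notation S := (slit_over U).
Local Notation B := (finsler_inner F).
Local Notation T := (dmetric F).
Local Notation S' := (slit_over U').
Local Notation B' := (finsler_inner F').
Local Notation T' := (dmetric F').
Local Notation Phi := (tangent_map h).

Let oU : open U := local_open HF.
Let oS : open S := open_slit_over oU.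
Let fE := fin_dim_rV (R := R) n.

Lemma diff_h x : U x -> differentiable h x.
Proof. exact: (smooth_differentiable fE fE oU sh). Qed.

(** The conformal factor is positive and [F'] vanishes on zero vectors, so ['D_v h x = 0] would give
    F(x, v) = 0, against positive definiteness. *)
Lemma tangent_neq0 x v : U x -> v != 0 -> 'D_v h x != 0.
Proof.
move=> Ux v0; apply/negP => /eqP Dv0; have Sz : S (x, v) by [].
have := hF (z := (x, v)) Ux; rewrite /tangent_map /= Dv0.
(* A zero vector equals its double, so homogeneity gives F'(h x, 0) = 2 F'(h x, 0). *)
have F'0 : F' (h x, 0) = 0.
  have := local_homogeneous HF' 0 (hU Ux) (ltr0n R 2); rewrite scaler0.
  by move/eqP; rewrite -subr_eq0 mulr_natl mulr2n opprD addNKr oppr_eq0 => /eqP.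
rewrite F'0 => /esym/eqP; rewrite mulf_eq0 gt_eqF ?expR_gt0//= => /eqP F0.
have := local_posdef HF Sz v0; have /= -> := inner_yy HF Sz.
by rewrite /F2 F0 expr0n ltxx.
Qed.

Lemma tangent_slit z : S z -> S' (Phi z).
Proof. by case: z => x y [Ux y0]; split; [exact: hU|exact: tangent_neq0]. Qed.

Lemma tangent_onto x w : U x -> exists v, 'D_v h x = w.
Proof.
move=> Ux; pose M : 'M[R]_n := \matrix_i 'D_(delta_mx 0 i : E) h x.
have DM v : 'D_v h x = v *m M.
  rewrite [in LHS](row_sum_delta v) derive_dir_sumV; last exact: diff_h.
  by rewrite mulmx_sum_row; apply: eq_bigr => i _; rewrite rowK.
have uM : M \in unitmx.
  rewrite unitmxE unitfE; apply/negP => /det0P[v v0 vM].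
  by have := tangent_neq0 Ux v0; rewrite DM vM eqxx.
by exists (w *m invmx M); rewrite DM mulmxKV.
Qed.

Let kappa x := expR (phi x) ^+ 2.

Let is_derive_kappa x v : U x -> is_derive x v kappa (2 * 'D_v phi x * kappa x).
Proof.
move=> Ux; have dp := diff_is_derive v (diff_phi HF sphi Ux).
have de : differentiable (@expR R) (phi x) by exact/derivable1_diffP/derivable_expR.
have d1 := is_derive_comp_diff dp de.
have dE : 'D_('D_v phi x) expR (phi x) = 'D_v phi x * expR (phi x).
  rewrite -[X in 'D_X _ _](mulr1) (_ : _ * 1 = 'D_v phi x *: 1)// diff_dirZ//.
  by rewrite (@derive_val _ _ _ _ _ _ _ (is_derive_expR (phi x))).
rewrite dE in d1; have := is_derive_mul d1 d1.
rewrite (_ : (fun y => _) = kappa); last by apply/funext => y; rewrite /kappa expr2.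
by move=> d; apply: is_derive_eq d _; rewrite /kappa; ring.
Qed.

Lemma diff_kappa x : U x -> differentiable kappa x.
Proof.
move=> Ux; have de : differentiable (@expR R) (phi x).
  exact/derivable1_diffP/derivable_expR.
have d := differentiable_comp (diff_phi HF sphi Ux) de.
have -> : kappa = (@expR R \o phi) * (@expR R \o phi).
  by apply/funext => y; rewrite /kappa expr2.
exact: differentiableM.
Qed.

Lemma vert_kappa z w : U z.1 -> is_derive z (0, w) (fun z => kappa z.1) (0 : R).
Proof.
move=> Uz; have := is_derive_comp_diff (is_derive_fst (is_derive_id z (0, w))) (diff_kappa Uz).
by rewrite derive0.
Qed.

(** The square of [hF] is differentiated twice vertically. No further terms appear, because
    [tangent_map h] is linear on each fibre and [kappa] does not depend on y. *)
Lemma inner_nat z u v : S z -> B' (Phi z) ('D_u h z.1) ('D_v h z.1) = kappa z.1 * B z u v.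
Proof.
move=> Sz; have Ux : U z.1 by case: Sz.
have PhiL z' w : U z'.1 -> forall t : R, Phi (t *: (0, w) + z') = t *: (0, 'D_w h z'.1) + Phi z'.
  move=> Uz' t; apply/pair_equal_spec; rewrite /= scaler0 !add0r; split=> //.
  by rewrite diff_dirD ?diff_dirZ//; exact: diff_h.
have F2nat z' : U z'.1 -> F2 F' (Phi z') = kappa z'.1 * F2 F z'.
  by move=> Uz'; rewrite /F2 hF// exprMn.
have step1 z' w : S z' -> 'D_(0, 'D_w h z'.1) (F2 F') (Phi z') = kappa z'.1 * 'D_(0, w) (F2 F) z'.
  move=> Sz'; have Uz' : U z'.1 by case: Sz'.
  have d1 : is_derive z' (0, w) (fun z => F2 F' (Phi z)) ('D_(0, 'D_w h z'.1) (F2 F') (Phi z')).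
    apply/is_derive_line.
    have := (is_derive_line (F2 F') (Phi z') (0, 'D_w h z'.1) _).1
      (diff_is_derive _ (diff_F2 HF' (tangent_slit Sz'))).
    rewrite (_ : (fun t => _) = (fun t => F2 F' (Phi (t *: (0, w) + z'))))//.
    by apply/funext => t; rewrite PhiL.
  have d2 : is_derive z' (0, w) (fun z => F2 F' (Phi z)) (kappa z'.1 * 'D_(0, w) (F2 F) z').
    apply: (@near_eq_is_derive _ _ _ (fun z => kappa z.1 * F2 F z)).
      apply: filterS (open_nbhs_nbhs (conj oS Sz')) => z2 [Uz2 _].
      by rewrite F2nat.
    have := is_derive_mul (vert_kappa w Uz') (diff_is_derive (0, w) (diff_F2 HF Sz')).
    by rewrite mul0r add0r.
  by rewrite -(@derive_val _ _ _ _ _ _ _ d1) (@derive_val _ _ _ _ _ _ _ d2).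
have Sz' := tangent_slit Sz.
rewrite (inner_hess HF' _ _ Sz') (inner_hess HF _ _ Sz) [RHS]mulrCA; congr (_ * _).
set G := 'D_(0, 'D_u h z.1) (F2 F').
have dG : differentiable G (Phi z) by exact: (diff_dF2 HF' (0, 'D_u h z.1) Sz').
have d1 : is_derive (0 : R) (1 : R) (fun t => G (Phi (t *: (0, v) + z)))
    ('D_(0, 'D_v h z.1) G (Phi z)).
  have := (is_derive_line G (Phi z) (0, 'D_v h z.1) _).1 (diff_is_derive _ dG).
  rewrite (_ : (fun t => _) = (fun t => G (Phi (t *: (0, v) + z))))//.
  by apply/funext => t; rewrite PhiL.
have d2 : is_derive (0 : R) (1 : R) (fun t => G (Phi (t *: (0, v) + z)))
    (kappa z.1 * 'D_(0, v) ('D_(0, u) (F2 F)) z).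
  have dL : {for (0 : R), continuous (fun t : R => t *: (0, v) + z)}.
    by apply: cvgD; [exact: scalel_continuous|exact: cvg_cst].
  have nS : \forall t \near (0 : R), S (t *: (0, v) + z).
    by apply: dL; rewrite scale0r add0r; exact: open_nbhs_nbhs.
  apply: (@near_eq_is_derive _ _ _ (fun t : R => kappa z.1 * 'D_(0, u) (F2 F) (t *: (0, v) + z))).
    apply: filterS nS => t St; have := step1 _ u St.
    have -> : (t *: (0, v) + z).1 = z.1 by rewrite /= scaler0 add0r.
    by move=> E1; rewrite /G E1.
  have dd := (is_derive_line _ _ _ _).1 (diff_is_derive (0, v) (diff_dF2 HF (0, u) Sz)).
  have := is_derive_mul (is_derive_cst (kappa z.1) (0 : R) (1 : R)) dd.
  by rewrite mul0r add0r.
by rewrite -(@derive_val _ _ _ _ _ _ _ d1) (@derive_val _ _ _ _ _ _ _ d2).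
Qed.

Lemma is_derive_tangent z X : S z -> is_derive z X Phi
  ('D_(X.1) h z.1, 'D_(X.1) ('D_(z.2) h) z.1 + 'D_(X.2) h z.1).
Proof.
move=> [Uz _]; apply: is_derive_pair.
  exact: is_derive_comp_diff (is_derive_fst (is_derive_id z X)) (diff_h Uz).
apply: (is_derive_dir oU sh Uz _ (is_derive_fst (is_derive_id z X)) (is_derive_snd
  (is_derive_id z X))).
exact: cvg_fst.
Qed.

Lemma is_derive_push z (X : E * E) u : S z ->
  is_derive z X (fun z => 'D_u h z.1) ('D_(X.1) ('D_u h) z.1).
Proof.
move=> [Uz _]; apply: is_derive_comp_diff (is_derive_fst (is_derive_id z X)) _.
exact: (smooth_differentiable fE fE oU (smooth_derive u sh)).
Qed.

(** [inner_nat] differentiated in the direction [(a, b)]; the inner products on the left come from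
    the dependence of ['D_u h] and ['D_v h] on x. *)
Lemma dmetric_nat z a b u v : S z ->
  T' (Phi z) ('D_a h z.1, 'D_a ('D_(z.2) h) z.1 + 'D_b h z.1) ('D_u h z.1) ('D_v h z.1)
  + B' (Phi z) ('D_a ('D_u h) z.1) ('D_v h z.1) + B' (Phi z) ('D_u h z.1) ('D_a ('D_v h) z.1)
  = kappa z.1 * (2 * 'D_a phi z.1 * B z u v + T z (a, b) u v).
Proof.
move=> Sz; have Uz : U z.1 by case: Sz.
have d1 := is_derive_inner HF' (is_derive_tangent (a, b) Sz) (is_derive_push (a, b) u Sz)
  (is_derive_push (a, b) v Sz) (tangent_slit Sz).
have dk := is_derive_comp_diff (is_derive_fst (is_derive_id z (a, b))) (diff_kappa Uz).
have d2 := is_derive_mul dk (diff_is_derive (a, b) (diff_inner HF u v Sz)).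
have : 'D_(a, b) (fun z => B' (Phi z) ('D_u h z.1) ('D_v h z.1)) z =
    'D_(a, b) (fun z => kappa z.1 * B z u v) z.
  apply: near_eq_derive; apply: filterS (open_nbhs_nbhs (conj oS Sz)) => z2 Sz2.
  exact: inner_nat.
rewrite (@derive_val _ _ _ _ _ _ _ d1) (@derive_val _ _ _ _ _ _ _ d2) => ->.
rewrite (@derive_val _ _ _ _ _ _ _ (is_derive_kappa a Uz)) dmetric.unlock /=.
by move: ('D_ _ _ _) ('D_ _ _ _) => ? ?; ring.
Qed.

Lemma hess_swap x a b : U x -> 'D_a ('D_b h) x = 'D_b ('D_a h) x.
Proof. by move=> Ux; exact: (derive_swap a b fE oU (sh 2%N) Ux). Qed.

(** The computation behind [nab_nat], with the derivatives of [h] and [phi] at the point replaced by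
    functions that satisfy the relations used. Second derivatives of [h] cancel by their symmetry,
    and the derivatives of the conformal factor produce the three correction terms. *)
Let nab_nat_algebra z v V dV w k (dh : E -> E) (ddh : E -> E -> E) (dp : E -> R) :
  S z -> S' (h z.1, dh z.2) -> let B1 := B' (h z.1, dh z.2) in let T1 := T' (h z.1, dh z.2) in
  (forall a u u', T1 (dh a, ddh a z.2) (dh u) (dh u') + B1 (ddh a u) (dh u')
     + B1 (dh u) (ddh a u') = k * (2 * dp a * B z u u' + T z (a, 0) u u')) ->
  (forall a u u', T1 (0, dh a) (dh u) (dh u') = k * T z (0, a) u u') ->
  (forall u u', B1 (dh u) (dh u') = k * B z u u') ->
  (forall a b, ddh a b = ddh b a) ->
  (forall u, B z (gradient F phi z) u = dp u) ->
  2 * B1 (nab F' (h z.1, dh z.2) (ddh z.2 z.2 + dh v) (dh V) (ddh z.2 V + dh dV)) (dh w) =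
  2 * B1 (dh (nab F z v V dV + dp V *: z.2 + dp z.2 *: V - B z V z.2 *: gradient F phi z)) (dh w).
Proof.
move=> Sz Sz' B1 T1 hor0 ver inn sym grad.
have hor a u u' : T1 (dh a, 0) (dh u) (dh u') =
    k * (2 * dp a * B z u u' + T z (a, 0) u u') - T1 (0, ddh a z.2) (dh u) (dh u')
    - B1 (ddh a u) (dh u') - B1 (dh u) (ddh a u').
  rewrite -hor0 /T1 (dmetric_pair HF' (dh a) (ddh a z.2) _ _ Sz').
  by ring.
have yl a u : T1 (0, a) u (dh z.2) = 0 by exact: (dmetric_yr HF' u a Sz').
rewrite {1}/B1 (nab_inner HF' _ _ _ _ Sz') /= -/B1 -/T1 !hor !yl.
have T1D X u a b : T1 X u (a + b) = T1 X u a + T1 X u b by exact: (dmetricDr HF' X u a b Sz').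
have B1D a b u : B1 (a + b) u = B1 a u + B1 b u by exact: innerDl.
rewrite T1D ver B1D.
have -> : T1 (0, dh w) (dh V) (ddh z.2 z.2) = T1 (0, ddh z.2 z.2) (dh V) (dh w).
  rewrite /T1 (dmetricC HF' _ _ _ Sz') (dmetric_vertC HF' _ _ _ Sz').
  by rewrite (dmetricC HF' _ _ _ Sz').
rewrite (sym V w) (sym V z.2) (sym w z.2).
have -> : B1 (dh w) (ddh z.2 V) = B1 (ddh z.2 V) (dh w) by exact: (innerC HF' _ _ Sz').
have -> : B1 (dh V) (ddh z.2 w) = B1 (ddh z.2 w) (dh V) by exact: (innerC HF' _ _ Sz').
have N : B z (nab F z v V dV) w = 2^-1 * (2 * B z dV w + T z (V, 0) w z.2
    + T z (z.2, 0) V w - T z (w, 0) V z.2 + T z (0, w) V v).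
  exact: (nab_innerE HF v V dV w Sz).
rewrite !inn !innerDl innerNl !innerZl grad N (innerC HF w z.2 Sz).
by field.
Qed.

(** The arguments of [nab F'] are those of the image curve: its second derivative, the pushed
    vector, and the derivative of the pushed field. The correction is the Riemannian one for the
    metric factor e^(2 phi). *)
Lemma nab_nat z v V dV : S z ->
  nab F' (Phi z) ('D_(z.2) ('D_(z.2) h) z.1 + 'D_v h z.1) ('D_V h z.1)
    ('D_(z.2) ('D_V h) z.1 + 'D_dV h z.1) =
  'D_(nab F z v V dV + 'D_V phi z.1 *: z.2 + 'D_(z.2) phi z.1 *: V
      - B z V z.2 *: gradient F phi z) h z.1.
Proof.
move=> Sz; have Uz : U z.1 by case: Sz.
have Sz' := tangent_slit Sz.
apply: (inner_inj2 HF' Sz') => w'; have [w <-] := tangent_onto w' Uz.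
apply: (@nab_nat_algebra z v V dV w (kappa z.1) (fun v => 'D_v h z.1)
  (fun a b => 'D_a ('D_b h) z.1) (fun v => 'D_v phi z.1) Sz Sz').
- move=> a u u'; rewrite -(dmetric_nat a 0 u u' Sz) derive0 addr0; reflexivity.
- move=> a u u'; have := dmetric_nat 0 a u u' Sz.
  by rewrite !derive0 (inner0l F' (Phi z)) (inner0r F' (Phi z)) !addr0 mulr0 mul0r !add0r.
- by move=> u u'; have := inner_nat u u' Sz.
- move=> a b; exact: (hess_swap a b Uz).
- move=> u; exact: (inner_gradient HF sphi u Sz).
Qed.

End Naturality.

Section SmoothNab.
Context {R : realType} {n : nat}.
Local Notation E := 'rV[R]_n.
Context {U : set E} {F : E * E -> R} (HF : local_finsler U F).

(** By [connection_inner_y] the connection term is a raised covector built from first derivatives of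
    the metric. *)
Lemma smooth_nab k (P : normedModType R) (A : set P) (zeta : P -> E * E) (v V dV : P -> E) :
  open A -> (forall p, A p -> slit_over U (zeta p)) ->
  Ck k A zeta -> Ck k A v -> Ck k A V -> Ck k A dV ->
  Ck k A (fun p => nab F (zeta p) (v p) (V p) (dV p)).
Proof.
move=> oA AS Cz Cv CV CdV.
pose T := dmetric F; pose e l : E := delta_mx 0 l; pose y p := (zeta p).2.
pose c l p : R := T (zeta p) (V p, 0) (e l) (y p) + T (zeta p) (y p, 0) (V p) (e l)
  + (-1) * T (zeta p) (e l, 0) (V p) (y p) + T (zeta p) (0, e l) (V p) (v p).
apply: (@Ck_eq _ _ _ _ _ (fun p =>
    dV p + 2^-1 *: \row_i \sum_l metric_inv F (zeta p) i l * c l p)) => //.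
  move=> p Ap; have Sp := AS p Ap; rewrite nab.unlock; congr (_ + _).
  apply: (inner_inj2 HF Sp) => w; rewrite innerZl mulrA divff ?pnatr_eq0// mul1r.
  rewrite (connection_inner_y HF _ _ _ Sp).
  have -> : \row_i \sum_l metric_inv F (zeta p) i l * c l p =
      \row_i \sum_l metric_inv F (zeta p) i l * (\row_l c l p) 0 l.
    by apply/rowP => i; rewrite !mxE; apply: eq_bigr => l _; rewrite mxE.
  rewrite (inner_sharp HF _ _ Sp).
  have lin (f : E -> R) : (forall u u', f (u + u') = f u + f u') ->
      (forall (k : R) u, f (k *: u) = k * f u) -> f w = \sum_l f (e l) * w 0 l.
    move=> fD fZ; have f0 : f 0 = 0 by rewrite -(scale0r 0) fZ mul0r.
    rewrite [in LHS](row_sum_delta w) (big_morph f fD f0).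
    by apply: eq_bigr => l _; rewrite fZ mulrC.
  rewrite (lin (fun u => T (zeta p) (V p, 0) u (y p) + T (zeta p) (y p, 0) (V p) u
    - T (zeta p) (u, 0) (V p) (y p) + T (zeta p) (0, u) (V p) (v p))).
  - by apply: eq_bigr => l _; rewrite mxE /c mulN1r.
  - move=> u u'; rewrite /T (dmetricDl HF _ _ _ _ Sp) (dmetricDr HF _ _ _ _ Sp).
    by rewrite (dmetric_horD HF _ _ _ _ Sp) (dmetric_vertD HF _ _ _ _ Sp); ring.
  - move=> k' u; rewrite /T (dmetricZl HF _ _ _ _ Sp) (dmetricZr HF _ _ _ _ Sp).
    by rewrite (dmetric_horZ HF _ _ _ _ Sp) (dmetric_vertZ HF _ _ _ _ Sp); ring.
have Cc (w : E) : Ck k A (fun=> w) by exact: Ck_cst.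
have Cy : Ck k A y by exact: Ck_snd.
have C0 (f : P -> E) : Ck k A f -> Ck k A (fun p => (f p, 0 : E)).
  by move=> Cf; apply: Ck_pair.
have C1 (w : E) : Ck k A (fun p => (0 : E, w)) by exact: Ck_cst.
apply: Ck_add => //; apply: Ck_scale => //; first exact: Ck_cst.
apply: (smooth_sharp HF) => // l; rewrite /c /T.
apply: Ck_add => //; last exact: (smooth_dmetric HF oA AS).
apply: Ck_add => //; last first.
  apply: Ck_mul => //; first exact: Ck_cst.
  by apply: (smooth_dmetric HF oA AS) => //; exact: C0.
by apply: Ck_add => //; apply: (smooth_dmetric HF oA AS) => //; exact: C0.
Qed.

End SmoothNab.

(** * Curves on a Finsler manifold *)

(* The covariant derivative along c of a field given only in the chart a. *)
HB.lock Definition cov (R : realType) (n : nat) (M : smooth_manifold R n) (F : finsler M)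
  (c : R -> M) (a : chart M) (Z : R -> 'rV[R]_n) (t : R) : 'rV[R]_n :=
  nabla_along F c (fun=> Z) a t.

HB.lock Definition acceleration (R : realType) (n : nat) (M : smooth_manifold R n)
  (F : finsler M) (c : R -> M) (a : chart M) (t : R) : 'rV[R]_n :=
  cov F c a (velocity c a) t.

Section ManifoldCurves.
Context {R : realType} {n : nat} {M : smooth_manifold R n}.
Local Notation E := 'rV[R]_n.
Implicit Types (f : M -> M) (a b : chart M) (c e : R -> M) (I J : set R).

Lemma chart_mapP a p : chart_dom a p ->
  chart_cod a (chart_map a p) /\ chart_inv a (chart_map a p) = p.
Proof. by move=> ap; split; [exists p|apply: chart_mapK; rewrite inE]. Qed.

Lemma chart_invP a x : chart_cod a x ->
  chart_dom a (chart_inv a x) /\ chart_map a (chart_inv a x) = x.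
Proof. by move=> [p ap <-]; rewrite (chart_mapP ap).2. Qed.

Lemma open_chart_cod a : open (chart_cod a).
Proof. exact: chart_cod_open. Qed.

Definition overlap f a b : set E :=
  [set x | chart_cod a x /\ chart_dom b (f (chart_inv a x))].

Lemma open_overlap f a b : continuous f -> open (overlap f a b).
Proof.
move=> cf; rewrite openE => x [ax bx]; apply: filterI.
  exact: (open_nbhs_nbhs (conj (@open_chart_cod a) ax)).
have cx : {for x, continuous (f \o chart_inv a)}.
  apply: continuous_comp; last exact: cf.
  by apply: (chart_inv_continuous (s := M)); rewrite inE.
by apply: cx; exact: (open_nbhs_nbhs (conj (chart_dom_open b) bx)).
Qed.

Context (F : finsler M).

Lemma local_finsler_sub (U : set E) a : open U -> U `<=` chart_cod a -> local_finsler U (F a).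
Proof.
move=> oU Ua; have Sa z : slit_over U z -> slit a z by move=> [/Ua].
split=> //.
- by move=> k; exact: (Ck_sub Sa (finsler_smooth F a k)).
- by move=> x y l /Ua; exact: finsler_homogeneous.
- by move=> z /Sa; exact: finsler_posdef.
Qed.

Lemma local_finsler_chart a : local_finsler (chart_cod a) (F a).
Proof. exact: (local_finsler_sub (@open_chart_cod a) (fun _ h => h)). Qed.

Definition conformal_to_self f (phi : M -> R) := smooth_map f /\ conformal_factor F F f phi.

(** The identity read in two charts is a change of charts, so each result on conformal maps also
    yields the independence of charts. *)
Lemma conformal_to_self_id : conformal_to_self id (fun=> 0).
Proof.
split; last first.
  split=> [a k|a b z az bz]; first exact: Ck_cst.
  by rewrite expR0 mul1r; exact: finsler_transition.
split=> [p|a b k]; first exact: cvg_id.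
have := @transition_smooth _ _ M a b k; congr Ck.
apply/seteqP; split=> [_ [p [ap bp] <-]|x [ax bx]] /=.
  by have [h1 h2] := chart_mapP ap; rewrite h2.
by have [h1 h2] := chart_invP ax; exists (chart_inv a x).
Qed.

Section Smooth.
Context {I : set R} {c : R -> M} (oI : open I) (sc : smooth_curve I c).

Definition curve_dom a : set R := I `&` c @^-1` chart_dom a.

Lemma open_curve_dom a : open (curve_dom a).
Proof.
rewrite openE => t [It at_]; apply: filterI; first exact: open_nbhs_nbhs.
have ct : {for t, continuous c} by apply: sc.1; rewrite inE.
by apply: ct; exact: (open_nbhs_nbhs (conj (chart_dom_open a) at_)).
Qed.

Lemma smooth_coord a : smooth_on (curve_dom a) (chart_map a \o c).
Proof. exact: sc.2. Qed.

Lemma smooth_derive1 (V : normedModType R) (A : set R) (g : R -> V) :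
  smooth_on A g -> smooth_on A (derive1 g).
Proof.
move=> sg k; rewrite (_ : derive1 g = 'D_1 g); last by apply/funext => t; rewrite derive1E.
exact: (smooth_derive (1 : R) sg k).
Qed.

Lemma smooth_velocity a : smooth_on (curve_dom a) (velocity c a).
Proof. exact: (smooth_derive1 (smooth_coord a)). Qed.

Lemma smooth_is_derive (V : normedModType R) (A : set R) (g : R -> V) t :
  smooth_on A g -> A t -> is_derive t (1 : R) g (derive1 g t).
Proof.
move=> sg At; apply: DeriveDef; last by rewrite derive1E.
exact: (Ck_derivable _ (sg 1%N) At).
Qed.

Lemma is_derive1 (V : normedModType R) (g : R -> V) (t : R) d :
  is_derive t (1 : R) g d -> derive1 g t = d.
Proof. by move=> dg; rewrite derive1E (@derive_val _ _ _ _ _ _ _ dg). Qed.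

Lemma is_derive_coord_curve a t : curve_dom a t ->
  is_derive t (1 : R) (chart_map a \o c) (velocity c a t).
Proof. exact: (smooth_is_derive (smooth_coord a)). Qed.

Lemma is_derive_velocity a t : curve_dom a t ->
  is_derive t (1 : R) (velocity c a) (derive1 (velocity c a) t).
Proof. exact: (smooth_is_derive (smooth_velocity a)). Qed.

Lemma is_derive_lift a t : curve_dom a t ->
  is_derive t (1 : R) (velocity_lift c a) (velocity c a t, derive1 (velocity c a) t).
Proof. by move=> At; apply: is_derive_pair; [exact: is_derive_coord_curve|exact:
  is_derive_velocity]. Qed.

Lemma covE Z a t : curve_dom a t ->
  cov F c a Z t =
  nab (F a) (velocity_lift c a t) (derive1 (velocity c a) t) (Z t) (derive1 Z t).
Proof.
by move=> At; rewrite cov.unlock /nabla_along (is_derive1 (is_derive_lift At)) nab.unlock.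
Qed.

Lemma nabla_along_cov Y a t : nabla_along F c Y a t = cov F c a (Y a) t.
Proof. by rewrite cov.unlock. Qed.

Lemma acceleration_cov a t : cov F c a (velocity c a) t = acceleration F c a t.
Proof. by rewrite acceleration.unlock. Qed.

Local Notation acceleration := (acceleration F c).

Lemma lift_slit a t : curve_dom a t -> velocity c a t != 0 ->
  slit_over (chart_cod a) (velocity_lift c a t).
Proof. by move=> [_ at_] v0; split => //; exact: (chart_mapP at_).1. Qed.

Lemma smooth_acceleration a : (forall t, curve_dom a t -> velocity c a t != 0) ->
  smooth_on (curve_dom a) (acceleration a).
Proof.
move=> v0 k; have oD : open (curve_dom a) by exact: open_curve_dom.
apply: (@Ck_eq _ _ _ _ _ (fun t => nab (F a) (velocity_lift c a t)
  (derive1 (velocity c a) t) (velocity c a t) (derive1 (velocity c a) t))) => //.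
  by move=> t At; rewrite acceleration.unlock (covE _ At).
apply: (smooth_nab (local_finsler_chart a) oD).
- by move=> t At; apply: lift_slit => //; exact: v0.
- by apply: Ck_pair => //; [exact: smooth_coord|exact: smooth_velocity].
- exact: (smooth_derive1 (smooth_velocity a) k).
- exact: smooth_velocity.
- exact: (smooth_derive1 (smooth_velocity a) k).
Qed.

End Smooth.

Lemma unit_velocity_neq0 a x v : chart_cod a x -> F a (x, v) = 1 -> v != 0.
Proof.
move=> ax F1; apply/negP => /eqP v0; rewrite v0 in F1.
have := finsler_homogeneous F 0 ax (ltr0n R 2); rewrite scaler0 F1.
by move=> /eqP; rewrite mulr1 eq_sym -subr_eq0 [2]mulr2n addrK oner_eq0.
Qed.

Section Push.
Context {I : set R} {e : R -> M} (oI : open I) (se : smooth_curve I e).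
Context {f : M -> M} {phi : M -> R} (cf : conformal_to_self f phi).
Context {a b : chart M} {t : R} (It : I t) (at_ : chart_dom a (e t)) (bt : chart_dom b (f (e t))).
Hypothesis sd : smooth_curve I (f \o e).

Let h := local_rep f a b.
Let U := overlap f a b.
Let x s := chart_map a (e s).
Let pa := phi \o chart_inv a.

Let oU : open U := open_overlap cf.1.1.
Let Ua : U `<=` chart_cod a. Proof. by move=> ? []. Qed.
Let HU : local_finsler U (F a) := local_finsler_sub oU Ua.
Let Hb := local_finsler_chart b.
Let sh : smooth_on U h := cf.1.2 a b.
Let spa : smooth_on U pa. Proof. by move=> k; exact: (Ck_sub Ua (cf.2.1 a k)). Qed.
Let hU y : U y -> chart_cod b (h y).
Proof. by move=> [_ by_]; exact: (chart_mapP by_).1. Qed.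
Let hF z : U z.1 -> F b (tangent_map h z) = expR (pa z.1) * F a z.
Proof. by move=> [az bz]; exact: cf.2.2. Qed.

Let K : set R := curve_dom (I := I) (c := e) a `&` curve_dom (I := I) (c := f \o e) b.
Let oK : open K.
Proof. by apply: openI; exact: open_curve_dom. Qed.
Let Kt : K t. Proof. by []. Qed.

Let xU s : K s -> U (x s).
Proof.
by move=> [[_ as_] [_ bs]]; have [h1 h2] := chart_mapP as_; split; rewrite //= h2.
Qed.

Let xE s : K s -> chart_map b (f (e s)) = h (x s).
Proof. by move=> [[_ as_] _]; rewrite /h /local_rep /= (chart_mapP as_).2. Qed.

Lemma velocity_push_near s : K s -> velocity (f \o e) b s = 'D_(velocity e a s) h (x s).
Proof.
move=> Ks; apply: is_derive1; apply: (@near_eq_is_derive _ _ _ (h \o x)).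
  by apply: filterS (open_nbhs_nbhs (conj oK Ks)) => s' Ks'; rewrite /= xE.
apply: is_derive_comp_diff; first exact: (is_derive_coord_curve se Ks.1).
exact: (diff_h HU sh (xU Ks)).
Qed.

Lemma velocity_push : velocity (f \o e) b t = 'D_(velocity e a t) h (x t).
Proof. exact: velocity_push_near. Qed.

Let is_derive_field (Z : R -> E) dZ : is_derive t (1 : R) Z dZ ->
  is_derive t (1 : R) (fun s => 'D_(Z s) h (x s))
    ('D_(velocity e a t) ('D_(Z t) h) (x t) + 'D_dZ h (x t)).
Proof.
move=> dZt; have dx := is_derive_coord_curve se Kt.1.
apply: (is_derive_dir oU sh (xU Kt) _ dx dZt).
by case: dx => dx _; exact/differentiable_continuous/derivable1_diffP.
Qed.

(** [nab_nat] along a curve. [Z'] is the pushed field on all of [K], not only at [t], since its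
    derivative at [t] enters. *)
Lemma nabla_push (Z Z' : R -> E) dZ : velocity e a t != 0 ->
  is_derive t (1 : R) Z dZ -> (forall s, K s -> Z' s = 'D_(Z s) h (x s)) ->
  cov F (f \o e) b Z' t =
  'D_(cov F e a Z t + 'D_(Z t) pa (x t) *: velocity e a t
      + 'D_(velocity e a t) pa (x t) *: Z t
      - finsler_inner (F a) (velocity_lift e a t) (Z t) (velocity e a t)
        *: gradient (F a) pa (velocity_lift e a t)) h (x t).
Proof.
move=> v0 dZt Z'E; have nK := open_nbhs_nbhs (conj oK Kt).
rewrite (covE sd _ Kt.2) (covE se _ Kt.1).
have -> : velocity_lift (f \o e) b t = tangent_map h (velocity_lift e a t).
  by rewrite /velocity_lift /tangent_map /= velocity_push -xE.
have -> : derive1 (velocity (f \o e) b) t =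
    'D_(velocity e a t) ('D_(velocity e a t) h) (x t) + 'D_(derive1 (velocity e a) t) h (x t).
  apply: is_derive1; apply: (@near_eq_is_derive _ _ _ (fun s => 'D_(velocity e a s) h (x s))).
    by apply: filterS nK => s Ks; rewrite velocity_push_near.
  exact/is_derive_field/(is_derive_velocity se Kt.1).
have -> : derive1 Z' t = 'D_(velocity e a t) ('D_(Z t) h) (x t) + 'D_dZ h (x t).
  apply: is_derive1; apply: (@near_eq_is_derive _ _ _ (fun s => 'D_(Z s) h (x s))).
    by apply: filterS nK => s Ks; rewrite Z'E.
  exact: is_derive_field.
rewrite (Z'E t Kt) (is_derive1 dZt).
have Sz : slit_over U (velocity_lift e a t) by split; [exact: xU|].
exact: (nab_nat HU Hb sh spa hU hF (derive1 (velocity e a) t) (Z t) dZ Sz).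
Qed.

End Push.

End ManifoldCurves.

(** * Unit speed curves and geodesic circles *)

Section GeodesicCircles.
Context {R : realType} {n : nat} {M : smooth_manifold R n} (F : finsler M).
Local Notation E := 'rV[R]_n.

Definition unit_speed (I : set R) (c : R -> M) := forall a t, I t -> chart_dom a (c t) ->
  F a (velocity_lift c a t) = 1.

Lemma nab0 (a : chart M) z v : slit_over (chart_cod a) z -> nab (F a) z v 0 0 = 0.
Proof.
move=> Sz; have := nab_scale (local_finsler_chart F a) v 0 0 0 0 Sz.
by rewrite !scale0r addr0.
Qed.

Section UnitSpeed.
Context {I : set R} {c : R -> M} (oiI : open_interval I) (sc : smooth_curve I c).
Hypothesis uc : unit_speed I c.
Local Notation dom := (@curve_dom R n M I c).
Local Notation A := (acceleration F c).
Local Notation B a t := (finsler_inner (F a) (velocity_lift c a t)).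

Let oI : open I. Proof. by case: oiI. Qed.

Lemma unit_lift_slit a t : dom a t -> slit_over (chart_cod a) (velocity_lift c a t).
Proof.
move=> at_; apply: (lift_slit at_); case: at_ => It at_.
by apply: (unit_velocity_neq0 (chart_mapP at_).1); exact: uc.
Qed.

Lemma unit_neq0 a t : dom a t -> velocity c a t != 0.
Proof. by case/unit_lift_slit. Qed.

Lemma smooth_acc a : smooth_on (dom a) (A a).
Proof. by apply: smooth_acceleration => // t; exact: unit_neq0. Qed.

Lemma is_derive_acc a t : dom a t -> is_derive t (1 : R) (A a) (derive1 (A a) t).
Proof. exact: (smooth_is_derive (smooth_acc a)). Qed.

Lemma is_derive_inner_along a t (V V' : R -> E) dV dV' : dom a t ->
  is_derive t (1 : R) V dV -> is_derive t (1 : R) V' dV' ->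
  is_derive t (1 : R) (fun s => B a s (V s) (V' s))
    (B a t (cov F c a V t) (V' t) + B a t (V t) (cov F c a V' t)).
Proof.
move=> at_ dVt dVt'; have Sz := unit_lift_slit at_.
rewrite !(covE F sc _ at_) (is_derive1 dVt) (is_derive1 dVt').
rewrite (nab_metric (local_finsler_chart F a) _ _ _ _ _ Sz).
exact: (is_derive_inner (local_finsler_chart F a) (is_derive_lift sc at_) dVt dVt' Sz).
Qed.

Lemma inner_velocity a t : dom a t -> B a t (velocity c a t) (velocity c a t) = 1.
Proof.
move=> at_; have /= -> := inner_yy (local_finsler_chart F a) (unit_lift_slit at_).
by rewrite /F2 uc ?expr1n//; case: at_.
Qed.

Lemma is_derive_cst_near (f : R -> R) (t k : R) (J : set R) : open J -> J t ->
  (forall s, J s -> f s = k) -> forall d, is_derive t (1 : R) f d -> d = 0.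
Proof.
move=> oJ Jt fk d df; rewrite -(@derive_val _ _ _ _ _ _ _ df) -(derive_cst k t (1 : R)).
by apply: near_eq_derive; apply: filterS (open_nbhs_nbhs (conj oJ Jt)).
Qed.

(** Twice this product is the derivative of the squared speed, which is constantly 1, because the
    connection is metric. *)
Lemma acc_orthogonal a t : dom a t -> B a t (A a t) (velocity c a t) = 0.
Proof.
move=> at_; have dv := is_derive_velocity sc at_.
have oD : open (dom a) by exact: open_curve_dom.
have := is_derive_cst_near oD at_ (@inner_velocity a) (is_derive_inner_along at_ dv dv).
rewrite acceleration_cov.
rewrite (innerC (local_finsler_chart F a) (velocity c a t) _ (unit_lift_slit at_)).
by move=> /eqP; rewrite -mulr2n mulrn_eq0 => /eqP.
Qed.

Lemma nabla_acc_velocity a t : dom a t ->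
  B a t (cov F c a (A a) t) (velocity c a t) = - B a t (A a t) (A a t).
Proof.
move=> at_; have oD : open (dom a) by exact: open_curve_dom.
have := is_derive_cst_near oD at_ (@acc_orthogonal a)
  (is_derive_inner_along at_ (is_derive_acc at_) (is_derive_velocity sc at_)).
rewrite acceleration_cov.
by move=> /eqP; rewrite addr_eq0 => /eqP.
Qed.

Section ChartChange.
Context {a b : chart M} {t : R} (at_ : dom a t) (bt : dom b t).
Let h := local_rep (M := M) id a b.
Let x := chart_map a (c t).

Lemma velocity_change : velocity c b t = 'D_(velocity c a t) h x.
Proof.
exact: (velocity_push oI sc (conformal_to_self_id F) at_.1 at_.2 bt.2 sc).
Qed.

Lemma nabla_change (Z Z' : R -> E) dZ : is_derive t (1 : R) Z dZ ->
  (forall s, dom a s -> dom b s -> Z' s = 'D_(Z s) h (chart_map a (c s))) ->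
  cov F c b Z' t = 'D_(cov F c a Z t) h x.
Proof.
move=> dZt ZE.
have := nabla_push oI sc (conformal_to_self_id F) at_.1 at_.2 bt.2 sc
  (unit_neq0 at_) dZt (fun s Ks => ZE s Ks.1 Ks.2).
have -> : (fun=> 0) \o chart_inv a = cst 0 :> (E -> R) by [].
rewrite !derive_cst !scale0r !addr0.
have -> : gradient (F a) (cst 0) (velocity_lift c a t) = 0.
  by apply/rowP => i; rewrite !mxE big1// => j _; rewrite /partial derive_cst mulr0.
by rewrite scaler0 subr0.
Qed.

Lemma inner_change u v : B b t ('D_u h x) ('D_v h x) = B a t u v.
Proof.
have Sz := unit_lift_slit at_.
have E1 : velocity_lift c b t = tangent_map h (velocity_lift c a t).
  apply/pair_equal_spec; split; last exact: velocity_change.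
  by rewrite /h /local_rep /= (chart_mapP at_.2).2.
have oU : open (overlap (M := M) id a b) by apply: open_overlap => p; exact: cvg_id.
have Ua : overlap (M := M) id a b `<=` chart_cod a by move=> ? [].
have Ux : overlap (M := M) id a b x.
  by have [h1 h2] := chart_mapP at_.2; split; rewrite //= h2; case: bt.
have Sz' : slit_over (overlap (M := M) id a b) (velocity_lift c a t) by split => //; case: Sz.
have [sm [_ cfac]] := conformal_to_self_id F.
have := @inner_nat R n _ _ _ _ (local_finsler_sub F oU Ua) (local_finsler_chart F b) h (cst 0)
  (sm.2 a b) (fun k => Ck_cst k _ 0).
have hU y : overlap (M := M) id a b y -> chart_cod b (h y).
  by move=> [_ by_]; exact: (chart_mapP by_).1.
have hF z : overlap (M := M) id a b z.1 -> F b (tangent_map h z) = expR (cst 0 z.1) * F a z.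
  by move=> [az bz]; exact: cfac.
move=> /(_ hU hF _ u v Sz'); rewrite expR0 expr1n mul1r.
by move=> E2; rewrite E1; exact: E2.
Qed.

Lemma acc_change : A b t = 'D_(A a t) h x.
Proof.
rewrite acceleration.unlock.
apply: (@nabla_change (velocity c a) (velocity c b) _ (is_derive_velocity sc at_)) => s as_ bs.
exact: (velocity_push oI sc (conformal_to_self_id F) as_.1 as_.2 bs.2 sc).
Qed.

End ChartChange.

Lemma nabla_acc_change a b t : dom a t -> dom b t ->
  cov F c b (A b) t = 'D_(cov F c a (A a) t) (local_rep (M := M) id a b) (chart_map a (c t)).
Proof.
move=> at_ bt.
have AE s : dom a s -> dom b s -> A b s = 'D_(A a s) (local_rep id a b) (chart_map a (c s)).
  by move=> as_ bs; rewrite (acc_change as_ bs).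
exact: (@nabla_change a b t at_ bt (A a) (A b) _ (is_derive_acc at_) AE).
Qed.

Lemma diff_chart_change a b t : dom a t -> dom b t ->
  differentiable (local_rep (M := M) id a b) (chart_map a (c t)).
Proof.
move=> at_ bt; have oU : open (overlap (M := M) id a b) by apply: open_overlap => p; exact: cvg_id.
apply: (smooth_differentiable (fin_dim_rV n) (fin_dim_rV n) oU).
  exact: (conformal_to_self_id F).1.2 a b.
by have [h1 h2] := chart_mapP at_.2; split; rewrite //= h2; case: bt.
Qed.

(** The multiplier is left free: pairing with the velocity shows by [nabla_acc_velocity] that it can
    only be minus the squared length of the acceleration. *)
Definition circular_at a t := exists mu, cov F c a (A a) t = mu *: velocity c a t.

Lemma circular_at_change a b t : dom a t -> dom b t -> circular_at a t -> circular_at b t.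
Proof.
move=> at_ bt [mu E1]; exists mu; rewrite (nabla_acc_change at_ bt) E1 (velocity_change at_ bt).
exact: (diff_dirZ _ _ (diff_chart_change at_ bt)).
Qed.

End UnitSpeed.

(* The Frenet normal is acceleration / |acceleration|, of constant length. *)
Lemma geodesic_circleP I c : geodesic_circle F I c <->
  [/\ open_interval I, smooth_curve I c, unit_speed I c &
    forall t, I t -> exists2 a, chart_dom a (c t) & circular_at (c := c) a t].
Proof.
split=> [[oiI sc uc circ]|[oiI sc uc circ]]; have oI : open I by case: oiI.
  split=> // t It; have [a at_] := chart_cover (c t); exists a => //.
  have Dt : curve_dom (I := I) (c := c) a t by [].
  have oD : open (curve_dom (I := I) (c := c) a) by exact: open_curve_dom.
  have nD := open_nbhs_nbhs (conj oD Dt).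
  case: circ => [geo|[Y [kappa [[sY _] k0 YP]]]].
    exists 0; rewrite scale0r (covE F sc _ Dt).
    have -> : derive1 (acceleration F c a) t = 0.
      rewrite derive1E -(derive_cst (0 : E) t (1 : R)); apply: near_eq_derive.
      by apply: filterS nD => s [Is as_]; rewrite acceleration.unlock -nabla_along_cov geo.
    have -> : acceleration F c a t = 0 by rewrite acceleration.unlock -nabla_along_cov geo.
    apply: nab0.
    exact: (unit_lift_slit uc Dt).
  (* The acceleration is kappa Y, so its derivative is kappa times - kappa X. *)
  exists (- (kappa ^+ 2)); have [_ _ _ E1] := YP a t It at_.
  have dY : is_derive t (1 : R) (Y a) (derive1 (Y a) t) by exact: (smooth_is_derive (sY a)).
  rewrite (covE F sc _ Dt).
  have -> : derive1 (acceleration F c a) t = 0 *: Y a t + kappa *: derive1 (Y a) t.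
    apply: is_derive1; apply: (@near_eq_is_derive _ _ _ (fun s => kappa *: Y a s)).
      by apply: filterS nD => s [Is as_]; have [_ _ E2 _] := YP a s Is as_;
        rewrite acceleration.unlock -nabla_along_cov E2.
    exact: is_derive_scale (is_derive_cst kappa t (1 : R)) dY.
  have -> : acceleration F c a t = kappa *: Y a t.
    by rewrite acceleration.unlock -nabla_along_cov; have [] := YP a t It at_.
  rewrite (nab_scale (local_finsler_chart F a) _ _ _ _ _ (unit_lift_slit uc Dt)) scale0r add0r.
  by rewrite -(covE F sc _ Dt) -nabla_along_cov E1 scalerA expr2 mulrN.
have circ' a t : curve_dom (I := I) (c := c) a t -> circular_at (c := c) a t.
  move=> at_; have [b bt] := circ t at_.1.
  by apply: (circular_at_change oiI sc uc _ at_); split => //; case: at_.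
have /choice[ch chP] : forall t, exists a, chart_dom a (c t) by move=> t; exact: chart_cover.
pose sq a t := finsler_inner (F a) (velocity_lift c a t) (acceleration F c a t)
  (acceleration F c a t).
(* A chart is chosen at each parameter; by [inner_change] the value does not depend on it, so near
   each parameter [rho] is computed in one fixed chart. *)
pose rho t := sq (ch t) t.
have rhoE a t : curve_dom (I := I) (c := c) a t -> rho t = sq a t.
  move=> at_; have ct : curve_dom (I := I) (c := c) (ch t) t by split; [case: at_|exact: chP].
  by rewrite /rho /sq (acc_change oiI sc uc at_ ct) (inner_change oiI sc uc at_ ct).
(* The derivative is made of products of mu X with the acceleration, and these are orthogonal. *)
have drho t : I t -> is_derive t (1 : R) rho 0.
  move=> It; have Dt : curve_dom (I := I) (c := c) (ch t) t by split => //; exact: chP.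
  have oD : open (curve_dom (I := I) (c := c) (ch t)) by exact: open_curve_dom.
  apply: (@near_eq_is_derive _ _ _ (sq (ch t))).
    by apply: filterS (open_nbhs_nbhs (conj oD Dt)) => s Ds; rewrite (rhoE _ _ Ds).
  have da := is_derive_acc oiI sc uc Dt.
  have [mu E1] := circ' _ _ Dt.
  have d0 := is_derive_inner_along sc uc Dt da da.
  rewrite E1 innerZl innerZr in d0.
  rewrite (innerC (local_finsler_chart F (ch t)) (velocity c _ t) _ (unit_lift_slit uc Dt)) in d0.
  by rewrite (acc_orthogonal oiI sc uc Dt) mulr0 addr0 in d0.
have [[t0 It0] _ iI] := oiI.
have rhoc t : I t -> rho t = rho t0 by move=> It; exact: (derive0_cst_itv iI drho It It0).
have rho_posdef a t : curve_dom (I := I) (c := c) a t -> acceleration F c a t != 0 -> 0 < rho t.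
  move=> Dt a0; rewrite (rhoE _ _ Dt).
  exact: (local_posdef (local_finsler_chart F a) (unit_lift_slit uc Dt) a0).
have [rho0|rho0] := eqVneq (rho t0) 0.
  split=> //; left=> a t It at_; apply/eqP; apply/negPn/negP => a0.
  have Dt : curve_dom (I := I) (c := c) a t by [].
  rewrite nabla_along_cov acceleration_cov in a0.
  by have := rho_posdef a t Dt a0; rewrite rhoc// rho0 ltxx.
have rho_gt0 : 0 < rho t0.
  have Dt : curve_dom (I := I) (c := c) (ch t0) t0 by split => //; exact: chP.
  apply: (rho_posdef _ _ Dt); apply/negP => /eqP a0.
  by move: rho0; rewrite /rho /sq a0 inner0l eqxx.
pose kappa := Num.sqrt (rho t0).
have k0 : 0 < kappa by rewrite sqrtr_gt0.
have k1 : kappa != 0 by rewrite gt_eqF.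
have k2 : kappa ^+ 2 = rho t0 by rewrite sqr_sqrtr// ltW.
split=> //; right; exists (fun a t => kappa^-1 *: acceleration F c a t), kappa; split=> //.
  split=> [a k|a b t It at_ bt].
    apply: Ck_scale; [exact: open_curve_dom|exact: Ck_cst|exact: (smooth_acc oiI sc uc)].
  have Da : curve_dom (I := I) (c := c) a t by [].
  have Db : curve_dom (I := I) (c := c) b t by [].
  rewrite (acc_change oiI sc uc Da Db) -diff_dirZ//; exact: (diff_chart_change Da Db).
move=> a t It at_; have Dt : curve_dom (I := I) (c := c) a t by [].
have SZ := unit_lift_slit uc Dt.
have sqE : finsler_inner (F a) (velocity_lift c a t) (acceleration F c a t)
  (acceleration F c a t) = kappa ^+ 2.
  by rewrite k2 -(rhoc t It) (rhoE _ _ Dt).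
split.
- by rewrite innerZl innerZr sqE; field.
- rewrite innerZr (innerC (local_finsler_chart F a) (velocity c _ t) _ SZ).
  by rewrite (acc_orthogonal oiI sc uc Dt) mulr0.
- by rewrite scalerA divff// scale1r acceleration.unlock nabla_along_cov.
have [mu E1] := circ' a t Dt.
have muE : mu = - kappa ^+ 2.
  have := nabla_acc_velocity oiI sc uc Dt; rewrite E1 innerZl sqE.
  by rewrite (inner_velocity uc Dt) mulr1.
have da := is_derive_acc oiI sc uc Dt.
rewrite nabla_along_cov (covE F sc _ Dt).
have -> : derive1 (fun t => kappa^-1 *: acceleration F c a t) t =
    0 *: acceleration F c a t + kappa^-1 *: derive1 (acceleration F c a) t.
  by apply: is_derive1; exact: is_derive_scale (is_derive_cst kappa^-1 t (1 : R)) da.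
rewrite (nab_scale (local_finsler_chart F a) _ _ _ _ _ SZ) scale0r add0r.
rewrite -(covE F sc (acceleration F c a) Dt) E1 muE scalerA.
by rewrite mulrN expr2 mulKf.
Qed.

End GeodesicCircles.

Section PointwiseRules.
Context {R : realType} {V W : normedModType R}.

Lemma is_derive_add (f g : V -> W) (x v : V) df dg :
  is_derive x v f df -> is_derive x v g dg -> is_derive x v (fun y => f y + g y) (df + dg).
Proof. exact: is_deriveD. Qed.

Lemma is_derive_opp (f : V -> W) (x v : V) df :
  is_derive x v f df -> is_derive x v (fun y => - f y) (- df).
Proof. exact: is_deriveN. Qed.

End PointwiseRules.

Section CovariantDerivativeRules.
Context {R : realType} {n : nat} {M : smooth_manifold R n} (F : finsler M).
Local Notation E := 'rV[R]_n.
Context {I : set R} {c : R -> M} (sc : smooth_curve I c).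
Context {a : chart M} {t : R} (at_ : curve_dom (I := I) (c := c) a t).
Hypothesis v0 : velocity c a t != 0.

Let Sz := lift_slit at_ v0.
Let HF := local_finsler_chart F a.

Lemma cov_add (Z Z' : R -> E) dZ dZ' : is_derive t (1 : R) Z dZ -> is_derive t (1 : R) Z' dZ' ->
  cov F c a (fun s => Z s + Z' s) t = cov F c a Z t + cov F c a Z' t.
Proof.
move=> d d'; rewrite !(covE F sc _ at_) (is_derive1 d) (is_derive1 d').
by rewrite -(nab_add HF _ _ _ _ _ Sz) (is_derive1 (is_derive_add d d')).
Qed.

Lemma cov_scale (k : R -> R) dk (Z : R -> E) dZ : is_derive t (1 : R) k dk ->
  is_derive t (1 : R) Z dZ ->
  cov F c a (fun s => k s *: Z s) t = dk *: Z t + k t *: cov F c a Z t.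
Proof.
move=> d d'; rewrite !(covE F sc _ at_) (is_derive1 d').
by rewrite -(nab_scale HF _ _ _ _ _ Sz) (is_derive1 (is_derive_scale d d')).
Qed.

Lemma cov_opp (Z : R -> E) dZ : is_derive t (1 : R) Z dZ ->
  cov F c a (fun s => - Z s) t = - cov F c a Z t.
Proof.
move=> d; rewrite !(covE F sc _ at_) (is_derive1 d).
by rewrite -(nab_opp HF _ _ _ Sz) (is_derive1 (is_derive_opp d)).
Qed.

End CovariantDerivativeRules.

Section Reparametrization.
Context {R : realType} {n : nat} {M : smooth_manifold R n} (F : finsler M).
Local Notation E := 'rV[R]_n.
Context {I : set R} {c : R -> M} (oI : open I) (sc : smooth_curve I c).
Context {J : set R} {s : R -> R} (oJ : open J) (ss : smooth_on J s).
Hypothesis sJI : forall t, J t -> I (s t).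

Let ds t : J t -> is_derive t (1 : R) s (derive1 s t).
Proof. exact: (smooth_is_derive ss). Qed.

Lemma is_derive_comp1 (Z : R -> E) dZ t : J t -> is_derive (s t) (1 : R) Z dZ ->
  is_derive t (1 : R) (fun t => Z (s t)) (derive1 s t *: dZ).
Proof.
move=> Jt dZs; have dZd : differentiable Z (s t) by case: dZs => /derivable1_diffP.
have := is_derive_comp_diff (ds Jt) dZd.
have -> : 'D_(derive1 s t) Z (s t) = derive1 s t *: dZ.
  rewrite -(@derive_val _ _ _ _ _ _ _ dZs) -(diff_dirZ _ _ dZd).
  by rewrite [_%:A]mulr1.
by [].
Qed.

Lemma smooth_curve_reparam : smooth_curve J (c \o s).
Proof.
split=> [t|a k].
  rewrite inE => Jt; apply: continuous_comp.
    by apply: differentiable_continuous; apply/derivable1_diffP; case: (ds Jt).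
  by apply: sc.1; rewrite inE; exact: sJI.
have cs t : J t -> {for t, continuous s}.
  by move=> Jt; apply: differentiable_continuous; apply/derivable1_diffP; case: (ds Jt).
have oD : open (curve_dom (I := I) (c := c) a) by exact: open_curve_dom.
have oK : open (J `&` (c \o s) @^-1` chart_dom a).
  rewrite openE => t [Jt at_]; apply: filterI; first exact: open_nbhs_nbhs.
  have Ds : curve_dom (I := I) (c := c) a (s t) by split; [exact: sJI|].
  apply: (@filterS _ (nbhs t) _ (s @^-1` curve_dom (I := I) (c := c) a)); first by move=> t' [].
  exact: cs t Jt _ (open_nbhs_nbhs (conj oD Ds)).
have -> : chart_map a \o (c \o s) = (chart_map a \o c) \o s by [].
apply: (Ck_comp fin_dim_R (fin_dim_rV n) oK oD).
- by move=> t [Jt at_]; split; [exact: sJI|].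
- by apply: Ck_sub (ss k) => t [].
- exact: sc.2.
Qed.

Section At.
Context {a : chart M}.
Local Notation domc := (curve_dom (I := I) (c := c) a).
Local Notation dome := (curve_dom (I := J) (c := c \o s) a).

Lemma curve_dom_reparam t : dome t -> domc (s t).
Proof. by move=> [Jt at_]; split; [exact: sJI|]. Qed.

Lemma velocity_reparam t : dome t ->
  velocity (c \o s) a t = derive1 s t *: velocity c a (s t).
Proof.
move=> Dt; apply: is_derive1.
exact: (is_derive_comp1 Dt.1 (is_derive_coord_curve sc (curve_dom_reparam Dt))).
Qed.

Lemma cov_reparam (Z : R -> E) dZ t : dome t -> 0 < derive1 s t ->
  velocity c a (s t) != 0 -> is_derive (s t) (1 : R) Z dZ ->
  cov F (c \o s) a (fun t => Z (s t)) t = derive1 s t *: cov F c a Z (s t).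
Proof.
move=> Dt s0 v0 dZs; have Ds := curve_dom_reparam Dt.
have oD : open dome by apply: open_curve_dom => //; exact: smooth_curve_reparam.
have Sz := lift_slit Ds v0.
rewrite (covE F smooth_curve_reparam _ Dt) (covE F sc _ Ds) (is_derive1 dZs).
rewrite (is_derive1 (is_derive_comp1 Dt.1 dZs)).
have dv : is_derive t (1 : R) (velocity (c \o s) a)
    (derive1 (derive1 s) t *: velocity c a (s t)
     + derive1 s t ^+ 2 *: derive1 (velocity c a) (s t)).
  apply: (@near_eq_is_derive _ _ _ (fun t => derive1 s t *: velocity c a (s t))).
    by apply: filterS (open_nbhs_nbhs (conj oD Dt)) => t' Dt'; rewrite velocity_reparam.
  rewrite expr2 -scalerA; apply: is_derive_scale.
    exact: (smooth_is_derive (smooth_derive1 ss) Dt.1).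
  exact: (is_derive_comp1 Dt.1 (is_derive_velocity sc Ds)).
rewrite (is_derive1 dv); have -> : velocity_lift (c \o s) a t =
    (chart_map a (c (s t)), derive1 s t *: velocity c a (s t)).
  by rewrite /velocity_lift velocity_reparam.
exact: (nab_reparam (local_finsler_chart F a) _ _ _ _ Sz s0).
Qed.

End At.
End Reparametrization.

(** * Images of geodesic circles under conformal maps *)

Section CircleTransform.
Context {R : realType} {n : nat} {M : smooth_manifold R n} (F : finsler M).
Local Notation E := 'rV[R]_n.
Context {I : set R} {c : R -> M} (oiI : open_interval I) (sc : smooth_curve I c).
Hypothesis uc : unit_speed F I c.
Context {J : set R} {s : R -> R} (oiJ : open_interval J) (ss : smooth_on J s).
Hypothesis sJI : forall t, J t -> I (s t).
Context {f : M -> M} {phi : M -> R} (cf : conformal_to_self F f phi).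
(** [f] multiplies the length of vectors by e^phi, so this is the parameter for which [f \o c \o s]
    has unit speed. *)
Hypothesis s_speed : forall t, J t -> derive1 s t = expR (- phi (c (s t))).
Local Notation e := (c \o s).
Local Notation d := (f \o c \o s).
Hypothesis sd : smooth_curve J d.

Let oI : open I. Proof. by case: oiI. Qed.
Let oJ : open J. Proof. by case: oiJ. Qed.

Context {a b : chart M}.
Let h := local_rep f a b.
Let pa := phi \o chart_inv a.
Local Notation domc := (curve_dom (I := I) (c := c) a).
Local Notation dome := (curve_dom (I := J) (c := e) a).
Local Notation domd := (curve_dom (I := J) (c := d) b).
Let x s := chart_map a (c s).
Let y := velocity c a.
Let A := acceleration F c a.
Let W s := gradient (F a) pa (velocity_lift c a s).
Let B s := finsler_inner (F a) (velocity_lift c a s).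
Let l s := expR (- pa (x s)).
Let py s := 'D_(y s) pa (x s).
Let HF := local_finsler_chart F a.
Let oa : open (chart_cod a) := @open_chart_cod R n M a.
Let spa : smooth_on (chart_cod a) pa := cf.2.1 a.
Let oD : open domc. Proof. exact: open_curve_dom. Qed.
Let xa t : domc t -> chart_cod a (x t). Proof. by move=> [_ at_]; exact: (chart_mapP at_).1. Qed.

Let Sz t : domc t -> slit_over (chart_cod a) (velocity_lift c a t).
Proof. by move=> Dt; exact: (unit_lift_slit uc Dt). Qed.

Let smooth_lift : smooth_on domc (velocity_lift c a).
Proof.
move=> k; apply: Ck_pair => //; first exact: (smooth_coord sc).
exact: (smooth_velocity sc).
Qed.

Let dW t : domc t -> is_derive t (1 : R) W (derive1 W t).
Proof.
have sW : smooth_on domc W.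
  move=> k; apply: (Ck_comp fin_dim_E2 (fin_dim_rV n) oD (open_slit_over oa)).
  - exact: Sz.
  - exact: smooth_lift.
  - exact: (smooth_gradient HF spa).
exact: (smooth_is_derive sW).
Qed.

Let dpy t : domc t -> is_derive t (1 : R) py (derive1 py t).
Proof.
have sp : smooth_on domc py.
  move=> k; apply: (Ck_derive_along (fin_dim_rV n) fin_dim_R oD oa xa).
  - exact: spa.
  - exact: (smooth_coord sc).
  - exact: (smooth_velocity sc).
exact: (smooth_is_derive sp).
Qed.

Let dl t : domc t -> is_derive t (1 : R) l (- py t * l t).
Proof.
move=> Dt; have dp := is_derive_comp_diff (is_derive_coord_curve sc Dt) (diff_phi HF spa (xa Dt)).
have dp' := is_derive_opp dp.
have de : differentiable (@expR R) (- pa (x t)) by exact/derivable1_diffP/derivable_expR.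
have := is_derive_comp_diff dp' de.
have -> : 'D_(- 'D_(velocity c a t) pa (x t)) expR (- pa (x t)) = - py t * l t.
  rewrite -[X in 'D_X _ _](mulr1) -[X in _ = _ * X](@derive_val _ _ _ _ _ _ _ (is_derive_expR _)).
  exact: diff_dirZ.
by [].
Qed.

Let BWy t : domc t -> B t (W t) (y t) = py t.
Proof. by move=> Dt; exact: (inner_gradient HF spa _ (Sz Dt)). Qed.

Let domE t : dome t -> domc (s t).
Proof. exact: (curve_dom_reparam sJI). Qed.

Let sE t : dome t -> derive1 s t = l (s t).
Proof. by move=> [Jt at_]; rewrite s_speed// /l /pa /x /= (chart_mapP at_).2. Qed.

Let s_gt0 t : dome t -> 0 < derive1 s t.
Proof. by move/sE->; exact: expR_gt0. Qed.

Let se : smooth_curve J e := smooth_curve_reparam oI sc oJ ss sJI.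

Let yN0 t : domc t -> y t != 0. Proof. by move/Sz => []. Qed.

Let gradient_scale t (k : R) : domc t -> 0 < k ->
  gradient (F a) pa (x t, k *: y t) = W t.
Proof.
move=> Dt k0; apply: (inner_inj HF (Sz Dt)) => w.
have E1 := inner_gradient HF spa w (scale_slit (Sz Dt) k0).
rewrite (inner_scale HF _ _ (Sz Dt) k0) in E1.
exact: etrans E1 (esym (inner_gradient HF spa w (Sz Dt))).
Qed.

Let veE t : dome t -> velocity e a t = l (s t) *: y (s t).
Proof. by move=> Dt; rewrite (velocity_reparam sc ss sJI Dt) sE. Qed.

Let ve0 t : dome t -> velocity e a t != 0.
Proof. by move=> Dt; rewrite veE// scaler_eq0 negb_or gt_eqF ?expR_gt0//= yN0//; exact: domE. Qed.

(** [nabla_push] for the curve [c \o s], expressed along [c]: every term picks up one factor [l],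
    the speed of [s]. *)
Let cov_push (Z : R -> E) dZ (Z' : R -> E) t : dome t -> domd t ->
  is_derive (s t) (1 : R) Z dZ ->
  (forall t, dome t -> domd t -> Z' t = 'D_(Z (s t)) h (x (s t))) ->
  cov F d b Z' t =
  'D_(l (s t) *: (cov F c a Z (s t) + 'D_(Z (s t)) pa (x (s t)) *: y (s t)
    + py (s t) *: Z (s t) - B (s t) (Z (s t)) (y (s t)) *: W (s t))) h (x (s t)).
Proof.
move=> at_ bt dZs ZE; have Ds := domE at_.
have := nabla_push oJ se cf at_.1 at_.2 bt.2 sd (ve0 at_) (is_derive_comp1 ss at_.1 dZs)
  (fun s Ks => ZE s Ks.1 Ks.2).
rewrite (cov_reparam F oI sc oJ ss sJI at_ (s_gt0 at_) (yN0 Ds) dZs).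
have -> : velocity_lift e a t = (x (s t), l (s t) *: y (s t)) by rewrite /velocity_lift veE.
rewrite (gradient_scale Ds (expR_gt0 _)) (inner_scale HF _ _ (Sz Ds) (expR_gt0 _)).
rewrite (veE at_) (sE at_) innerZr.
have -> : 'D_(l (s t) *: y (s t)) pa (chart_map a (e t)) = l (s t) * py (s t).
  exact: (diff_dirZ _ _ (diff_phi HF spa (xa Ds))).
move=> ->; congr ('D_ _ h _).
rewrite -[in RHS]/(velocity_lift c a (s t)) !scalerDr !scalerN !scalerA.
rewrite [X in _ + X *: _ + _ - _ = _]mulrC; reflexivity.
Qed.

Let dom_change t : dome t -> domd t -> differentiable h (x (s t)).
Proof.
move=> at_ bt; have oU : open (overlap f a b) by exact: open_overlap cf.1.1.
apply: (smooth_differentiable (fin_dim_rV n) (fin_dim_rV n) oU (cf.1.2 a b)).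
by have [h1 h2] := chart_mapP at_.2; split; rewrite //= h2; case: bt.
Qed.

Let dy t : domc t -> is_derive t (1 : R) y (derive1 y t).
Proof. exact: is_derive_velocity. Qed.

Let dA t : domc t -> is_derive t (1 : R) A (derive1 A t).
Proof. by move=> Dt; exact: (is_derive_acc oiI sc uc Dt). Qed.

(** The acceleration of the image curve, pulled back to [c]. The velocity pulls back to l y with l'
    = - py l; of the three terms in py y, one negative from l' and two from the conformal change,
    one remains. *)
Let Zc t := l t ^+ 2 *: (A t + py t *: y t - W t).

Lemma acceleration_push t : dome t -> domd t ->
  acceleration F d b t = 'D_(Zc (s t)) h (x (s t)).
Proof.
move=> at_ bt; have Ds := domE at_.
have vE t' : dome t' -> domd t' ->
    velocity d b t' = 'D_(l (s t') *: y (s t')) h (x (s t')).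
  move=> at' bt'; rewrite -(veE at').
  exact: (velocity_push oJ se cf at'.1 at'.2 bt'.2 sd).
rewrite -acceleration_cov (cov_push at_ bt (is_derive_scale (dl Ds) (dy Ds)) vE).
congr ('D_ _ h _); rewrite (cov_scale F sc Ds (yN0 Ds) (dl Ds) (dy Ds)) acceleration_cov.
have -> : 'D_(l (s t) *: y (s t)) pa (x (s t)) = l (s t) * py (s t).
  exact: (diff_dirZ _ _ (diff_phi HF spa (xa Ds))).
have -> : B (s t) (l (s t) *: y (s t)) (y (s t)) = l (s t).
  by rewrite /B innerZl (inner_velocity uc Ds) mulr1.
rewrite /Zc -/A; move: (A (s t)) (W (s t)) (y (s t)) (l (s t)) (py (s t)) => A' W' y' l' p'.
by apply/rowP => i; rewrite !mxE; ring.
Qed.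

(** The terms in [A] cancel: the derivative of l^2 gives -2 py, while the derivative of py y and the
    conformal correction give py each. The term in B(Zc, y) W vanishes because [Zc] is orthogonal to
    y. All that is along y goes into [m]. *)
Lemma cov_acceleration_push t : dome t -> domd t -> exists m : R,
  cov F d b (acceleration F d b) t =
  'D_(l (s t) ^+ 3 *: (cov F c a A (s t) - cov F c a W (s t) + py (s t) *: W (s t)
                       + m *: y (s t))) h (x (s t)).
Proof.
move=> at_ bt; have Ds := domE at_.
have dZ1 := is_derive_add (dA Ds) (is_derive_scale (dpy Ds) (dy Ds)).
have dZ2 := is_derive_add dZ1 (is_derive_opp (dW Ds)).
have dl2 := is_derive_mul (dl Ds) (dl Ds).
have ZcE : (fun t => (l t * l t) *: (A t + py t *: y t - W t)) = Zc.
  by apply/funext => t'; rewrite /Zc expr2.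
have dZ := is_derive_scale dl2 dZ2; rewrite ZcE in dZ.
have cZ : cov F c a Zc (s t) = (2 * (- py (s t)) * l (s t) ^+ 2) *: (A (s t) + py (s t) *: y
  (s t) - W (s t))
  + l (s t) ^+ 2 *: (cov F c a A (s t) + (derive1 py (s t) *: y (s t) + py (s t) *: A
    (s t)) - cov F c a W (s t)).
  rewrite -ZcE (cov_scale F sc Ds (yN0 Ds) dl2 dZ2).
  rewrite (cov_add F sc Ds (yN0 Ds) dZ1 (is_derive_opp (dW Ds))).
  rewrite (cov_add F sc Ds (yN0 Ds) (dA Ds) (is_derive_scale (dpy Ds) (dy Ds))).
  rewrite (cov_scale F sc Ds (yN0 Ds) (dpy Ds) (dy Ds)) (cov_opp F sc Ds (yN0 Ds) (dW Ds)).
  rewrite acceleration_cov -/A.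
  by congr (_ *: _ + _ *: _); ring.
have BZ : B (s t) (Zc (s t)) (y (s t)) = 0.
  rewrite /B /Zc innerZl innerDl innerNl innerDl innerZl (inner_velocity uc Ds).
  rewrite (acc_orthogonal oiI sc uc Ds) -/(B (s t) (W (s t)) (y (s t))) (BWy Ds).
  by rewrite mulr1 add0r subrr mulr0.
rewrite (cov_push at_ bt dZ acceleration_push) BZ scale0r subr0 cZ.
move: ('D_(Zc (s t)) pa (x (s t))) => q.
exists (derive1 py (s t) - py (s t) ^+ 2 + q / l (s t) ^+ 2).
congr ('D_ _ h _); rewrite /Zc; have l0 : l (s t) != 0 by rewrite gt_eqF ?expR_gt0.
move: (A (s t)) (W (s t)) (y (s t)) (l (s t)) l0 (py (s t)) => A' W' y' l' l0 p'.
move: (cov _ _ _ _ _) (cov _ _ _ _ _) (derive1 _ _) => Q' N' dp'.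
by apply/rowP => i; rewrite !mxE; field.
Qed.

Let push_algebra (g : E -> E) (p l' mu m : R) (y' N' W' : E) : l' != 0 ->
  (forall (k : R) v, g (k *: v) = k *: g v) -> (forall u v, g (u - v) = g u - g v) ->
  (forall v, g v = 0 -> v = 0) ->
  (exists k, g (l' ^+ 3 *: (mu *: y' - N' + p *: W' + m *: y')) = k *: g (l' *: y')) <->
  (exists k, N' - p *: W' = k *: y').
Proof.
move=> l0 gZ gB hinj; split=> [[k kE]|[k kE]].
  exists (mu + m - k / l' ^+ 2); apply/eqP; rewrite -subr_eq0; apply/eqP.
  set v := (v in v = 0); have : l' ^+ 3 *: v = 0.
    apply: hinj; rewrite -(subrr (k *: g (l' *: y'))) -{2}kE -gZ -gB.
    by congr g; rewrite /v; apply/rowP => i; rewrite !mxE; field.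
  by move/eqP; rewrite scaler_eq0 expf_eq0 (negPf l0) => /eqP.
exists (l' ^+ 2 * (mu - k + m)); rewrite -gZ; congr g.
have -> : mu *: y' - N' + p *: W' = mu *: y' - (N' - p *: W') by rewrite opprB addrA addrAC.
by rewrite kE; apply/rowP => i; rewrite !mxE; ring.
Qed.

(** Along a circle the derivative of [A] is itself parallel to y, so only the derivative of [W] and
    py W remain to be compared with y; injectivity of the differential of [f] transfers the
    condition to [c]. *)
Lemma circular_push t : dome t -> domd t -> circular_at F (c := c) a (s t) ->
  circular_at F (c := d) b t <-> exists m, cov F c a W (s t) - py (s t) *: W (s t) = m *: y (s t).
Proof.
move=> at_ bt [mu muE]; have Ds := domE at_.
have dh := dom_change at_ bt.
have dvE : velocity d b t = 'D_(l (s t) *: y (s t)) h (x (s t)).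
  by rewrite -(veE at_); exact: (velocity_push oJ se cf at_.1 at_.2 bt.2 sd).
have l0 : l (s t) != 0 by rewrite gt_eqF ?expR_gt0.
have [m mE] := cov_acceleration_push at_ bt.
rewrite -/A in muE; rewrite muE in mE.
have hinj v : 'D_v h (x (s t)) = 0 -> v = 0.
  move=> v0; apply/eqP/negPn/negP => vN0.
  have oU : open (overlap f a b) by exact: open_overlap cf.1.1.
  have Ua : overlap f a b `<=` chart_cod a by move=> ? [].
  have Ux : overlap f a b (x (s t)).
    by have [h1 h2] := chart_mapP at_.2; split; rewrite //= h2; case: bt.
  have := @tangent_neq0 R n _ _ _ _ (local_finsler_sub F oU Ua) (local_finsler_chart F b) h pa.
  move=> /(_ _ _ _ _ Ux vN0); rewrite v0 eqxx => H; apply: notF; apply: H.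
    by move=> y' [_ by_]; exact: (chart_mapP by_).1.
  by move=> z [az bz]; exact: cf.2.2.
have gZ (k : R) v : 'D_(k *: v) h (x (s t)) = k *: 'D_v h (x (s t)) := diff_dirZ k v dh.
have gB u v : 'D_(u - v) h (x (s t)) = 'D_u h (x (s t)) - 'D_v h (x (s t)).
  by rewrite (diff_dirD _ _ dh) (diff_dirN _ dh).
rewrite /circular_at dvE mE.
exact: (push_algebra (g := fun v => 'D_v h (x (s t))) _ mu m _ _ _ l0 gZ gB hinj).
Qed.

End CircleTransform.

Opaque gradient finsler_inner.

(** * Vertical derivatives of the gradient *)

Section Gronwall.
Context {R : realType}.

(** The product of [q] with e^(-K t) has a non-positive derivative. *)
Lemma gronwall_le0 (q dq : R -> R) (T K : R) : 0 <= T -> q 0 <= 0 ->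
  (forall t, 0 <= t <= T -> is_derive t (1 : R) q (dq t)) ->
  (forall t, 0 <= t <= T -> dq t <= K * q t) -> q T <= 0.
Proof.
move=> T0 q0 dqE dqK; pose r t := expR (- K * t) * q t.
have dr t : 0 <= t <= T -> is_derive t (1 : R) r (expR (- K * t) * (dq t - K * q t)).
  move=> tT; have dKt : is_derive t (1 : R) (fun t => - K * t) (- K).
    apply: is_derive_eq (is_derive_mul (is_derive_cst (- K) t (1 : R)) (is_derive_id t (1 : R))) _.
    by rewrite mul0r add0r mulr1.
  have de : is_derive t (1 : R) (fun t => expR (- K * t)) (- K * expR (- K * t)).
    have dx : differentiable (@expR R) (- K * t) by exact/derivable1_diffP/derivable_expR.
    have := is_derive_comp_diff dKt dx.
    have -> : 'D_(- K) expR (- K * t) = - K * expR (- K * t).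
      rewrite -[X in 'D_X _ _]mulr1 -[X in _ = _ * X](@derive_val _ _ _ _ _ _ _ (is_derive_expR _)).
      exact: diff_dirZ.
    by [].
  by apply: is_derive_eq (is_derive_mul de (dqE t tT)) _; ring.
have inT t : 0 <= t <= 1 -> 0 <= 0 + t *: T <= T.
  move=> /andP[t0 t1]; rewrite add0r [t *: T]/(t * T) mulr_ge0//=.
  by rewrite ler_piMl.
have rD t : 0 <= t <= 1 -> derivable r (0 + t *: T) T /\
    'D_T r (0 + t *: T) = T *: 'D_1 r (0 + t *: T).
  move=> /inT /dr [d _]; have := deriveZv T d; rewrite [T%:A]mulr1.
  by [].
have [t tI] := @mvt_line R R r 0 T (fun t tI => (rD t tI).1).
rewrite (rD t tI).2 (@derive_val _ _ _ _ _ _ _ (dr _ (inT t tI))) add0r => rE.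
have : r T <= 0.
  have -> : r T = r 0 + (r T - r 0) by ring.
  rewrite rE {1}/r mulr0 expR0 mul1r; rewrite -[leRHS](addr0 0); apply: lerD => //.
  rewrite [_ *: _]/(_ * _) mulr_ge0_le0// mulr_ge0_le0 ?expR_ge0//.
  by rewrite subr_le0 dqK//; exact: inT.
by rewrite pmulr_rle0 ?expR_gt0.
Qed.

Lemma right_limit_value (V : normedModType R) (g : R -> V) k :
  {for 0, continuous g} -> (forall r, 0 < r -> g r = k) -> g 0 = k.
Proof.
move=> cg gk; have h1 : g r @[r --> 0^'+] --> g 0 by exact: cvg_at_right_filter.
have h2 : g r @[r --> 0^'+] --> k.
  apply: (@cvg_trans _ (k @[_ --> (0 : R)^'+])); last exact: cvg_cst.
  by apply: near_eq_cvg; apply: filterS (nbhs_right_gt 0) => r r0; rewrite gk.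
exact: (cvg_unique _ h1 h2).
Qed.

Lemma continuous_at_sum (V : topologicalType) m (g : 'I_m -> V -> R) x :
  (forall i, {for x, continuous (g i)}) -> {for x, continuous (fun y => \sum_i g i y)}.
Proof.
move=> cg; rewrite (_ : (fun y => _) = \sum_i g i); last by apply/funext => y; rewrite fct_sumE.
apply: (big_ind (fun f => {for x, continuous f})) => [|f h cf ch|i _]; last exact: cg.
  exact: cvg_cst.
exact: cvgD.
Qed.

End Gronwall.

Section VerticalGradient.
Context {R : realType} {n : nat}.
Local Notation E := 'rV[R]_n.
Implicit Types (z X : E * E) (u v w V : E) (phi : E -> R).
Context {U : set E} {F : E * E -> R} (HF : local_finsler U F).
Local Notation S := (slit_over U).
Local Notation B := (finsler_inner F).
Local Notation T := (dmetric F).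

Let oU : open U := local_open HF.
Let oS : open S := open_slit_over oU.

Lemma gradient_homogeneous phi x y (l : R) : smooth_on U phi -> S (x, y) -> 0 < l ->
  gradient F phi (x, l *: y) = gradient F phi (x, y).
Proof.
move=> sphi Sz l0; apply: (inner_inj HF Sz) => w.
have E1 := inner_gradient HF sphi w (scale_slit Sz l0).
rewrite (inner_scale HF _ _ Sz l0) in E1.
exact: etrans E1 (esym (inner_gradient HF sphi w Sz)).
Qed.

(** The differential of [phi] does not depend on y, so the vertical variation of its gradient only
    compensates that of the metric. *)
Lemma gradient_vertical phi z u w : smooth_on U phi -> S z ->
  B z ('D_(0, u) (gradient F phi) z) w = - T z (0, u) (gradient F phi z) w.
Proof.
by move=> sphi Sz; rewrite (inner_dgradient HF sphi _ _ Sz) derive0 add0r.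
Qed.

Section Positive.
Context {phi : E -> R} (sphi : smooth_on U phi).
Local Notation W := (gradient F phi).
Hypothesis vert : forall z w, S z -> T z (0, W z) (W z) w = 0.

Let dWW z : S z -> 'D_(0, W z) W z = 0.
Proof.
move=> Sz; apply: (inner_inj HF Sz) => w.
by rewrite (gradient_vertical _ _ sphi Sz) vert// oppr0 inner0l.
Qed.

Section Ray.
Context {x y : E} (Sxy : S (x, y)) (y0 : 0 < 'D_y phi x).
Let w0 := W (x, y).
Let zt (t : R) : E * E := (x, y + t *: w0).
(** Bounds the vertical derivative of [W] along the ray; its maximum on [0, t] gives the Gronwall
    constant. *)
Let m (t : R) : R := \sum_i \sum_j `|('D_(0, delta_mx 0 j) W (zt t)) 0 i|.

Let w0_neq0 : w0 != 0.
Proof.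
apply/negP => /eqP w00; have := inner_gradient HF sphi y Sxy.
by rewrite -/w0 w00 inner0l => e0; move: y0; rewrite -e0 ltxx.
Qed.

(** At the point of parameter [t], the derivative of [phi] in the direction y + t w0 is D_y phi + t
    B(w0, w0) > 0. The ray therefore never meets the zero vector. *)
Let Szt t : 0 <= t -> S (zt t).
Proof.
move=> t0; split; first by case: Sxy.
apply/negP => /eqP /= yt0; have Ux : U x by case: Sxy.
have : 'D_(y + t *: w0) phi x = 0 by rewrite yt0 derive0.
rewrite (diff_dirD _ _ (diff_phi HF sphi Ux)) (diff_dirZ _ _ (diff_phi HF sphi Ux)).
have <- := inner_gradient HF sphi w0 Sxy; rewrite -/w0 /=.
have := local_posdef HF Sxy w0_neq0; set b := B _ _ _ => b0 e0.
have : 0 < 'D_y phi x + t *: b by rewrite ltr_pwDl// mulr_ge0// ltW.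
by rewrite e0 ltxx.
Qed.

Let continuous_zt t : {for t, continuous zt}.
Proof.
apply: (@cvg_pair _ _ _ _ (nbhs x) (nbhs (y + t *: w0)) _ _ _ _ _); first exact: cvg_cst.
by apply: cvgD; [exact: cvg_cst|exact: scalel_continuous].
Qed.

(* D_(0, W) W = 0 makes u(t) = W(x, y + t w0) - w0 a solution of the linear
   equation u' = - D_(0, u) W with u(0) = 0. *)
Lemma gradient_ray t : 0 <= t -> W (x, y + t *: w0) = w0.
Proof.
(* The Euclidean norm in coordinates suffices: it turns the linear equation into a scalar inequality
   q' <= 2 m(c) q with q(0) = 0. *)
move=> t0; pose u (s : R) := W (zt s) - w0; pose q (s : R) := \sum_i u s 0 i ^+ 2.
have dzt (s : R) : is_derive s (1 : R) zt (0, w0).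
  have := is_derive_add (is_derive_cst y s (1 : R))
    (is_derive_scale (is_derive_id s (1 : R)) (is_derive_cst w0 s (1 : R))).
  rewrite add0r scaler0 addr0 [1 *: _]scale1r => d2.
  exact: (is_derive_pair (is_derive_cst x s (1 : R)) d2).
have du (s : R) : 0 <= s -> is_derive s (1 : R) u (- 'D_(0, u s) W (zt s)).
  move=> s0; have dW := diff_gradient HF sphi (Szt s0).
  have d1 := is_derive_add (is_derive_comp_diff (dzt s) dW) (is_derive_opp (is_derive_cst w0 s
    (1 : R))).
  apply: is_derive_eq d1 _; rewrite oppr0 addr0.
  have -> : (0, w0) = (0, W (zt s)) - (0, u s) :> E * E.
    by apply/pair_equal_spec; rewrite /= subrr /u opprB addrC subrK.
  by rewrite (diff_dirD _ _ dW) (diff_dirN _ dW) dWW ?add0r//; exact: Szt.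
have dq (s : R) : 0 <= s -> is_derive s (1 : R) q
    (\sum_i (- 2 * u s 0 i * ('D_(0, u s) W (zt s)) 0 i)).
  move=> s0; apply: is_derive_sumE => i; have di := is_derive_coord i (du s s0).
  have := is_derive_mul di di; rewrite (_ : (fun _ => _) = (fun s => u s 0 i ^+ 2)); last first.
    by apply/funext => s'; rewrite expr2.
  move=> h; apply: is_derive_eq h _.
  have -> : (- 'D_(0, u s) W (zt s)) 0 i = - ('D_(0, u s) W (zt s)) 0 i by rewrite mxE.
  by move: (fun_of_matrix ('D_(0, u s) W (zt s)) 0 i) => d; ring.
have cm : {within `[0, t], continuous m}.
  apply: continuous_in_subspaceT => s; rewrite inE /= in_itv /= => /andP[s0 _].
  apply: continuous_at_sum => i; apply: continuous_at_sum => j; apply: cvg_norm.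
  have cW : {for zt s, continuous ('D_(0, delta_mx 0 j) W)}.
    exact: (Ck_continuous (smooth_derive (0, delta_mx 0 j) (smooth_gradient HF sphi) 0%N) (Szt s0)).
  have := continuous_comp (@continuous_zt s) cW => h.
  exact: (cvg_comp _ _ h (@coord_continuous _ _ _ 0 i _)).
have [c _ mc] := EVT_max t0 cm.
have qb (s : R) : 0 <= s <= t -> \sum_i (- 2 * u s 0 i * ('D_(0, u s) W (zt s)) 0 i) <=
  (2 * m c) * q s.
  move=> /andP[s0 st]; have dW := diff_gradient HF sphi (Szt s0).
  have uq i : u s 0 i ^+ 2 <= q s.
    by rewrite /q (bigD1 i)//= lerDl sumr_ge0// => j _; rewrite sqr_ge0.
  have uuq i j : `|u s 0 i| * `|u s 0 j| <= q s.
    have := uq i; have := uq j; have := sqr_ge0 (`|u s 0 i| - `|u s 0 j|).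
    by rewrite -[u s 0 i ^+ 2]real_normK ?num_real// -[u s 0 j ^+ 2]real_normK ?num_real//; nra.
  apply: (@le_trans _ _ (2 * m s * q s)); last first.
    have q0 : 0 <= q s by apply: sumr_ge0 => i _; exact: sqr_ge0.
    have ms : m s <= m c by apply: mc; rewrite in_itv /= s0.
    exact: (ler_wpM2r q0 (ler_wpM2l (ler0n R 2) ms)).
  rewrite /m -mulrA mulr_suml mulr_sumr; apply: ler_sum => i _.
  rewrite mulr_suml mulr_sumr.
  have Di : ('D_(0, u s) W (zt s)) 0 i = \sum_j u s 0 j * ('D_(0, delta_mx 0 j) W (zt s)) 0 i.
    by rewrite (vertical_sum (u s)) (derive_dir_sumV _ _ dW) summxE; apply: eq_bigr => j _;
      rewrite mxE.
  rewrite [X in _ * X <= _]Di mulr_sumr; apply: ler_sum => j _.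
  have := uuq i j.
  move: (u s 0 i) (u s 0 j) (fun_of_matrix ('D_(0, delta_mx 0 j) W (zt s)) 0 i) => a b d ab.
  apply: (@le_trans _ _ (2 * (`|a| * `|b| * `|d|))).
    have -> : - 2 * a * (b * d) = 2 * (- (a * b * d)) by ring.
    by rewrite ler_wpM2l// -!normrM -[X in _ <= X]normrN ler_norm.
  by rewrite ler_wpM2l// [leRHS]mulrC ler_wpM2r.
have qt : q t <= 0.
  apply: (gronwall_le0 t0 _ (fun s sI => dq s (andP sI).1) qb).
  by rewrite /q big1// => i _; rewrite /u /zt scale0r addr0 subrr mxE expr0n.
apply/eqP; rewrite -subr_eq0; apply/eqP/rowP => i; rewrite [RHS]mxE -/(zt t) -/(u t).
apply/eqP; rewrite -sqrf_eq0 eq_le sqr_ge0 andbT; apply: le_trans qt.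
by rewrite /q (bigD1 i)//= lerDl sumr_ge0// => j _; rewrite sqr_ge0.
Qed.

(* By homogeneity W(x, r y + w0) = w0 for r = 1 / t > 0; let r tend to 0. *)
Lemma gradient_fixed : w0 != 0 /\ W (x, w0) = w0.
Proof.
split; first exact: w0_neq0.
pose g (r : R) := W (x, r *: y + w0).
have -> : W (x, w0) = g 0 by rewrite /g scale0r add0r.
apply: right_limit_value => [|r r0].
  have cz : {for 0, continuous (fun r : R => (x, r *: y + w0))}.
    apply: (@cvg_pair _ _ _ _ (nbhs x) (nbhs (0 *: y + w0)) _ _ _ _ _); first exact: cvg_cst.
    by apply: cvgD; [exact: scalel_continuous|exact: cvg_cst].
  apply: (continuous_comp cz); rewrite scale0r add0r.
  apply: (Ck_continuous (smooth_gradient HF sphi 0%N)).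
  by split; [case: Sxy|].
rewrite /g; have ri0 : 0 < r^-1 by rewrite invr_gt0.
rewrite -[RHS](gradient_ray (ltW ri0)).
have -> : y + r^-1 *: w0 = r^-1 *: (r *: y + w0) by rewrite scalerDr scalerA mulVf ?scale1r//
  gt_eqF.
rewrite (gradient_homogeneous sphi)//.
have := Szt (ltW ri0); rewrite /zt.
have -> : y + r^-1 *: w0 = r^-1 *: (r *: y + w0) by rewrite scalerDr scalerA mulVf ?scale1r//
  gt_eqF.
by move=> [? /=]; rewrite scaler_eq0 negb_or => /andP[_ ?]; split.
Qed.

End Ray.

(* B_(x, W)(W, v) = D_v phi holds for y in an open set; in its derivative the
   variation of the metric at (x, W) vanishes on W. *)
Lemma gradient_vertical_pos z u : S z -> 0 < 'D_(z.2) phi z.1 -> 'D_(0, u) W z = 0.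
Proof.
case: z => x y Sz /= y0; have Ux : U x by case: Sz.
have [w0 Ww] := gradient_fixed Sz y0; set w := W (x, y) in w0 Ww.
have Sw : S (x, w) by split; [exact: Ux|exact: w0].
have dph := diff_phi HF sphi Ux.
pose zeta (t : R) : E * E := (x, t *: u + y).
have dzeta : is_derive (0 : R) (1 : R) zeta (0, u).
  have := is_derive_add (is_derive_scale (is_derive_id (0 : R) (1 : R)) (is_derive_cst u
    (0 : R) (1 : R))) (is_derive_cst y (0 : R) (1 : R)).
  rewrite scaler0 !addr0 [1 *: _]scale1r => d2.
  exact: (is_derive_pair (is_derive_cst x (0 : R) (1 : R)) d2).
have zeta0 : zeta 0 = (x, y) by rewrite /zeta scale0r add0r.
have dWz : is_derive (0 : R) (1 : R) (fun t => W (zeta t)) ('D_(0, u) W (x, y)).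
  have := is_derive_comp_diff dzeta; rewrite zeta0; apply.
  exact: (diff_gradient HF sphi Sz).
have dp : is_derive (0 : R) (1 : R) (fun t => (x, W (zeta t))) (0, 'D_(0, u) W (x, y)).
  by apply: is_derive_pair => //; exact: is_derive_cst.
have czeta : {for 0, continuous zeta} by case: dzeta => /derivable1_diffP
  /differentiable_continuous.
have nS : \forall t \near (0 : R), S (zeta t).
  by apply: czeta; rewrite zeta0; exact: (open_nbhs_nbhs (conj oS Sz)).
have np : \forall t \near (0 : R), 0 < 'D_(t *: u + y) phi x.
  have cl : {for (0 : R), continuous (fun t : R => t * 'D_u phi x + 'D_y phi x)}.
    by apply: cvgD; [apply: cvgM; [exact: cvg_id|exact: cvg_cst]|exact: cvg_cst].
  have : \forall t \near (0 : R), 0 < t * 'D_u phi x + 'D_y phi x.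
    by apply: (cl [set r | 0 < r]); rewrite /= mul0r add0r; exact: lt_nbhsr.
  by apply: filterS => t; rewrite (diff_dirD _ _ dph) (diff_dirZ _ _ dph).
apply: (inner_inj HF Sw) => v; rewrite inner0l.
have dB := is_derive_inner HF dp dWz (is_derive_cst v (0 : R) (1 : R)).
rewrite /= zeta0 -/w in dB; have dB' := dB Sw.
have dC : is_derive (0 : R) (1 : R) (fun t => B (x, W (zeta t)) (W (zeta t)) v) 0.
  have dcst := is_derive_cst ('D_v phi x) (0 : R) (1 : R).
  apply: (near_eq_is_derive _ dcst).
  apply: (@filterS2 _ _ _ _ _ _ _ nS np) => t St pt.
  have [wt0 Wt] := gradient_fixed St pt.
  have Swt : S (x, W (zeta t)) by split; [exact: Ux|exact: wt0].
  by have := inner_gradient HF sphi v Swt; rewrite /= Wt => <-.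
move: (@derive_val _ _ _ _ _ _ _ dC); rewrite (@derive_val _ _ _ _ _ _ _ dB') inner0r addr0.
by rewrite (dmetric_yl HF (z := (x, w)) _ _ Sw) add0r.
Qed.

End Positive.

Lemma gradient_opp phi z : smooth_on U phi -> S z ->
  gradient F (fun x => - phi x) z = - gradient F phi z.
Proof.
move=> sphi Sz; apply: (inner_inj HF Sz) => w.
have Uz : U z.1 by case: Sz.
have sN : smooth_on U (fun x => - phi x).
  move=> k; apply: (@Ck_eq _ _ _ k U (fun x => (-1) * phi x)) => //; first by move=> x _;
    rewrite mulN1r.
  by apply: Ck_mul => //; exact: Ck_cst.
rewrite (inner_gradient HF sN w Sz) innerNl (inner_gradient HF sphi w Sz).
exact: (@derive_val _ _ _ _ _ _ _ (is_derive_opp (diff_is_derive w (diff_phi HF sphi Uz)))).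
Qed.

(** Where D_y phi > 0 this is [gradient_vertical_pos], and where D_y phi < 0 it is the same for -
    phi, whose gradient is - W. Where D_y phi = 0 and W is not zero, moving y along W enters the
    first region, and the identity passes to the limit. *)
Lemma cartan_gradient_eq0 phi : smooth_on U phi ->
  (forall z w, S z -> T z (0, gradient F phi z) (gradient F phi z) w = 0) ->
  forall z u w, S z -> T z (0, u) (gradient F phi z) w = 0.
Proof.
have pos psi : smooth_on U psi ->
    (forall z w, S z -> T z (0, gradient F psi z) (gradient F psi z) w = 0) ->
    forall z u w, S z -> 0 < 'D_(z.2) psi z.1 -> T z (0, u) (gradient F psi z) w = 0.
  move=> spsi vert z u w Sz z0; have := gradient_vertical u w spsi Sz.
  rewrite (gradient_vertical_pos spsi vert _ Sz z0) inner0l => /eqP.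
  by rewrite eq_sym oppr_eq0 => /eqP.
move=> sphi vert z u w Sz; have Uz : U z.1 by case: Sz.
have [z0|z0|z0] := ltgtP ('D_(z.2) phi z.1) 0.
- have sN : smooth_on U (fun x => - phi x).
    move=> k; apply: (@Ck_eq _ _ _ k U (fun x => (-1) * phi x)) => //; first by move=> x _;
      rewrite mulN1r.
    by apply: Ck_mul => //; exact: Ck_cst.
  have ver z' a b : S z' -> T z' (0, - a) (- a) b = T z' (0, a) a b.
    move=> Sz'; rewrite -(scaleN1r a) (dmetric_vertZ HF (-1) a _ _ Sz') (dmetricZl HF _
      (-1) a b Sz').
    by rewrite !mulN1r opprK.
  have := pos _ sN _ z u w Sz; rewrite (gradient_opp sphi Sz) -scaleN1r (dmetricZl HF _ _ _ _ Sz).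
  move=> H; apply/eqP; rewrite -oppr_eq0 -mulN1r; apply/eqP; apply: H.
    by move=> z' w' Sz'; rewrite (gradient_opp sphi Sz') ver// vert.
  rewrite (@derive_val _ _ _ _ _ _ _ (is_derive_opp (diff_is_derive z.2 (diff_phi HF sphi Uz)))).
  by rewrite oppr_gt0.
- exact: pos.
have [W0|W0] := eqVneq (gradient F phi z) 0.
  by rewrite W0 -(scale0r (0 : E)) (dmetricZl HF _ _ _ _ Sz) mul0r.
pose zeta (r : R) : E * E := (z.1, r *: gradient F phi z + z.2).
have czeta r : {for r, continuous zeta}.
  apply: (@cvg_pair _ _ _ _ (nbhs z.1) (nbhs (r *: gradient F phi z + z.2)) _ _ _ _ _);
    first exact: cvg_cst.
  by apply: cvgD; [exact: scalel_continuous|exact: cvg_cst].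
have zeta0 : zeta 0 = z by rewrite /zeta scale0r add0r; case: z {Sz Uz z0 W0 zeta czeta}.
have pr r : 0 < r -> 0 < 'D_((zeta r).2) phi (zeta r).1.
  move=> r0; rewrite /= (diff_dirD _ _ (diff_phi HF sphi Uz)) z0 addr0.
  rewrite (diff_dirZ _ _ (diff_phi HF sphi Uz)); have <- := inner_gradient HF sphi
    (gradient F phi z) Sz.
  exact: (mulr_gt0 r0 (local_posdef HF Sz W0)).
have Sr r : 0 < r -> S (zeta r).
  move=> r0; split => //; apply/negP => /eqP e0; have := pr r r0.
  by rewrite e0 derive0 ltxx.
have -> : T z (0, u) (gradient F phi z) w =
    (fun r => T (zeta r) (0, u) (gradient F phi (zeta r)) w) 0 by rewrite /= zeta0.
apply: (right_limit_value (g := fun r => T (zeta r) (0, u) (gradient F phi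
  (zeta r)) w)) => [|r r0]; last exact: (pos _ sphi vert _ _ _ (Sr r r0) (pr r r0)).
have cT : {for z, continuous (fun z => T z (0, u) (gradient F phi z) w)}.
  apply: (Ck_continuous (k := 0) (U := S)) Sz.
  apply: (smooth_dmetric HF) => //; [exact: Ck_id|exact: Ck_cst| |exact: Ck_cst].
  exact: (smooth_gradient HF sphi).
rewrite -zeta0 in cT.
exact: (continuous_comp (czeta 0) cT).
Qed.

(** [v] enters through T (0, v) W w only: with coefficient -2 from the derivative of [W] and +1 from
    the connection. So the acceleration of a curve acts on the derivative of [W] through the Cartan
    tensor on [W] alone. *)
Lemma nab_gradient_inner phi z v w : smooth_on U phi -> S z ->
  2 * B z (nab F z v (gradient F phi z) ('D_(z.2, v) (gradient F phi) z)) w =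
  2 * 'D_(z.2) ('D_w phi) z.1 - T z (z.2, 0) (gradient F phi z) w
    + T z (gradient F phi z, 0) w z.2 - T z (w, 0) (gradient F phi z) z.2
    - T z (0, v) (gradient F phi z) w.
Proof.
move=> sphi Sz; set W := gradient F phi z.
rewrite (nab_inner HF v W _ w Sz) (inner_dgradient HF sphi (z.2, v) w Sz) /=.
rewrite (dmetric_pair HF _ v _ _ Sz) -/W.
have -> : T z (0, w) W v = T z (0, v) W w.
  by rewrite (dmetricC HF _ _ _ Sz) (dmetric_vertC HF _ _ _ Sz) (dmetricC HF _ _ _ Sz).
by move: ('D_ _ _ _) => d; ring.
Qed.

End VerticalGradient.

(** * Vertical derivatives and the nonlinear connection *)

Section VerticalDerivatives.
Context {R : realType} {n : nat}.
Local Notation E := 'rV[R]_n.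
Implicit Types (z X : E * E) (u v w V a : E).
Context {U : set E} {F : E * E -> R} (HF : local_finsler U F).
Local Notation S := (slit_over U).
Local Notation B := (finsler_inner F).
Local Notation T := (dmetric F).

Let oU : open U := local_open HF.
Let oS : open S := open_slit_over oU.

Lemma dmetric_hor_y z a w : S z -> T z (a, 0) w z.2 = 2^-1 * 'D_(a, 0) ('D_(0, w) (F2 F)) z.
Proof.
move=> Sz.
have d1 := is_derive_inner HF (is_derive_id z (a, 0)) (is_derive_cst w z (a, 0))
  (is_derive_snd (is_derive_id z (a, 0))) Sz.
have d2 := is_derive_mul (is_derive_cst (2^-1 : R) z (a, 0))
  (diff_is_derive (a, 0) (diff_dF2 HF (0, w) Sz)).
have near_eq : \near z, 2^-1 * 'D_(0, w) (F2 F) z = B z w z.2.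
  apply: filterS (open_nbhs_nbhs (conj oS Sz)) => z' Sz'.
  by rewrite (innerC HF _ _ Sz') (inner_y HF _ Sz').
have d3 := near_eq_is_derive near_eq d2.
have := @derive_val _ _ _ _ _ _ _ d3; rewrite (@derive_val _ _ _ _ _ _ _ d1) mul0r add0r => <-.
by rewrite inner0r inner0l !addr0.
Qed.

(** Only the dependence of the argument y contributes: T (a, 0) w y is half the x-derivative of
    D_(0, w) F2, and exchanging derivatives leaves the x-derivative of B(w, u). *)
Lemma is_derive_dmetric_hor_y z a u w : S z ->
  is_derive z (0, u) (fun z => T z (a, 0) w z.2) (T z (a, 0) w u).
Proof.
move=> Sz; pose g := 'D_(0, w) (F2 F).
have sg : smooth_on S g := smooth_derive (0, w) (smooth_F2 HF).
have dag : differentiable ('D_(a, 0) g) z.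
  exact: (smooth_differentiable fin_dim_E2 fin_dim_R oS (smooth_derive (a, 0) sg) Sz).
have d2 := is_derive_mul (is_derive_cst (2^-1 : R) z (0, u)) (diff_is_derive (0, u) dag).
have near_eq : \near z, 2^-1 * 'D_(a, 0) g z = T z (a, 0) w z.2.
  by apply: filterS (open_nbhs_nbhs (conj oS Sz)) => z' Sz'; rewrite (dmetric_hor_y _ _ Sz').
apply: is_derive_eq (near_eq_is_derive near_eq d2) _; rewrite mul0r add0r.
rewrite (derive_swap (0, u) (a, 0) fin_dim_R oS (sg 2%N) Sz).
have dug : differentiable ('D_(0, u) g) z.
  exact: (smooth_differentiable fin_dim_E2 fin_dim_R oS (smooth_derive (0, u) sg) Sz).
have d4 := is_derive_mul (is_derive_cst (2^-1 : R) z (a, 0)) (diff_is_derive (a, 0) dug).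
have near_eq4 : \near z, 2^-1 * 'D_(0, u) g z = B z w u.
  by apply: filterS (open_nbhs_nbhs (conj oS Sz)) => z' Sz'; rewrite (inner_hess HF _ _ Sz').
have := @derive_val _ _ _ _ _ _ _ (near_eq_is_derive near_eq4 d4).
by rewrite dmetric.unlock mul0r add0r => ->.
Qed.

Lemma dmetric_hor_sum z a u w : S z ->
  T z (a, 0) u w = \sum_i a 0 i * T z (delta_mx 0 i, 0) u w.
Proof.
move=> Sz; have := diff_inner HF u w Sz => dB.
by rewrite dmetric.unlock horizontal_sum (derive_dir_sumV _ _ dB).
Qed.

Lemma nonlinear_vecE z V : S z ->
  nonlinear_vec F z V = 'D_(0, V) (fun z => \row_i spray F i z) z.
Proof.
move=> Sz; have ds : differentiable (fun z => \row_i spray F i z) z.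
  exact: (smooth_differentiable fin_dim_E2 (fin_dim_rV n) oS (smooth_spray HF) Sz).
rewrite vertical_sum (derive_dir_sumV _ _ ds); apply/rowP => j.
rewrite mxE summxE; apply: eq_bigr => i _; rewrite mxE [RHS]mulrC; congr (_ * _).
have := is_derive_coord j (diff_is_derive (0, basis_vec i) ds).
rewrite (_ : (fun _ => _) = spray F j); last by apply/funext => z'; rewrite mxE.
by move=> d; rewrite /nonlinear /dy (@derive_val _ _ _ _ _ _ _ d).
Qed.

(** Vertical derivative of [inner_spray], as [nonlinear_vec] is the vertical derivative of the
    spray. The variation of the metric leaves a Cartan term with the spray, which will vanish for V
    = W. *)
Lemma nonlinear_inner z V w : S z ->
  2 * B z (nonlinear_vec F z V) w + 2 * T z (0, V) (\row_i spray F i z) w =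
  T z (V, 0) w z.2 + T z (z.2, 0) w V - T z (w, 0) V z.2.
Proof.
move=> Sz; pose spr z := \row_i spray F i z.
have ds : differentiable spr z.
  exact: (smooth_differentiable fin_dim_E2 (fin_dim_rV n) oS (smooth_spray HF) Sz).
have d1 := is_derive_mul (is_derive_cst (4 : R) z (0, V))
  (is_derive_inner HF (is_derive_id z (0, V)) (diff_is_derive (0, V) ds) (is_derive_cst w z
    (0, V)) Sz).
have dsum := is_derive_sumE (fun i : 'I_n => is_derive_mul
  (is_derive_coord i (is_derive_snd (is_derive_id z (0, V))))
  (is_derive_mul (is_derive_cst (2 : R) z (0, V)) (is_derive_dmetric_hor_y (delta_mx 0 i) V w Sz))).
have dF : differentiable ('D_(w, 0) (F2 F)) z by exact: (diff_dF2 HF (w, 0) Sz).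
have d2 := is_derive_add dsum (is_derive_opp (diff_is_derive (0, V) dF)).
have near_eq : \forall z' \near z, (\sum_i (z' : E * E).2 0 i * (2 * T z' (delta_mx 0 i, 0) w z'.2)
    - 'D_(w, 0) (F2 F) z') = 4 * B z' (spr z') w.
  apply: filterS (open_nbhs_nbhs (conj oS Sz)) => z' Sz'; rewrite (inner_spray HF _ Sz').
  congr (_ - _); apply: eq_bigr => i _; congr (_ * _).
  rewrite (dmetric_hor_y _ _ Sz') mulrA divff ?pnatr_eq0// mul1r.
  exact: (derive_swap (delta_mx 0 i, 0) (0, w) fin_dim_R oS (smooth_F2 HF 2%N) Sz').
have := @derive_val _ _ _ _ _ _ _ (near_eq_is_derive near_eq d2).
rewrite (@derive_val _ _ _ _ _ _ _ d1) mul0r add0r inner0r addr0 -(nonlinear_vecE V Sz) => E1.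
have swp : 'D_(0, V) ('D_(w, 0) (F2 F)) z = 2 * T z (w, 0) V z.2.
  rewrite (dmetric_hor_y _ _ Sz) mulrA divff ?pnatr_eq0// mul1r.
  exact: (derive_swap (0, V) (w, 0) fin_dim_R oS (smooth_F2 HF 2%N) Sz).
apply: (@mulfI _ (2 : R)); first by rewrite pnatr_eq0.
have -> : 2 * (2 * B z (nonlinear_vec F z V) w + 2 * T z (0, V) (\row_i spray F i z) w) =
   4 * (T z (0, V) (spr z) w + B z (nonlinear_vec F z V) w) by rewrite /spr; ring.
rewrite E1 swp (dmetric_hor_sum V _ _ Sz) (dmetric_hor_sum z.2 _ _ Sz) -big_split /=.
rewrite !mulrDr mulrN; congr (_ - _); rewrite mulr_sumr; apply: eq_bigr => i _.
by ring.
Qed.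

End VerticalDerivatives.

(** * From the circle condition to the Schwarzian equation *)

Section MobiusTensor.
Context {R : realType} {n : nat}.
Local Notation E := 'rV[R]_n.
Implicit Types (z : E * E) (u v w V a : E).
Context {U : set E} {F : E * E -> R} (HF : local_finsler U F).
Context {phi : E -> R} (sphi : smooth_on U phi).
Local Notation S := (slit_over U).
Local Notation B := (finsler_inner F).
Local Notation T := (dmetric F).
Local Notation W := (gradient F phi).

Hypothesis C0 : forall z u w, S z -> T z (0, u) (W z) w = 0.
(** The circle condition tested against w: by [nab_gradient_inner] and [C0] the acceleration has
    dropped out. The multiplier is chosen point by point, so its differentiability has to be proved
    ([dlam_vert]). *)
Hypothesis Q0 : forall z, S z -> exists lam : R, forall w,
  2 * 'D_(z.2) ('D_w phi) z.1 - T z (z.2, 0) (W z) w + T z (W z, 0) w z.2 - T z (w, 0) (W z) z.2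
  = 2 * 'D_(z.2) phi z.1 * 'D_w phi z.1 + 2 * lam * B z z.2 w.

Let oU : open U := local_open HF.
Let oS : open S := open_slit_over oU.
Let sW : smooth_on S W := smooth_gradient HF sphi.
Let fE := fin_dim_rV (R := R) n.

Let dW_vert z u : S z -> 'D_(0, u) W z = 0.
Proof.
move=> Sz; apply: (inner_inj HF Sz) => w.
by rewrite (gradient_vertical HF _ _ sphi Sz) (C0 _ _ Sz) oppr0 inner0l.
Qed.

Let hess_sym x u w : U x -> 'D_u ('D_w phi) x = 'D_w ('D_u phi) x.
Proof. by move=> Ux; exact: (derive_swap u w fin_dim_R oU (sphi 2%N) Ux). Qed.

Let hessE z u w : S z ->
  'D_u ('D_w phi) z.1 = B z ('D_(u, 0) W z) w + T z (u, 0) (W z) w.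
Proof. by move=> Sz; rewrite (inner_dgradient HF sphi (u, 0) w Sz) subrK. Qed.

Let D z u := 'D_(u, 0) W z.
(** Twice the Hessian of [phi] for the metric with y frozen, written as the Lie derivative of that
    metric along [W]; [KE] compares the two forms. For [u = z.2] it is the left side of [Q0]. *)
Let K z u w := B z (D z u) w + B z (D z w) u + T z (W z, 0) w u.

Let KE z u w : S z ->
  2 * 'D_u ('D_w phi) z.1 - T z (u, 0) (W z) w - T z (w, 0) (W z) u + T z (W z, 0) w u = K z u w.
Proof.
move=> Sz; have Uz : U z.1 by case: Sz.
rewrite /K; have h1 := hessE u w Sz; have h2 := hessE w u Sz.
rewrite (hess_sym w u Uz) in h2; rewrite /D mulr_natl mulr2n {1}h1 h2.
by ring.
Qed.

Let differentiable_D z u : S z -> differentiable (fun z => D z u) z.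
Proof. exact: (smooth_differentiable fin_dim_E2 fE oS (smooth_derive (u, 0) sW)). Qed.

(** The vertical derivatives of [W] vanish, hence so do those of its x-derivatives, by exchanging
    derivatives. *)
Let dD_vert z u v : S z -> is_derive z (0, v) (fun z => D z u) 0.
Proof.
move=> Sz; apply: is_derive_eq (diff_is_derive (0, v) (differentiable_D u Sz)) _.
rewrite (derive_swap (0, v) (u, 0) fE oS (sW 2%N) Sz).
have near0 : \near z, cst (0 : E) z = 'D_(0, v) W z.
  by apply: filterS (open_nbhs_nbhs (conj oS Sz)) => z' Sz'; rewrite (dW_vert _ Sz').
exact: (@derive_val _ _ _ _ _ _ _ (near_eq_is_derive near0 (is_derive_cst (0 : E) z (u, 0)))).
Qed.

Let D_sum z u : S z -> D z u = \sum_i u 0 i *: D z (delta_mx 0 i).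
Proof.
move=> Sz; have dW := diff_gradient HF sphi Sz; rewrite /D.
by rewrite horizontal_sum (derive_dir_sumV _ _ dW).
Qed.

Let dDy_vert z v : S z -> is_derive z (0, v) (fun z => D z z.2) (D z v).
Proof.
move=> Sz.
have dsum := is_derive_sumE (fun i : 'I_n => is_derive_scale
  (is_derive_coord i (is_derive_snd (is_derive_id z (0, v)))) (dD_vert (delta_mx 0 i) v Sz)).
have near_eq : \forall z' \near z,
    \sum_i (z' : E * E).2 0 i *: D z' (delta_mx 0 i) = D z' z'.2.
  by apply: filterS (open_nbhs_nbhs (conj oS Sz)) => z' Sz'; rewrite [RHS](D_sum _ Sz').
apply: is_derive_eq (near_eq_is_derive near_eq dsum) _; rewrite (D_sum v Sz).
by apply: eq_bigr => i _; rewrite scaler0 addr0.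
Qed.

Let dTW_vert z v w : S z ->
  is_derive z (0, v) (fun z => T z (W z, 0) w z.2) (T z (W z, 0) w v).
Proof.
move=> Sz.
have dWi i : is_derive z (0, v) (fun z => W z 0 i) 0.
  have := is_derive_coord i (diff_is_derive (0, v) (diff_gradient HF sphi Sz)).
  by rewrite (dW_vert v Sz) mxE.
have dsum := is_derive_sumE (fun i : 'I_n => is_derive_mul (dWi i)
  (is_derive_dmetric_hor_y HF (delta_mx 0 i) v w Sz)).
have near_eq : \forall z' \near z,
    \sum_i W z' 0 i * T z' (delta_mx 0 i, 0) w z'.2 = T z' (W z', 0) w z'.2.
  by apply: filterS (open_nbhs_nbhs (conj oS Sz)) => z' Sz';
    rewrite [RHS](dmetric_hor_sum HF _ _ _ Sz').
apply: is_derive_eq (near_eq_is_derive near_eq dsum) _; rewrite (dmetric_hor_sum HF (W z) _ _ Sz).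
by apply: eq_bigr => i _; rewrite mul0r add0r.
Qed.

Let dK_vert z u w : S z ->
  is_derive z (0, u) (fun z => K z z.2 w) (T z (0, u) (D z z.2) w + K z u w).
Proof.
move=> Sz.
have d1 : is_derive z (0, u) (fun z => B z (D z z.2) w) (T z (0, u) (D z z.2) w + B z (D z u) w).
  apply: is_derive_eq (is_derive_inner HF (is_derive_id z (0, u)) (dDy_vert u Sz)
    (is_derive_cst w z (0, u)) Sz) _.
  exact: etrans (congr1 (fun r => T z (0, u) (D z z.2) w + B z (D z u) w + r) (inner0r F z
    (D z z.2))) (addr0 _).
have d2 : is_derive z (0, u) (fun z => B z (D z w) z.2) (B z (D z w) u).
  apply: is_derive_eq (is_derive_inner HF (is_derive_id z (0, u)) (dD_vert w u Sz)
    (is_derive_snd (is_derive_id z (0, u))) Sz) _.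
  have e1 : T z (0, u) (D z w) z.2 = 0 by exact: (dmetric_yr HF _ _ Sz).
  have e2 : B z 0 z.2 = 0 by exact: inner0l.
  by rewrite [X in X + _ + _]e1 [X in _ + X + _]e2 addr0 add0r.
apply: is_derive_eq (is_derive_add (is_derive_add d1 d2) (dTW_vert u w Sz)) _.
by rewrite /K -!addrA.
Qed.

Let dphi_vert z u : S z -> is_derive z (0, u) (fun z => 'D_(z.2) phi z.1) ('D_u phi z.1).
Proof.
move=> Sz; have Uz : U z.1 by case: Sz.
have dpi i : is_derive z (0, u) (fun z => 'D_(delta_mx 0 i) phi z.1) 0.
  have dd : differentiable ('D_(delta_mx 0 i) phi) z.1.
    exact: (smooth_differentiable fE fin_dim_R oU (smooth_derive (delta_mx 0 i) sphi) Uz).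
  have := is_derive_comp_diff (is_derive_fst (is_derive_id z (0, u))) dd.
  by rewrite derive0.
have dsum := is_derive_sumE (fun i : 'I_n => is_derive_mul
  (is_derive_coord i (is_derive_snd (is_derive_id z (0, u)))) (dpi i)).
have expand z' v : S z' -> 'D_v phi z'.1 = \sum_i v 0 i * 'D_(delta_mx 0 i) phi z'.1.
  move=> [Uz' _]; rewrite [in LHS](row_sum_delta v) derive_dir_sumV//.
  exact: (diff_phi HF sphi Uz').
have near_eq : \forall z' \near z,
    \sum_i (z' : E * E).2 0 i * 'D_(delta_mx 0 i) phi z'.1 = 'D_(z'.2) phi z'.1.
  by apply: filterS (open_nbhs_nbhs (conj oS Sz)) => z' Sz'; rewrite (expand _ z'.2 Sz').
apply: is_derive_eq (near_eq_is_derive near_eq dsum) _; rewrite (expand _ u Sz).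
by apply: eq_bigr => i _; rewrite mulr0 addr0.
Qed.

Let lamP : exists lam : E * E -> R, forall z w, S z ->
  K z z.2 w = 2 * 'D_(z.2) phi z.1 * 'D_w phi z.1 + 2 * lam z * B z z.2 w.
Proof.
have /choice[lam lamE] : forall z, exists lam, S z -> forall w,
    K z z.2 w = 2 * 'D_(z.2) phi z.1 * 'D_w phi z.1 + 2 * lam * B z z.2 w.
  move=> z; have [Sz|nSz] := pselect (S z); last by exists 0.
  have [l lE] := Q0 Sz; exists l => _ w; rewrite -lE -(KE _ _ Sz).
  by rewrite addrAC.
by exists lam => z w Sz; exact: lamE.
Qed.

Let lam := projT1 (cid lamP).
Let lamE z w : S z ->
  K z z.2 w = 2 * 'D_(z.2) phi z.1 * 'D_w phi z.1 + 2 * lam z * B z z.2 w.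
Proof. by move=> Sz; exact: (projT2 (cid lamP)). Qed.

(** With the test vector frozen at the value of y, [lamE] expresses [lam] near [z] as a quotient of
    vertically differentiable functions with non-zero denominator. *)
Let dlam_vert z u : S z -> exists dl, is_derive z (0, u) lam dl.
Proof.
move=> Sz; pose y := z.2; have y0 : y != 0 by case: Sz.
have dB := is_derive_inner HF (is_derive_id z (0, u)) (is_derive_snd (is_derive_id z (0, u)))
  (is_derive_cst y z (0, u)) Sz.
have Bz : B z z.2 y != 0 by rewrite gt_eqF//; exact: (local_posdef HF Sz y0).
have dp := is_derive_mul (is_derive_mul (is_derive_cst (2 : R) z (0, u)) (dphi_vert u Sz))
  (is_derive_comp_diff (is_derive_fst (is_derive_id z (0, u)))
    (smooth_differentiable fE fin_dim_R oU (smooth_derive y sphi) Sz.1)).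
have dN := is_derive_add (dK_vert u y Sz) (is_derive_opp dp).
have dV := is_derive_comp_diff dB (differentiable_Rinv Bz).
have dlam := is_derive_mul (is_derive_mul (is_derive_cst (2^-1 : R) z (0, u)) dN) dV.
have cB : {for z, continuous (fun z : E * E => B z z.2 y)}.
  apply: (Ck_continuous (k := 0) (U := S)) Sz.
  by apply: (smooth_inner HF) => //; [exact: Ck_id|apply: Ck_snd => //; exact: Ck_id|exact: Ck_cst].
have nB : \forall z' \near z, B z' z'.2 y != 0.
  have Bpos : \forall z' \near z, 0 < B z' z'.2 y.
    by apply: (cB [set r | 0 < r]); exact: (lt_nbhsr (local_posdef HF Sz y0)).
  by apply: filterS Bpos => z' Bz'; rewrite gt_eqF.
have near_eq : \forall z' \near z,
    2^-1 * (K z' z'.2 y - 2 * 'D_(z'.2) phi z'.1 * 'D_y phi z'.1) * (B z' z'.2 y)^-1 = lam z'.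
  apply: (@filterS2 _ _ _ _ _ _ _ nB (open_nbhs_nbhs (conj oS Sz))) => z' Bz' Sz'.
  by rewrite (lamE y Sz'); move: ('D_(z'.2) phi z'.1) ('D_y phi z'.1) => p q; field.
by eexists; exact: (near_eq_is_derive near_eq dlam).
Qed.

Let vertical_identity z u : S z -> exists dl, forall w,
  T z (0, u) (D z z.2) w + K z u w = 2 * 'D_u phi z.1 * 'D_w phi z.1
    + 2 * dl * B z z.2 w + 2 * lam z * B z u w.
Proof.
move=> Sz; have Uz : U z.1 by case: Sz.
have [dl dlE] := dlam_vert u Sz; exists dl => w.
have d1 : is_derive z (0, u) (fun z : E * E => B z z.2 w) (B z u w).
  apply: is_derive_eq (is_derive_inner HF (is_derive_id z (0, u)) (is_derive_snd
    (is_derive_id z (0, u)))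
    (is_derive_cst w z (0, u)) Sz) _.
  have e1 : T z (0, u) z.2 w = 0 by exact: (dmetric_yl HF _ _ Sz).
  have e2 : B z z.2 0 = 0 by exact: inner0r.
  by rewrite [X in X + _ + _]e1 [X in _ + _ + X]e2 addr0 add0r.
have d2 : is_derive z (0, u) (fun z => 'D_w phi z.1) 0.
  have dd : differentiable ('D_w phi) z.1.
    exact: (smooth_differentiable fE fin_dim_R oU (smooth_derive w sphi) Uz).
  have := is_derive_comp_diff (is_derive_fst (is_derive_id z (0, u))) dd.
  by rewrite derive0.
have d3 := is_derive_add
  (is_derive_mul (is_derive_mul (is_derive_cst (2 : R) z (0, u)) (dphi_vert u Sz)) d2)
  (is_derive_mul (is_derive_mul (is_derive_cst (2 : R) z (0, u)) dlE) d1).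
have near_eq : \forall z' \near z,
    2 * 'D_((z' : E * E).2) phi z'.1 * 'D_w phi z'.1 + 2 * lam z' * B z' z'.2 w = K z' z'.2 w.
  by apply: filterS (open_nbhs_nbhs (conj oS Sz)) => z' Sz'; rewrite (lamE w Sz').
have := @derive_val _ _ _ _ _ _ _ (near_eq_is_derive near_eq d3).
rewrite (@derive_val _ _ _ _ _ _ _ (dK_vert u w Sz)) => ->.
move: ('D_u phi z.1) ('D_w phi z.1) ('D_(z.2) phi z.1) => p q r.
have -> : cst (2 : R) z = 2 by [].
by ring.
Qed.

(* Vertical derivative of Q0; lam has none, as the case w = y shows. *)
Lemma mobius_symmetric z : S z -> exists l, forall u w,
  T z (0, u) ('D_(z.2, 0) W z) w + (B z ('D_(u, 0) W z) w + B z ('D_(w, 0) W z) u + T z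
    (W z, 0) w u)
  = 2 * 'D_u phi z.1 * 'D_w phi z.1 + 2 * l * B z u w.
Proof.
move=> Sz; exists (lam z) => u w; have y0 : z.2 != 0 by case: Sz.
have Byy := local_posdef HF Sz y0; have Byy0 : B z z.2 z.2 != 0 by rewrite gt_eqF.
have [du duE] := vertical_identity u Sz.
have du0 : du = 0.
  have := duE z.2; have := lamE u Sz.
  have -> : T z (0, u) (D z z.2) z.2 = 0 by exact: (dmetric_yr HF _ _ Sz).
  have -> : K z u z.2 = K z z.2 u.
    by rewrite /K (dmetricC HF (W z, 0) z.2 u Sz) [X in X + _ = _]addrC.
  rewrite (innerC HF u z.2 Sz); move: ('D_u phi z.1) ('D_(z.2) phi z.1) => p q -> H.
  by apply: (mulIf Byy0); lra.
by have := duE w; rewrite du0 /K; move: ('D_u phi z.1) ('D_w phi z.1) => p q ->; ring.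
Qed.

(** Two terms separate [mobius_symmetric] from the Koszul formula: the Cartan tensor on D_y W, and
    the one on N(W) with N the nonlinear connection. They add up to the Cartan tensor on D_y W +
    N(W), a combination of [W] and y, on both of which it vanishes. *)
Lemma schwarzian_tensor z : S z -> exists l, forall u v w,
  2 * 'D_u ('D_w phi) z.1 - 2 * T z (u, v) (W z) w
    + 2 * B z (connection_form F z (u, v) (W z)) w
  = 2 * 'D_u phi z.1 * 'D_w phi z.1 + 2 * l * B z u w.
Proof.
move=> Sz; have Uz : U z.1 by case: Sz.
have [l lE] := mobius_symmetric Sz; exists l => u v w; set N := nonlinear_vec F z.
have C0' a b : T z (0, a) (W z) b = 0 := C0 a b Sz.
have C0r a b : T z (0, a) b (W z) = 0 by rewrite (dmetricC HF _ _ _ Sz).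
have C0v a b : T z (0, W z) a b = 0 by rewrite (dmetric_vertC HF _ _ _ Sz) C0'.
have neg a b c : T z (0, - a) b c = - T z (0, a) b c.
  by rewrite -scaleN1r (dmetric_vertZ HF _ _ _ _ Sz) mulN1r.
have horiz (a b c d : E) : T z (a, b) c d = T z (a, 0) c d + T z (0, b) c d.
  exact: (dmetric_pair HF _ _ _ _ Sz).
(* Compares [nonlinear_inner] at [W] with the case u = y of [mobius_symmetric]. *)
have NW : D z z.2 + N (W z) = 'D_(z.2) phi z.1 *: W z + l *: z.2.
  apply: (inner_inj2 HF Sz) => b.
  have h1 := nonlinear_inner HF (W z) b Sz; rewrite C0v mulr0 addr0 in h1.
  have h2 := KE z.2 b Sz; have h3 := lE z.2 b; rewrite (dmetric_vy HF _ _ Sz) add0r in h3.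
  have h4 := hessE z.2 b Sz; have h5 := inner_gradient HF sphi b Sz.
  rewrite /K /D h3 h4 in h2.
  rewrite !innerDl !innerZl h5 mulrDr h1 /D.
  rewrite (dmetricC HF (b, 0) (W z) z.2 Sz) (dmetricC HF (z.2, 0) b (W z) Sz) in h2 *.
  move: h2; move: ('D_(z.2) phi z.1) ('D_b phi z.1) => p q h2.
  by lra.
have CW : T z (0, u) (D z z.2) w + T z (0, N (W z)) w u = 0.
  have -> : T z (0, u) (D z z.2) w = T z (0, D z z.2) w u.
    by rewrite (dmetric_vertC HF _ _ _ Sz) (dmetricC HF _ _ _ Sz).
  rewrite -(dmetric_vertD HF _ _ _ _ Sz) NW (dmetric_vertD HF _ _ _ _ Sz).
  by rewrite !(dmetric_vertZ HF _ _ _ _ Sz) C0v (dmetric_vy HF _ _ Sz) !mulr0 addr0.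
rewrite (connection_inner HF _ _ _ Sz) /= -/N.
rewrite (horiz (W z)) (horiz u (- N u)) (horiz w) (horiz u v) !neg !C0'.
have := lE u w; rewrite -/(D z z.2) -/(D z u) -/(D z w) -/(K z u w).
rewrite -(KE u w Sz); move: CW; rewrite -/(W z).
move: ('D_u ('D_w phi) z.1) ('D_u phi z.1) ('D_w phi z.1) => r p q CW h.
by lra.
Qed.

(** Metric compatibility of the connection in any direction. The Laplacian pairs the connection on
    basis vectors with [W]; this moves the connection onto [W]. *)
Lemma connection_gradient z u v V : S z ->
  2 * B z (connection_form F z (u, v) V) (W z) =
  2 * T z (u, v) (W z) V - 2 * B z (connection_form F z (u, v) (W z)) V.
Proof.
move=> Sz; set N := nonlinear_vec F z.
have C0' a b : T z (0, a) (W z) b = 0 := C0 a b Sz.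
have C0r a b : T z (0, a) b (W z) = 0 by rewrite (dmetricC HF _ _ _ Sz).
have C0v a b : T z (0, W z) a b = 0 by rewrite (dmetric_vertC HF _ _ _ Sz) C0'.
have neg a b c : T z (0, - a) b c = - T z (0, a) b c.
  by rewrite -scaleN1r (dmetric_vertZ HF _ _ _ _ Sz) mulN1r.
have horiz (a b c d : E) : T z (a, b) c d = T z (a, 0) c d + T z (0, b) c d.
  exact: (dmetric_pair HF _ _ _ _ Sz).
rewrite !(connection_inner HF _ _ _ Sz) /= -/N.
rewrite (horiz (W z)) (horiz u (- N u) V (W z)) (horiz u (- N u) (W z) V) (horiz V) (horiz u v).
by rewrite !neg !C0' !C0r !C0v (dmetricC HF (u, 0) V (W z) Sz); ring.
Qed.

(** Adding the horizontal and the vertical Laplacian means deriving along delta_j + d/dy^j, which in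
    coordinates (x, y) is the direction (e_j, e_j - N e_j). *)
Lemma Gamma_Cartan_sum z i j : S z ->
  \sum_k (Gamma F k i j z + Cartan F k i j z) * partial k phi z.1 =
  B z (connection_form F z (basis_vec j, basis_vec j - nonlinear_vec F z (basis_vec j))
    (basis_vec i)) (W z).
Proof.
move=> Sz; rewrite (innerC HF _ _ Sz) (inner_gradient HF sphi _ Sz).
rewrite (partial_sum HF sphi); last by case: Sz.
apply: eq_bigr => k _; rewrite mulrC; congr (_ * _); rewrite mxE.
rewrite [RHS](bigD1 i)//= [X in _ = _ + X]big1 ?addr0; last first.
  move=> j' /negPf ij; rewrite big1// => k' _; rewrite !mxE eqxx ij /=; ring.
rewrite [RHS](bigD1 j)//= [X in _ = _ + X]big1 ?addr0; last first.
  move=> k' /negPf jk; rewrite !mxE !eqxx jk /=.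
  by rewrite mulr0 add0r sub0r addNr mulr0.
by rewrite !mxE !eqxx /= subrK !mulr1.
Qed.

Lemma schwarzian_eq0 (X : E * E -> E * E) z : S z -> schwarzian F phi X z = 0.
Proof.
move=> Sz; have Uz : U z.1 by case: Sz.
have [l lE] := schwarzian_tensor Sz.
have e2 : (2 : R) != 0 by rewrite pnatr_eq0.
have lap i j : partial i (partial j phi) z.1
      - \sum_k (Gamma F k i j z + Cartan F k i j z) * partial k phi z.1 =
    partial i phi z.1 * partial j phi z.1 + l * metric F z i j.
  rewrite (Gamma_Cartan_sum _ _ Sz); apply: (mulfI e2).
  set v := basis_vec j - _.
  have h1 := lE (basis_vec j) v (basis_vec i); have h2 := connection_gradient (basis_vec j) v
    (basis_vec i) Sz.
  rewrite /partial -inner_basis (hess_sym (basis_vec i) (basis_vec j) Uz).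
  rewrite (innerC HF (basis_vec i) (basis_vec j) Sz).
  rewrite mulrBr h2; move: h1.
  move: ('D_(basis_vec j) ('D_(basis_vec i) phi) z.1) => r.
  move: ('D_(basis_vec j) phi z.1) ('D_(basis_vec i) phi z.1) => p q h1.
  by lra.
(* A non-zero vector in the fibre forces n > 0. *)
have n0 : (n%:R : R) != 0.
  rewrite pnatr_eq0; apply/eqP => n0; have [_ /negP] := Sz; apply.
  by apply/eqP/rowP => i; have := ltn_ord i; rewrite {2}n0.
(* The trace of [lap] against the inverse metric: the products of derivatives of [phi] give the
   squared norm of the gradient, and the multiplier appears n times. *)
have lamE' : n%:R^-1 * (laplacian F phi z - gradient_norm2 F phi z) = l.
  have tr : \sum_i \sum_j metric_inv F z i j * metric F z i j = n%:R.
    have -> : n%:R = \tr (1%:M : 'M[R]_n) by rewrite mxtrace1.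
    rewrite -(mulVmx (metric_unit HF Sz)) -[X in _ *m X](finsler_metric_sym HF Sz);
      apply: eq_bigr => i _.
    rewrite [RHS]mxE; apply: eq_bigr => j _; congr (_ * _); rewrite [RHS]mxE; reflexivity.
  apply: (mulfI n0); rewrite mulrA divff// mul1r -tr mulrC mulr_sumr /laplacian /gradient_norm2
    -sumrB.
  apply: eq_bigr => i _; rewrite mulr_sumr -sumrB; apply: eq_bigr => j _.
  by rewrite lap; ring.
rewrite /schwarzian lamE' /cartan_nabla; apply: (inner_inj HF Sz) => w; apply: (mulfI e2).
have := lE (X z).1 (X z).2 w; rewrite -surjective_pairing => h1.
have h2 := inner_dgradient HF sphi (X z) w Sz.
have h3 := inner_gradient HF sphi w Sz; have h4 := inner_gradient HF sphi (X z).1 Sz.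
rewrite !innerDl !innerNl !innerZl inner0l h2 h3 h4.
by move: h1; move: ('D_(X z).1 ('D_w phi) z.1) ('D_(X z).1 phi z.1) ('D_w phi z.1) => r p q h1; lra.
Qed.

End MobiusTensor.

(** * Existence of geodesic circles *)

Section FrenetEquations.
Context {R : realType} {n : nat}.
Local Notation E := 'rV[R]_n.
Context {U : set E} {F : E * E -> R} (HF : local_finsler U F).
Local Notation S := (slit_over U).
Local Notation B := (finsler_inner F).

Let oU : open U := local_open HF.
Let oS : open S := open_slit_over oU.
Local Notation P := 'rV[R]_(n + (n + n)).

(** Position, velocity and acceleration in one row vector, the form in which [ode_exists] takes its
    unknown. *)
Definition triple (x y A : E) : P := row_mx x (row_mx y A).
Let px (p : P) : E := \row_j p 0 (lshift _ j).
Let py (p : P) : E := \row_j p 0 (rshift n (lshift n j)).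
Let pA (p : P) : E := \row_j p 0 (rshift n (rshift n j)).

Let px_triple x y A : px (triple x y A) = x.
Proof. by apply/rowP => j; rewrite mxE row_mxEl. Qed.
Let py_triple x y A : py (triple x y A) = y.
Proof. by apply/rowP => j; rewrite mxE row_mxEr row_mxEl. Qed.
Let pA_triple x y A : pA (triple x y A) = A.
Proof. by apply/rowP => j; rewrite mxE !row_mxEr. Qed.

Let Ck_proj k (D : set P) (f : 'I_n -> 'I_(n + (n + n))) : open D ->
  Ck k D (fun p : P => \row_j p 0 (f j)).
Proof. by move=> oD; apply: Ck_row => // j; apply: Ck_coord => //; exact: Ck_id. Qed.

Let Ck_triple k (D : set P) (f g h : P -> E) : open D -> Ck k D f -> Ck k D g -> Ck k D h ->
  Ck k D (fun p => triple (f p) (g p) (h p)).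
Proof.
move=> oD Cf Cg Ch.
rewrite (_ : (fun p => _) = fun p => \row_i triple (f p) (g p) (h p) 0 i); last first.
  by apply/funext => p; apply/rowP => i; rewrite mxE.
apply: Ck_row => // i; rewrite -(splitK i); case: (fintype.split i) => /= [j|j].
  by rewrite (_ : (fun p => _) = fun p => f p 0 j); [exact: Ck_coord|apply/funext => p;
    rewrite row_mxEl].
rewrite -(splitK j); case: (fintype.split j) => /= [l|l].
  by rewrite (_ : (fun p => _) = fun p => g p 0 l); [exact: Ck_coord|apply/funext => p;
    rewrite row_mxEr row_mxEl].
by rewrite (_ : (fun p => _) = fun p => h p 0 l); [exact: Ck_coord|apply/funext => p;
  rewrite !row_mxEr].
Qed.

(** The second derivative of a curve with velocity [z.2] and covariant acceleration [A], by
    [nab_velocity]. *)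
Definition frenet_velocity (z : E * E) (A : E) : E := A - nab F z 0 z.2 0.
(** The derivative of [A] for which its covariant derivative is - (B(A, A) / B(y, y)) y. For unit y
    this is the circle equation; with the quotient, B(A, y) is constant along solutions before the
    speed is known to be 1. *)
Definition frenet_normal (z : E * E) (A : E) : E :=
  - nab F z (frenet_velocity z A) A 0 - (B z A A / B z z.2 z.2) *: z.2.

Lemma frenet_solution x0 y0 A0 : S (x0, y0) -> exists (T : R) (x y A : R -> E),
  [/\ 0 < T, [/\ x 0 = x0, y 0 = y0 & A 0 = A0], smooth_on [set t | `|t| < T] x &
    forall t, `|t| < T -> [/\ S (x t, y t), is_derive t (1 : R) x (y t),
      is_derive t (1 : R) y (frenet_velocity (x t, y t) (A t)) &
      is_derive t (1 : R) A (frenet_normal (x t, y t) (A t))]].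
Proof.
move=> S0; pose D := [set p | S (px p, py p)].
pose v p := triple (py p) (frenet_velocity (px p, py p) (pA p)) (frenet_normal (px p, py p) (pA p)).
have oT : open [set: P] by exact: openT.
have oD : open D.
  rewrite openE => p Dp; have cz : {for p, continuous (fun p => (px p, py p))}.
    by apply: (Ck_continuous (k := 0) (U := setT)) => //; apply: Ck_pair => //; exact: Ck_proj.
  exact: (cz S (open_nbhs_nbhs (conj oS Dp))).
have sv : smooth_on D v.
  move=> k; have Cx : Ck k D px by exact: Ck_proj.
  have Cy : Ck k D py by exact: Ck_proj.
  have CA : Ck k D pA by exact: Ck_proj.
  have Cz : Ck k D (fun p => (px p, py p)) by exact: Ck_pair.
  have C0 : Ck k D (fun=> 0 : E) by exact: Ck_cst.
  have Cneg (f : P -> E) : Ck k D f -> Ck k D (fun p => - f p).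
    move=> Cf; apply: (@Ck_eq _ _ _ k D (fun p => (-1) *: f p)) => //; first by move=> p _;
      rewrite scaleN1r.
    by apply: Ck_scale => //; exact: Ck_cst.
  have CV : Ck k D (fun p => frenet_velocity (px p, py p) (pA p)).
    by apply: Ck_add => //; apply: Cneg; apply: (smooth_nab HF oD).
  apply: Ck_triple => //; apply: Ck_add => //.
    by apply: Cneg; apply: (smooth_nab HF oD).
  apply: Cneg; apply: Ck_scale => //; apply: Ck_mul => //; first exact: (smooth_inner HF oD).
  apply: Ck_inv => //; last exact: (smooth_inner HF oD).
  by move=> p [Ux y0N]; rewrite /= gt_eqF//; apply: (local_posdef HF).
have D0 : D (triple x0 y0 A0) by rewrite /D /= px_triple py_triple.
have [T [u [T0 u0 uP]]] := ode_exists oD (sv 1%N) D0.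
exists T, (px \o u), (py \o u), (pA \o u); split=> //.
- by split; rewrite /= u0 ?px_triple ?py_triple ?pA_triple.
- have oJ : open [set t : R | `|t| < T].
    rewrite (_ : [set _ | _] = ball (0 : R) T); first exact: ball_open.
    by apply/seteqP; split => t; rewrite /ball /= sub0r normrN.
  have su := ode_smooth (fin_dim_rV _) oD oJ sv uP.
  by move=> k; apply: Ck_row => // j; apply: Ck_coord.
move=> t /uP[Dt du]; split=> //.
- have := is_derive_row (fun j => is_derive_coord (lshift _ j) du).
  by rewrite -[X in is_derive _ _ _ X -> _]/(px (v (u t))) px_triple.
- have := is_derive_row (fun j => is_derive_coord (rshift n (lshift n j)) du).
  by rewrite -[X in is_derive _ _ _ X -> _]/(py (v (u t))) py_triple.
- have := is_derive_row (fun j => is_derive_coord (rshift n (rshift n j)) du).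
  by rewrite -[X in is_derive _ _ _ X -> _]/(pA (v (u t))) pA_triple.
Qed.

(** On V = y the connection does not see [v], because the Cartan tensor vanishes there; so the
    velocity equation can be solved for the second derivative. *)
Lemma nab_velocity z v dv : S z -> nab F z v z.2 dv = dv + nab F z 0 z.2 0.
Proof.
move=> Sz; apply: (inner_inj2 HF Sz) => w; rewrite innerDl mulrDr !(nab_inner HF _ _ _ _ Sz).
by rewrite !(dmetric_yl HF _ _ Sz) inner0l; ring.
Qed.

Lemma nab_shift z v V dV : S z -> nab F z v V dV = dV + nab F z v V 0.
Proof.
move=> Sz; apply: (inner_inj2 HF Sz) => w; rewrite innerDl mulrDr !(nab_inner HF _ _ _ _ Sz).
by rewrite inner0l; ring.
Qed.

End FrenetEquations.

Arguments frenet_velocity {R n} F z A.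
Arguments frenet_normal {R n} F z A.

Section CircleExistence.
Context {R : realType} {n : nat} {M : smooth_manifold R n} (F : finsler M).
Local Notation E := 'rV[R]_n.

Lemma smooth_curve_chart (a : chart M) (J : set R) (x : R -> E) : open J ->
  (forall t, J t -> chart_cod a (x t)) -> smooth_on J x -> smooth_curve J (chart_inv a \o x).
Proof.
move=> oJ xa sx; split=> [t|b k].
  rewrite inE => Jt; apply: continuous_comp; first exact: (Ck_continuous (sx 0%N) Jt).
  by apply: (chart_inv_continuous (s := M)); rewrite inE; exact: xa.
have oU : open (overlap (M := M) id a b) by apply: open_overlap => p; exact: cvg_id.
have oK : open (J `&` (chart_inv a \o x) @^-1` chart_dom b).
  rewrite openE => t [Jt bt]; apply: filterI; first exact: open_nbhs_nbhs.
  have Ux : overlap (M := M) id a b (x t) by split; [exact: xa|].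
  apply: (@filterS _ (nbhs t) _ (x @^-1` overlap (M := M) id a b)); first by move=> s [].
  exact: (Ck_continuous (sx 0%N) Jt (open_nbhs_nbhs (conj oU Ux))).
have -> : chart_map b \o (chart_inv a \o x) = local_rep (M := M) id a b \o x by [].
apply: (Ck_comp (fin_dim_rV n) (fin_dim_rV n) oK oU).
- by move=> t [Jt bt]; split; [exact: xa|].
- by apply: Ck_sub (sx k) => t [].
- exact: ((conformal_to_self_id F).1.2 a b k).
Qed.

Lemma unit_speed_chart (a : chart M) (J : set R) (c : R -> M) : open J -> smooth_curve J c ->
  (forall t, J t -> chart_dom a (c t) /\ F a (velocity_lift c a t) = 1) -> unit_speed F J c.
Proof.
move=> oJ sc ua b t Jt bt; have [at_ F1] := ua t Jt.
have [ax ix] := chart_mapP at_.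
have := finsler_transition F (z := velocity_lift c a t) (a := a) (b := b) ax.
rewrite /= ix => /(_ bt) E1; rewrite -F1 -E1; congr (F b _).
apply/pair_equal_spec; split; first by rewrite /transition /= ix.
exact: (velocity_push oJ sc (conformal_to_self_id F) Jt at_ bt sc).
Qed.

(** A solution of the Frenet system keeps B(A, y) = 0 and hence B(y, y) = 1, so it has unit speed,
    [A] is its acceleration, and the covariant derivative of [A] is along y. *)
Lemma circle_exists (a : chart M) (x0 y0 A0 : E) : chart_cod a x0 -> F a (x0, y0) = 1 ->
  finsler_inner (F a) (x0, y0) A0 y0 = 0 ->
  exists (I : set R) (c : R -> M), [/\ geodesic_circle F I c, I 0, chart_dom a (c 0),
    velocity_lift c a 0 = (x0, y0) &
    derive1 (velocity c a) 0 = frenet_velocity (F a) (x0, y0) A0].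
Proof.
move=> ax0 F1 A0y0; have HF := local_finsler_chart F a.
have S0 : slit_over (chart_cod a) (x0, y0) by split => //; exact: (unit_velocity_neq0 ax0 F1).
have [T [x [y [A [T0 [x00 y00 A00] sx xyA]]]]] := frenet_solution HF A0 S0.
set J := [set t : R | `|t| < T] in sx.
have J0 : J 0 by rewrite /J /= normr0.
have JE : J = ball (0 : R) T by apply/seteqP; split => t; rewrite /J /ball /= sub0r normrN.
have oJ : open J by rewrite JE; exact: ball_open.
have iJ : is_interval J.
  move=> r s; rewrite /J /= => Jr Js t /andP[rt ts].
  move: Jr Js; rewrite !ltr_norml => /andP[r1 r2] /andP[s1 s2].
  by rewrite (lt_le_trans r1 rt) (le_lt_trans ts s2).
have xa t : J t -> chart_cod a (x t) by move=> /xyA[[]].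
pose c := chart_inv a \o x.
have sc : smooth_curve J c by exact: smooth_curve_chart.
have ca t : J t -> chart_dom a (c t) /\ chart_map a (c t) = x t by move/xa/chart_invP.
have dom t : J t -> curve_dom (I := J) (c := c) a t by move=> Jt; split => //; exact: (ca t Jt).1.
have vE t : J t -> velocity c a t = y t.
  move=> Jt; apply: is_derive1; have [_ dx _ _] := xyA t Jt.
  apply: near_eq_is_derive dx; apply: filterS (open_nbhs_nbhs (conj oJ Jt)) => s Js.
  by rewrite /= (ca s Js).2.
have lE t : J t -> velocity_lift c a t = (x t, y t).
  by move=> Jt; rewrite /velocity_lift vE// (ca t Jt).2.
have wE t : J t -> derive1 (velocity c a) t = frenet_velocity (F a) (x t, y t) (A t).
  move=> Jt; apply: is_derive1; have [_ _ dy _] := xyA t Jt.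
  apply: near_eq_is_derive dy; apply: filterS (open_nbhs_nbhs (conj oJ Jt)) => s Js.
  by rewrite vE.
have accE t : J t -> acceleration F c a t = A t.
  move=> Jt; have [St _ _ _] := xyA t Jt.
  rewrite -acceleration_cov (covE F sc _ (dom t Jt)) wE// lE// vE//.
  rewrite (nab_velocity HF (z := (x t, y t)) _ _ St) /frenet_velocity /=.
  by rewrite subrK.
pose z t := (x t, y t).
have dz t : J t -> is_derive t (1 : R) z (y t, frenet_velocity (F a) (z t) (A t)).
  by move=> /xyA[_ dx dy _]; exact: is_derive_pair.
pose m t := finsler_inner (F a) (z t) (A t) (y t).
pose e t := finsler_inner (F a) (z t) (y t) (y t).
have nAE t : J t -> nab (F a) (z t) (frenet_velocity (F a) (z t) (A t)) (A t)
    (frenet_normal (F a) (z t) (A t)) =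
    (- (finsler_inner (F a) (z t) (A t) (A t) / finsler_inner (F a) (z t) (y t) (y t))) *: y t.
  move=> Jt; have [St _ _ _] := xyA t Jt.
  by rewrite (nab_shift HF _ _ _ St) /frenet_normal addrAC addNr add0r scaleNr.
have nyE t : J t -> nab (F a) (z t) (frenet_velocity (F a) (z t) (A t)) (y t)
    (frenet_velocity (F a) (z t) (A t)) = A t.
  move=> Jt; have [St _ _ _] := xyA t Jt.
  by rewrite (nab_velocity HF (z := z t) _ _ St) /frenet_velocity subrK.
have dm t : J t -> is_derive t (1 : R) m 0.
  move=> Jt; have [St _ dy dA] := xyA t Jt.
  apply: is_derive_eq (is_derive_inner HF (dz t Jt) dA dy St) _.
  rewrite -(nab_metric HF _ _ _ _ _ St) [X in finsler_inner _ _ X _ + _](nAE t Jt).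
  rewrite [X in _ + finsler_inner _ _ _ X](nyE t Jt) innerZl mulNr divfK ?addNr//.
  by rewrite gt_eqF//; apply: (local_posdef HF St); case: St.
have mE t : J t -> m t = 0.
  by move=> Jt; rewrite (derive0_cst_itv iJ dm Jt J0) /m /z x00 y00 A00.
have de t : J t -> is_derive t (1 : R) e 0.
  move=> Jt; have [St _ dy dA] := xyA t Jt.
  apply: is_derive_eq (is_derive_inner HF (dz t Jt) dy dy St) _.
  rewrite -(nab_metric HF _ _ _ _ _ St) [X in finsler_inner _ _ X _ + _](nyE t Jt).
  rewrite [X in _ + finsler_inner _ _ _ X](nyE t Jt) (innerC HF (y t) _ St).
  by rewrite -/(m t) mE// addr0.
have F2E t : J t -> F a (z t) = 1.
  move=> Jt; have [St _ _ _] := xyA t Jt.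
  have : e t = 1.
    rewrite (derive0_cst_itv iJ de Jt J0) /e /z x00 y00.
    by have /= -> := inner_yy HF S0; rewrite /F2 F1 expr1n.
  have /= := inner_yy HF St; rewrite -/(z t) -/(e t) => -> /eqP.
  rewrite /F2 sqrf_eq1 => /orP[/eqP//|/eqP F0].
  by have := finsler_ge0 F (xa t Jt : chart_cod a (z t).1); rewrite F0 oppr_ge0 lt_geF.
exists J, c; split=> //; [|exact: (ca 0 J0).1|by rewrite lE// x00 y00|by rewrite wE// x00 y00 A00].
apply/geodesic_circleP; split=> //.
- by split => //; exists 0.
- by apply: (unit_speed_chart oJ sc) => t Jt; split; [exact: (ca t Jt).1|rewrite lE//; exact: F2E].
move=> t Jt; exists a; first exact: (ca t Jt).1.
have [St _ _ dA] := xyA t Jt.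
exists (- (finsler_inner (F a) (z t) (A t) (A t) / finsler_inner (F a) (z t) (y t) (y t))).
have dacc : is_derive t (1 : R) (acceleration F c a) (frenet_normal (F a) (z t) (A t)).
  apply: near_eq_is_derive dA; apply: filterS (open_nbhs_nbhs (conj oJ Jt)) => s Js.
  by rewrite accE.
rewrite (covE F sc _ (dom t Jt)) (is_derive1 dacc) accE// lE// wE// vE//.
exact: nAE.
Qed.

End CircleExistence.

(** * Preserving circles implies the Schwarzian equation *)

Section CirclesToMobius.
Context {R : realType} {n : nat} {M : smooth_manifold R n} (F : finsler M).
Local Notation E := 'rV[R]_n.
Context {f : M -> M} {phi : M -> R} (cf : conformal_to_self F f phi).
Hypothesis mf : maps_geodesic_circles F f.
Context (a : chart M).
Let pa := phi \o chart_inv a.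
Local Notation W := (gradient (F a) pa).
Local Notation B := (finsler_inner (F a)).
Local Notation T := (dmetric (F a)).
Local Notation S := (slit_over (chart_cod a)).
Let HF := local_finsler_chart F a.
Let spa : smooth_on (chart_cod a) pa := cf.2.1 a.

(** [maps_geodesic_circles] supplies some [s]; its derivative is forced, since [f] multiplies F by
    e^phi and both curves have unit speed. *)
Lemma reparametrized_speed (I : set R) (c : R -> M) (J : set R) (s : R -> R) :
  open J -> smooth_curve I c -> unit_speed F I c -> smooth_on J s -> (forall t, J t -> I (s t)) ->
  open I -> (forall t, J t -> 0 < derive1 s t) ->
  smooth_curve J (f \o c \o s) -> unit_speed F J (f \o c \o s) ->
  forall t, J t -> derive1 s t = expR (- phi (c (s t))).
Proof.
move=> oJ sc uc ss sJI oI s0 sd ud t Jt.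
have [b bt] := chart_cover (c (s t)); have [d dt] := chart_cover (f (c (s t))).
have se := smooth_curve_reparam oI sc oJ ss sJI.
have Dt : curve_dom (I := J) (c := c \o s) b t by [].
have bx := (chart_mapP bt).1; have ix := (chart_mapP bt).2.
have vE := velocity_push oJ se cf Jt bt dt sd.
have h1 := ud d t Jt dt; have h2 := uc b (s t) (sJI t Jt) bt.
have lE : velocity_lift (f \o c \o s) d t =
    tangent_map (local_rep f b d) (velocity_lift (c \o s) b t).
  apply/pair_equal_spec; split; last exact: vE.
  by rewrite /local_rep /= ix.
have Fc := cf.2.2 b d (velocity_lift (c \o s) b t) bx; rewrite /= ix in Fc.
rewrite lE (Fc dt) /velocity_lift (velocity_reparam sc ss sJI Dt) in h1.
rewrite (finsler_homogeneous F _ bx (s0 t Jt)) in h1.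
have e0 : expR (phi (c (s t))) != 0 by rewrite gt_eqF// expR_gt0.
apply: (mulfI e0); rewrite -expRD subrr expR0 -[RHS]h1 /=.
by rewrite [X in _ = _ * (_ * X)]h2 mulr1.
Qed.

(** The second derivative of the geodesic with velocity [z.2], so that [A + spr z] is
    [frenet_velocity (F a) z A]. *)
Let spr (z : E * E) : E := - nab (F a) z 0 z.2 0.

Let condition x y A : chart_cod a x -> F a (x, y) = 1 -> B (x, y) A y = 0 ->
  exists m, nab (F a) (x, y) (A + spr (x, y)) (W (x, y)) ('D_(y, A + spr (x, y)) W (x, y))
    - 'D_y pa x *: W (x, y) = m *: y.
Proof.
move=> ax F1 Ay.
have [I [c [circ I0 a0 lE wE]]] := circle_exists ax F1 Ay.
have [J [s [oiJ ss s0 sI circ']]] := mf circ.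
have [oiI sc uc cc] := (geodesic_circleP F I c).1 circ.
have [_ sd ud cd] := (geodesic_circleP F J (f \o c \o s)).1 circ'.
have oI : open I by case: oiI. have oJ : open J by case: oiJ.
have sJI t : J t -> I (s t) by move=> Jt; rewrite -sI; exists t.
have speed := reparametrized_speed oJ sc uc ss sJI oI s0 sd ud.
(* [s] maps onto [I], so some parameter [t0] corresponds to the point where the circle has its
   prescribed data. *)
have [t0 Jt0 st0] : exists2 t, J t & s t = 0 by move: I0; rewrite -sI => -[t Jt st]; exists t.
have [b bt] := chart_cover (f (c (s t0))).
have at0 : curve_dom (I := J) (c := c \o s) a t0 by split => //=; rewrite st0.
have bt0 : curve_dom (I := J) (c := f \o c \o s) b t0 by [].
have Da : curve_dom (I := I) (c := c) a (s t0) by split; [exact: sJI|rewrite /= st0].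
have circa : circular_at F (c := c) a (s t0).
  have [a' a't cc'] := cc _ (sJI t0 Jt0).
  by apply: (circular_at_change oiI sc uc _ Da cc'); split; [exact: sJI|].
have circb : circular_at F (c := f \o c \o s) b t0.
  have [b' b't cd'] := cd _ Jt0.
  exact: (circular_at_change oiJ sd ud (conj Jt0 b't) bt0 cd').
have [m] := (circular_push oiI sc uc oiJ ss sJI cf speed sd at0 bt0 circa).1 circb.
have D0 : curve_dom (I := I) (c := c) a 0 by [].
have Sz : S (x, y) by split => //; exact: (unit_velocity_neq0 ax F1).
rewrite st0 (covE F sc _ D0) lE wE.
have dW : is_derive (0 : R) (1 : R) (fun t => W (velocity_lift c a t)) ('D_(y, frenet_velocity
  (F a) (x, y) A) W (x, y)).
  have := is_derive_comp_diff (is_derive_lift sc D0); rewrite lE wE => dd.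
  have := dd _ _ (diff_gradient HF spa Sz); have [_ ->] : (chart_map a
    (c 0) = x) /\ velocity c a 0 = y.
    by case: lE.
  by [].
rewrite (is_derive1 dW); have [-> ->] : (chart_map a (c 0) = x) /\ velocity c a 0 = y by case: lE.
by move=> H; exists m; rewrite -H.
Qed.

Let HH z w := 2 * 'D_(z.2) ('D_w pa) z.1 - T z (z.2, 0) (W z) w + T z (W z, 0) w z.2
  - T z (w, 0) (W z) z.2.

Let unit_condition x y A : chart_cod a x -> F a (x, y) = 1 -> B (x, y) A y = 0 ->
  exists m, forall w, HH (x, y) w - T (x, y) (0, A + spr (x, y)) (W (x, y)) w =
    2 * 'D_y pa x * 'D_w pa x + 2 * m * B (x, y) y w.
Proof.
move=> ax F1 Ay; have Sz : S (x, y) by split => //; exact: (unit_velocity_neq0 ax F1).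
have [m mE] := condition ax F1 Ay; exists m => w.
have := nab_gradient_inner HF (A + spr (x, y)) w spa Sz; rewrite -/(HH (x, y) w) => <-.
have -> : nab (F a) (x, y) (A + spr (x, y)) (W (x, y)) ('D_(y, A + spr (x, y)) W (x, y)) =
    'D_y pa x *: W (x, y) + m *: y.
  by rewrite -mE [RHS]addrC subrK.
rewrite innerDl !innerZl (inner_gradient HF spa w Sz) /=.
by move: ('D_y pa x) ('D_w pa x) => p q; ring.
Qed.

(** The conditions for [A] and for 0 differ by T (0, A) W w, which is therefore a multiple of B(y,
    w); w = y shows that the multiple is 0. Orthogonality of [A] is no restriction, as the Cartan
    tensor vanishes on y. *)
Let unit_cartan x y : chart_cod a x -> F a (x, y) = 1 ->
  (forall u w, T (x, y) (0, u) (W (x, y)) w = 0) /\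
  exists m, forall w, HH (x, y) w = 2 * 'D_y pa x * 'D_w pa x + 2 * m * B (x, y) y w.
Proof.
move=> ax F1; have Sz : S (x, y) by split => //; exact: (unit_velocity_neq0 ax F1).
have Byy : B (x, y) y y = 1 by have /= -> := inner_yy HF Sz; rewrite /F2 F1 expr1n.
have [m0 m0E] := unit_condition ax F1 (inner0l (F a) (x, y) y).
have C0 u w : T (x, y) (0, u) (W (x, y)) w = 0.
  pose A := u - B (x, y) u y *: y.
  have Ay : B (x, y) A y = 0 by rewrite /A innerDl innerNl innerZl Byy mulr1 subrr.
  have [m mE] := unit_condition ax F1 Ay.
  have diff w' : T (x, y) (0, A) (W (x, y)) w' = 2 * (m0 - m) * B (x, y) y w'.
    have h1 := mE w'; have h2 := m0E w'; rewrite add0r in h2.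
    rewrite (dmetric_vertD HF _ _ _ _ Sz) in h1.
    by move: h1 h2; move: ('D_y pa x) ('D_w' pa x) => p q h1 h2; lra.
  have m0m : m0 - m = 0.
    have := diff y; rewrite Byy mulr1 (dmetric_yr HF (z := (x, y)) _ _ Sz) => /esym/eqP.
    by rewrite mulf_eq0 pnatr_eq0/= => /eqP.
  have -> : u = A + B (x, y) u y *: y by rewrite subrK.
  rewrite (dmetric_vertD HF _ _ _ _ Sz) diff m0m mulr0 mul0r add0r.
  by rewrite (dmetric_vertZ HF _ _ _ _ Sz) (dmetric_vy HF (z := (x, y)) _ _ Sz) mulr0.
split=> //; exists m0 => w; have := m0E w; rewrite C0 subr0; exact.
Qed.

(** Circles give information at unit vectors only; homogeneity extends it to the slit bundle. *)
Let unit_scaling z : S z -> exists r y1, [/\ 0 < r, z = (z.1, r *: y1) & F a (z.1, y1) = 1].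
Proof.
move=> Sz; have [az z0] := Sz; have B0 := local_posdef HF Sz z0.
have F0 : 0 < F a z.
  rewrite lt_def finsler_ge0// andbT; apply/negP => /eqP F0.
  by move: B0; rewrite (inner_yy HF Sz) /F2 F0 expr0n ltxx.
exists (F a z), ((F a z)^-1 *: z.2); split=> //.
  by rewrite scalerA divff ?gt_eqF// scale1r; case: z {Sz az z0 B0 F0}.
rewrite (finsler_homogeneous F _ az) ?invr_gt0//.
have -> : (z.1, z.2) = z by case: z {Sz az z0 B0 F0}.
by rewrite mulVf// gt_eqF.
Qed.

Lemma circles_schwarzian X z : S z -> schwarzian (F a) pa X z = 0.
Proof.
move=> Sz0; apply: (schwarzian_eq0 HF spa _ _ X Sz0) => {X z Sz0} z => [u w|] Sz.
  have [r [y1 [r0 -> F1]]] := unit_scaling Sz; have [az _] := Sz.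
  have S1 : S (z.1, y1) by split => //; exact: (unit_velocity_neq0 az F1).
  rewrite (gradient_homogeneous HF spa S1 r0).
  have -> : u = r *: (r^-1 *: u) by rewrite scalerA divff ?gt_eqF// scale1r.
  by rewrite (dmetric_scale HF _ _ _ _ S1 r0) (unit_cartan az F1).1.
have [r [y1 [r0 zE F1]]] := unit_scaling Sz; have [az _] := Sz.
have S1 : S (z.1, y1) by split => //; exact: (unit_velocity_neq0 az F1).
have [_ [m mE]] := unit_cartan az F1; exists m => w; rewrite -/(HH z w).
have hor b c d : T z (b, 0) c d = T (z.1, y1) (b, 0) c d.
  by rewrite zE -(dmetric_scale HF b 0 c d S1 r0) scaler0.
have WE : W z = W (z.1, y1) by rewrite zE (gradient_homogeneous HF spa S1 r0).
have yE : z.2 = r *: y1 by rewrite [in LHS]zE.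
have BE u v : B z u v = B (z.1, y1) u v by rewrite [in LHS]zE (inner_scale HF _ _ S1 r0).
have dpa := diff_phi HF spa az.
have dpw : differentiable ('D_w pa) z.1.
  exact: (smooth_differentiable (fin_dim_rV n) fin_dim_R (local_open HF) (smooth_derive w spa) az).
(* [W] and the x-derivatives of the metric have degree 0 in y, so [HH] has degree 1, like the right
   side of [mE] with the same [m]. *)
have -> : HH z w = r * HH (z.1, y1) w.
  have dZ : 'D_(r *: y1) ('D_w pa) z.1 = r * 'D_y1 ('D_w pa) z.1 := diff_dirZ r y1 dpw.
  rewrite /HH /= !hor WE yE dZ.
  rewrite (dmetric_horZ HF r y1 _ _ S1) !(dmetricZr HF _ r _ _ S1).
  by move: ('D_y1 ('D_w pa) z.1) => p; ring.
have dZ : 'D_(r *: y1) pa z.1 = r * 'D_y1 pa z.1 := diff_dirZ r y1 dpa.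
rewrite mE BE yE dZ innerZl.
by move: ('D_y1 pa z.1) ('D_w pa z.1) => p q; ring.
Qed.

End CirclesToMobius.

(** * Two global vector fields on the slit tangent bundle *)

Section TestFields.
Context {R : realType} {n : nat} {M : smooth_manifold R n} (F : finsler M).
Local Notation E := 'rV[R]_n.
Context {phi : M -> R} (sphi : smooth_function phi).
Let pa (a : chart M) := phi \o chart_inv a.

Definition spray_part (a : chart M) (z : E * E) : E := - nab (F a) z 0 z.2 0.

Section Change.
Context (a b : chart M).
Let h := local_rep (M := M) id a b.
Let U := overlap (M := M) id a b.
Let oU : open U. Proof. by apply: open_overlap => p; exact: cvg_id. Qed.
Let Ua : U `<=` chart_cod a. Proof. by move=> ? []. Qed.
Let HU : local_finsler U (F a) := local_finsler_sub F oU Ua.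
Let Hb := local_finsler_chart F b.
Let sh : smooth_on U h := (conformal_to_self_id F).1.2 a b.
Let s0 : smooth_on U (cst (0 : R)). Proof. by move=> k; exact: Ck_cst. Qed.
Let hU x : U x -> chart_cod b (h x).
Proof. by move=> [_ bx]; exact: (chart_mapP bx).1. Qed.
Let hF z : U z.1 -> F b (tangent_map h z) = expR (cst (0 : R) z.1) * F a z.
Proof. by move=> [az bz]; exact: (conformal_to_self_id F).2.2. Qed.

(** Checked by pairing with images of vectors: [inner_nat] with trivial factor identifies the
    metrics, and [phi] has the same differential in both charts. *)
Lemma gradient_change z : slit_over U z ->
  gradient (F b) (pa b) (tangent_map h z) = 'D_(gradient (F a) (pa a) z) h z.1.
Proof.
move=> Sz; have Uz : U z.1 by case: Sz.
have Sz' := tangent_slit HU Hb hU hF Sz.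
apply: (inner_inj Hb Sz') => w'; have [w <-] := tangent_onto HU Hb sh hU hF w' Uz.
have spU : smooth_on U (pa a) by move=> k; exact: (Ck_sub Ua (sphi a k)).
rewrite (inner_gradient Hb (sphi b) _ Sz') (inner_nat HU Hb sh s0 hU hF _ _ Sz).
rewrite expR0 expr1n mul1r (inner_gradient HU spU w Sz) /=.
have d1 := is_derive_comp_diff (diff_is_derive w (diff_h HU sh Uz)) (diff_phi Hb (sphi b) (hU Uz)).
have near_eq : \forall x \near z.1, pa b (h x) = pa a x.
  apply: filterS (open_nbhs_nbhs (conj oU Uz)) => x [ax bx].
  by rewrite /pa /h /local_rep /= (chart_mapP bx).2.
by rewrite (@derive_val _ _ _ _ _ _ _ (near_eq_is_derive near_eq d1)).
Qed.

(** [spray_part] is the [v] for which [nab F z v z.2 v] vanishes. By [nab_nat] with trivial factor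
    the vanishing persists in the second chart, and solving there for the second derivative gives
    this law. *)
Lemma spray_part_change z : slit_over U z ->
  spray_part b (tangent_map h z) = 'D_(z.2) ('D_(z.2) h) z.1 + 'D_(spray_part a z) h z.1.
Proof.
move=> Sz; have Uz : U z.1 by case: Sz.
have Sz' := tangent_slit HU Hb hU hF Sz.
have := nab_nat HU Hb sh s0 hU hF (spray_part a z) z.2 (spray_part a z) Sz.
rewrite !derive_cst !scale0r !addr0.
have -> : gradient (F a) (cst 0) z = 0.
  by apply: (inner_inj HU Sz) => w; rewrite (inner_gradient HU s0 w Sz) derive_cst inner0l.
rewrite scaler0 subr0 (nab_velocity HU _ _ Sz) addNr derive0.
have := nab_velocity Hb ('D_(z.2) ('D_(z.2) h) z.1 + 'D_(spray_part a z) h z.1)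
  ('D_(z.2) ('D_(z.2) h) z.1 + 'D_(spray_part a z) h z.1) Sz'.
rewrite {1}/tangent_map /= => -> /eqP; rewrite addr_eq0 => /eqP ->.
by rewrite /spray_part.
Qed.

Lemma derive_tangent_map z X : slit_over U z -> 'D_X (tangent_map h) z =
  ('D_(X.1) h z.1, 'D_(X.1) ('D_(z.2) h) z.1 + 'D_(X.2) h z.1).
Proof.
by move=> Sz; rewrite (@derive_val _ _ _ _ _ _ _ (is_derive_tangent HU sh X Sz)).
Qed.

End Change.

Lemma vertical_field_smooth a : smooth_on (slit a) (fun z => (0 : E, gradient (F a) (pa a) z)).
Proof.
have HF := local_finsler_chart F a; have oS := open_slit_over (local_open HF).
move=> k; apply: Ck_pair; [exact: oS|exact: Ck_cst|exact: (smooth_gradient HF (sphi a) k)].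
Qed.

Lemma vertical_field_transition a b z : slit a z -> chart_dom b (chart_inv a z.1) ->
  (0 : E, gradient (F b) (pa b) (tangent_map (transition a b) z)) =
  'D_(0, gradient (F a) (pa a) z) (tangent_map (transition a b)) z.
Proof.
move=> [az z0] bz; have Sz : slit_over (overlap (M := M) id a b) z by [].
rewrite [RHS](derive_tangent_map (0, gradient (F a) (pa a) z) Sz) /= !derive0 add0r.
by rewrite -(gradient_change Sz).
Qed.

(** The vertical lift of the gradient. Its projection to [M] is zero, so only the covariant
    derivative survives in the Schwarzian. *)
Definition vertical_field := SlitVectorField vertical_field_smooth vertical_field_transition.

Lemma vertical_fieldE a z : field_comp vertical_field a z = (0, gradient (F a) (pa a) z).
Proof. by []. Qed.

Lemma spray_field_smooth a : smooth_on (slit a) (fun z => (z.2, spray_part a z)).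
Proof.
have HF := local_finsler_chart F a; have oS := open_slit_over (local_open HF).
move=> k; have Cid : Ck k (slit a) (fun z : E * E => z) by exact: Ck_id.
have C0 : Ck k (slit a) (fun=> 0 : E) by exact: Ck_cst.
have C2 : Ck k (slit a) (fun z : E * E => z.2) by exact: Ck_snd.
apply: Ck_pair => //; apply: (@Ck_eq _ _ _ k (slit a) (fun z => (-1) *: nab (F a) z 0 z.2 0)) => //.
  by move=> z _; rewrite scaleN1r.
apply: Ck_scale => //; first exact: Ck_cst.
exact: (smooth_nab HF oS).
Qed.

Lemma spray_field_transition a b z : slit a z -> chart_dom b (chart_inv a z.1) ->
  ((tangent_map (transition a b) z).2, spray_part b (tangent_map (transition a b) z)) =
  'D_(z.2, spray_part a z) (tangent_map (transition a b)) z.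
Proof.
move=> [az z0] bz; have Sz : slit_over (overlap (M := M) id a b) z by [].
rewrite [RHS](derive_tangent_map (z.2, spray_part a z) Sz) /=.
by rewrite -(spray_part_change Sz).
Qed.

Definition spray_field := SlitVectorField spray_field_smooth spray_field_transition.

Lemma spray_fieldE a z : field_comp spray_field a z = (z.2, spray_part a z).
Proof. by []. Qed.

(** Paired with [w], the derivative of [W] contributes - T (0, W) W w and the connection half of T
    (0, W) W w; as their sum is 0, so is this term. *)
Lemma mobius_cartan a z w :
  (forall z, slit a z -> schwarzian (F a) (pa a) (vertical_field a) z = 0) -> slit a z ->
  dmetric (F a) z (0, gradient (F a) (pa a) z) (gradient (F a) (pa a) z) w = 0.
Proof.
move=> mob Sz; have HF := local_finsler_chart F a; have := mob z Sz.
rewrite /schwarzian /cartan_nabla vertical_fieldE /=.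
rewrite inner0r scale0r scaler0 !subr0; set W := gradient (F a) (pa a) z => e0.
have h0 : finsler_inner (F a) z ('D_(0, W) (gradient (F a) (pa a)) z + connection_form (F a) z
  (0, W) W) w = 0.
  by rewrite e0 inner0l.
have N0 : nonlinear_vec (F a) z 0 = 0 by rewrite (nonlinear_vecE HF _ Sz) derive0.
have h1 := gradient_vertical HF W w (sphi a) Sz.
have h2 := connection_inner HF (0, W) W w Sz.
have T0 X u : dmetric (F a) z X u 0 = 0.
  by rewrite -(scale0r (0 : E)) (dmetricZr HF _ _ _ _ Sz) mul0r.
have TX0 u v : dmetric (F a) z (0, 0) u v = 0.
  by rewrite dmetric.unlock; exact: derive0.
rewrite /= N0 oppr0 !T0 TX0 !(addr0, add0r, subr0) in h2.
rewrite innerDl h1 -/W in h0.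
have swap : dmetric (F a) z (0, w) W W = dmetric (F a) z (0, W) W w.
  by rewrite (dmetric_vertC HF _ _ _ Sz) (dmetricC HF _ _ _ Sz).
by rewrite swap in h2; lra.
Qed.

(** The vanishing of the Cartan tensor on [W] lets [v] be replaced by the spray; on the spray field
    the equation is the Schwarzian one, and the multiplier is its trace coefficient. *)
Lemma mobius_nab a z v :
  (forall (X : slit_vector_field M) a z, slit a z -> schwarzian (F a) (pa a) (X a) z = 0) ->
  slit a z -> exists m,
  nab (F a) z v (gradient (F a) (pa a) z) ('D_(z.2, v) (gradient (F a) (pa a)) z)
  - 'D_(z.2) (pa a) z.1 *: gradient (F a) (pa a) z = m *: z.2.
Proof.
move=> mob Sz; have HF := local_finsler_chart F a; set W := gradient (F a) (pa a).
have C0 := cartan_gradient_eq0 HF (sphi a) (fun z w Sz => mobius_cartan w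
  (mob vertical_field a) Sz).
have -> : nab (F a) z v (W z) ('D_(z.2, v) W z) =
    nab (F a) z (spray_part a z) (W z) ('D_(z.2, spray_part a z) W z).
  apply: (inner_inj2 HF Sz) => w.
  have h1 := nab_gradient_inner HF v w (sphi a) Sz.
  have h2 := nab_gradient_inner HF (spray_part a z) w (sphi a) Sz.
  rewrite (C0 z _ w Sz) in h1; rewrite (C0 z _ w Sz) in h2.
  exact: etrans h1 (esym h2).
have := mob spray_field a z Sz.
rewrite /schwarzian /cartan_nabla spray_fieldE /=.
rewrite (inner_gradient HF (sphi a) _ Sz) -/W nab.unlock.
set c := _ * _ => e0; exists c; apply/eqP; rewrite -subr_eq0; apply/eqP; exact: e0.
Qed.

End TestFields.

(** * Mobius maps preserve geodesic circles *)

Section MobiusToCircles.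
Context {R : realType} {n : nat} {M : smooth_manifold R n} (F : finsler M).
Local Notation E := 'rV[R]_n.

(** Smoothness is local: near each parameter the image curve is read through a chart around the
    corresponding point of [e]. *)
Lemma smooth_curve_push (f : M -> M) (J : set R) (e : R -> M) : smooth_map f -> open J ->
  smooth_curve J e -> smooth_curve J (f \o e).
Proof.
move=> [cf sf] oJ se; have ce t : J t -> {for t, continuous e} by move=> Jt; apply: se.1;
  rewrite inE.
split=> [t|b k].
  by rewrite inE => Jt; apply: continuous_comp; [exact: ce|exact: cf].
apply: Ck_local => t [Jt bt]; have [a at_] := chart_cover (e t).
pose D := curve_dom (I := J) (c := e) a `&` (f \o e) @^-1` chart_dom b.
have oU : open (overlap f a b) by exact: open_overlap.
have oDa : open (curve_dom (I := J) (c := e) a) by exact: open_curve_dom.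
have oD : open D.
  rewrite openE => s [Ds bs]; apply: filterI; first exact: (open_nbhs_nbhs (conj oDa Ds)).
  have cs : {for s, continuous (f \o e)} by apply: continuous_comp; [apply: ce; case: Ds|exact: cf].
  exact: (cs _ (open_nbhs_nbhs (conj (chart_dom_open b) bs))).
exists D; first by split.
apply: (@Ck_eq _ _ _ k D (local_rep f a b \o (chart_map a \o e))) => //.
  by move=> s [[_ as_] _]; rewrite /local_rep /= (chart_mapP as_).2.
apply: (Ck_comp (fin_dim_rV n) (fin_dim_rV n) oD oU); last exact: sf.
- by move=> s [[_ as_] bs]; have [h1 h2] := chart_mapP as_; split; rewrite //= h2.
- by apply: Ck_sub (se.2 a k) => s [].
Qed.

Lemma smooth_function_curve (phi : M -> R) (J : set R) (c : R -> M) : smooth_function phi ->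
  open J -> smooth_curve J c -> smooth_on J (phi \o c).
Proof.
move=> sphi oJ sc k; apply: Ck_local => t Jt; have [a at_] := chart_cover (c t).
have oD : open (curve_dom (I := J) (c := c) a) by exact: open_curve_dom.
exists (curve_dom (I := J) (c := c) a); first by split.
apply: (@Ck_eq _ _ _ k _ ((phi \o chart_inv a) \o (chart_map a \o c))) => //.
  by move=> s [_ as_]; rewrite /= (chart_mapP as_).2.
apply: (Ck_comp (fin_dim_rV n) fin_dim_R oD (@open_chart_cod _ _ _ a)).
- by move=> s [_ as_]; exact: (chart_mapP as_).1.
- exact: sc.2.
- exact: sphi.
Qed.

Lemma mobius_circles (f : M -> M) (phi : M -> R) : conformal_to_self F f phi ->
  (forall (X : slit_vector_field M) a z, slit a z ->
    schwarzian (F a) (phi \o chart_inv a) (X a) z = 0) -> maps_geodesic_circles F f.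
Proof.
move=> cf mob I c circ; have [oiI sc uc cc] := (geodesic_circleP F I c).1 circ.
have oI : open I by case: oiI.
(* The speed, as a function of the parameter of [c], that compensates the factor e^phi of [f]. *)
pose psi t := expR (- phi (c t)).
have spsi : smooth_on I psi.
  move=> k; have Cp := smooth_function_curve cf.2.1 oI sc k.
  have CN : Ck k I (fun t => - (phi \o c) t).
    apply: (@Ck_eq _ _ _ k I (fun t => (-1) * (phi \o c) t)) => //; first by move=> t _;
      rewrite mulN1r.
    by apply: Ck_mul => //; exact: Ck_cst.
  exact: (Ck_comp fin_dim_R fin_dim_R oI openT (fun _ _ => Logic.I) CN (Ck_expR k openT)).
have psi0 t : I t -> 0 < psi t by move=> _; exact: expR_gt0.
have [J [s [oiJ ss sI ds]]] := reparametrization oiI spsi psi0.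
have oJ : open J by case: oiJ.
have speed t : J t -> derive1 s t = expR (- phi (c (s t))) by move=> Jt;
  exact: (is_derive1 (ds t Jt)).
have s0 t : J t -> 0 < derive1 s t by move=> Jt; rewrite speed// expR_gt0.
have sJI t : J t -> I (s t) by move=> Jt; rewrite -sI; exists t.
have se := smooth_curve_reparam oI sc oJ ss sJI.
have sd : smooth_curve J (f \o c \o s) := smooth_curve_push cf.1 oJ se.
exists J, s; split=> //; apply/geodesic_circleP; split=> //.
  move=> b t Jt bt; have [a at_] := chart_cover (c (s t)).
  have Dt : curve_dom (I := J) (c := c \o s) a t by [].
  have ax := (chart_mapP at_).1; have ix := (chart_mapP at_).2.
  have vE := velocity_push oJ se cf Jt at_ bt sd.
  have lE : velocity_lift (f \o c \o s) b t =
      tangent_map (local_rep f a b) (velocity_lift (c \o s) a t).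
    apply/pair_equal_spec; split; last exact: vE.
    by rewrite /local_rep /= ix.
  have Fc := cf.2.2 a b (velocity_lift (c \o s) a t) ax; rewrite /= ix in Fc.
  rewrite lE (Fc bt) /velocity_lift (velocity_reparam sc ss sJI Dt).
  rewrite (finsler_homogeneous F _ ax (s0 t Jt)).
  have h2 := uc a (s t) (sJI t Jt) at_.
  by rewrite /= [X in _ * (_ * X)]h2 mulr1 speed// -expRD subrr expR0.
move=> t Jt; have [b bt] := chart_cover (f (c (s t))); exists b => //.
have [a at_ circa] := cc (s t) (sJI t Jt).
have at0 : curve_dom (I := J) (c := c \o s) a t by [].
have bt0 : curve_dom (I := J) (c := f \o c \o s) b t by [].
have Da : curve_dom (I := I) (c := c) a (s t) by split; [exact: sJI|].
have Sz := unit_lift_slit uc Da.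
apply/(circular_push oiI sc uc oiJ ss sJI cf speed sd at0 bt0 circa).
have HF := local_finsler_chart F a.
have dW := is_derive_comp_diff (is_derive_lift sc Da) (diff_gradient HF (cf.2.1 a) Sz).
rewrite (covE F sc _ Da) (is_derive1 dW).
exact: (mobius_nab cf.2.1 (derive1 (velocity c a) (s t)) mob Sz).
Qed.

End MobiusToCircles.

Unset Implicit Arguments.

Theorem theorem1p2 (R : realType) (n : nat) (M : smooth_manifold R n)
    (F : finsler M) :
  conformal_transformations F = mobius_transformations F <->
  (forall f : M -> M,
     conformal_transformations F f -> maps_geodesic_circles F f).
Proof.
split=> [conf f|circ].
  rewrite conf => -[[sf _] [phi cf mob]].
  exact: (mobius_circles (conj sf cf) mob).
(* One inclusion only forgets the Schwarzian equation; the other keeps the same factor [phi]. *)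
apply/seteqP; split=> f [df]; last by move=> [phi cf _]; split => //; exists phi.
move=> [phi cf]; split=> //; exists phi => // X a z Sz.
apply: (circles_schwarzian (conj df.1 cf)); last exact: Sz.
by apply: circ; split => //; exists phi.
Qed.
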